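(* Let $W\subset X$ be domains in $\mathbb{C}^n$ such that $X$ is a schlicht disc extension of $W$. If $\phi:W\to[-\infty,\infty)$ is upper semicontinuous, then $$S\phi = E_{\mathscr{A}_X^W}\phi \quad\text{on } X,$$ that is, for every $x\in X$, $$\sup\{u(x): u \text{ plurisubharmonic on } X,\ u|_W\leq\phi\}=\inf\Big\{\int_{\mathbb{T}}\phi\circ f\,d\lambda: f\in\mathscr{A}_X^W,\ f(0)=x\Big\}.$$
   Context: A domain is a connected, nonempty, open subset. $\mathbb{D}$ is the open unit disc in $\mathbb{C}$, $\mathbb{T}=\partial\mathbb{D}$, and $\lambda$ is the normalised arc length measure on $\mathbb{T}$. The constant function $-\infty$ is considered plurisubharmonic. $\mathscr{A}_X$ is the set of analytic discs in $X$, i.e. continuous maps $f:\overline{\mathbb{D}}\to X$ that are holomorphic on $\mathbb{D}$, with the topology of uniform convergence on $\overline{\mathbb{D}}$ (the compact-open topology); $f(0)$ is the centre of $f$. For an open subset $W\subset X$, $\mathscr{A}_X^W=\{f\in\mathscr{A}_X: f(\mathbb{T})\subset W\}$, with the subspace topology. For upper semicontinuous $\phi:W\to[-\infty,\infty)$, define $S\phi=\sup\{u: u \text{ plurisubharmonic on } X,\ u|_W\leq\phi\}$ (pointwise supremum) and $E_{\mathscr{A}_X^W}\phi(x)=\inf\{\int_{\mathbb{T}}\phi\circ f\,d\lambda: f\in\mathscr{A}_X^W, f(0)=x\}$ for $x\in X$. Two discs $f_0,f_1\in\mathscr{A}_X^W$ with $f_0(0)=f_1(0)$ are centre-homotopic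 if there is a continuous map $f:\overline{\mathbb{D}}\times[0,1]\to X$ with $f(\cdot,t)\in\mathscr{A}_X^W$ and $f(0,t)=f_0(0)$ for all $t\in[0,1]$, and $f(\cdot,t)=f_t$ for $t=0,1$. A $W$-disc structure on $X$ is a family $\beta=(\beta_\nu)$ of continuous maps $\beta_\nu:U_\nu\to\mathscr{A}_X^W$, where $(U_\nu)$ is an open cover of $X$, such that $\beta_\nu(x)(0)=x$ for all $x\in U_\nu$, and such that whenever $x\in U_\nu\cap U_\mu$, the discs $\beta_\nu(x)$ and $\beta_\mu(x)$ are centre-homotopic. $X$ is a schlicht disc extension of $W$ if $X$ carries a $W$-disc structure $(\beta_\nu)$ for which there is an index $\mu$ such that $U_\mu=W$ and $\beta_\mu(w)$ is the constant disc at $w$ for all $w\in W$. *)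

(* Defs.v *)
(* The complex numbers are R[i] for an arbitrary realType R.
   R[i] itself is not declared as a topological type; the regular module
   R[i]^o is the same type equipped with the topology of the modulus and viewed
   as a normed module over R[i]. C^n is 'rV[R[i]^o]_n (sup norm). *)
From HB Require Import structures.
From mathcomp Require Import all_boot all_order all_algebra.
From mathcomp Require Import complex.
From mathcomp Require Import all_classical all_reals all_analysis.
Import Order.TTheory GRing.Theory Num.Theory numFieldNormedType.Exports.

Set Implicit Arguments.
Unset Strict Implicit.
Unset Printing Implicit Defensive.

Local Open Scope classical_set_scope.
Local Open Scope ring_scope.
Local Open Scope complex_scope.

Section Defs.
Context {R : realType} {n : nat}.
Local Notation C := (R[i]^o).
Implicit Types (W X : set 'rV[C]_n) (f : C -> 'rV[C]_n).

Definition domain X := [/\ open X, connected X & X !=set0].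

Definition open_disc : set C := [set z | `|z| < 1].
Definition closed_disc : set C := [set z | `|z| <= 1].
Definition unit_circle : set C := [set z | `|z| = 1].

(* Integral against the normalised arc length measure of the unit circle,
   parametrised by t |-> e^{it}, 0 <= t <= 2 pi. *)
Definition circle_mean (g : C -> \bar R) : \bar R :=
  (((2 * pi)^-1)%:E *
    \int[lebesgue_measure]_(t in `[0%R, (2 * pi)%R]) g (cos t +i* sin t))%E.

(* phi restricted to U is upper semicontinuous with values in [-oo, +oo[;
   the values of phi outside U are irrelevant. *)
Definition usc_on {T : topologicalType} (U : set T) (phi : T -> \bar R) :=
  forall x, U x ->
    (phi x < +oo)%E /\
    forall a : R, (phi x < a%:E)%E ->
      \forall y \near within U (nbhs x), (phi y < a%:E)%E.

(* The function that is identically -oo is allowed. *)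
Definition subharmonic (U : set C) (v : C -> \bar R) :=
  usc_on U v /\
  forall (z : C) (r : R), 0 < r ->
    [set w : C | `|w - z| <= r%:C] `<=` U ->
    (v z <= circle_mean (fun w => v (z + r%:C * w)%R))%E.

Definition plurisubharmonic X (u : 'rV[C]_n -> \bar R) :=
  usc_on X u /\
  forall a b : 'rV[C]_n,
    subharmonic [set z | X (a + z *: b)] (fun z => u (a + z *: b)).

(* A disc is represented by a total function on C of which only the restriction
   to the closed unit disc matters. [derivable f z 1] is complex
   differentiability, the scalars being R[i]. *)
Definition analytic_disc X f :=
  [/\ {within closed_disc, continuous f},
      forall z, open_disc z -> derivable f z 1 &
      f @` closed_disc `<=` X].

Definition analytic_disc_bd X W f :=
  analytic_disc X f /\ f @` unit_circle `<=` W.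

Definition envelope_psh X W (phi : 'rV[C]_n -> \bar R) x :=
  ereal_sup [set u x | u in
    [set u | plurisubharmonic X u /\ forall w, W w -> (u w <= phi w)%E]].

Definition envelope_disc X W (phi : 'rV[C]_n -> \bar R) x :=
  ereal_inf [set circle_mean (phi \o f) | f in
    [set f | analytic_disc_bd X W f /\ f 0 = x]].

Definition centre_homotopic X W f0 f1 :=
  exists F : C * R -> 'rV[C]_n,
    [/\ {within closed_disc `*` `[0, 1], continuous F},
        forall t, t \in `[0, 1] ->
          analytic_disc_bd X W (fun z => F (z, t)) /\ F (0, t) = f0 0,
        forall z, closed_disc z -> F (z, 0) = f0 z &
        forall z, closed_disc z -> F (z, 1) = f1 z].

(* [{uniform` closed_disc -> _}] carries the topology of uniform convergence
   on the closed disc. *)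
Record disc_structure X W (I : Type) (U : I -> set 'rV[C]_n)
    (beta : I -> 'rV[C]_n -> {uniform` closed_disc -> 'rV[C]_n})
    : Prop := {
  disc_structure_open : forall i, open (U i);
  disc_structure_cover : \bigcup_i U i = X;
  disc_structure_disc : forall i x, U i x -> analytic_disc_bd X W (beta i x);
  disc_structure_continuous : forall i, {within U i, continuous (beta i)};
  disc_structure_centre : forall i x, U i x -> beta i x 0 = x;
  disc_structure_homotopic : forall i j x, U i x -> U j x ->
    centre_homotopic X W (beta i x) (beta j x) }.

Definition schlicht_disc_extension X W :=
  exists (I : Type) (U : I -> set 'rV[C]_n)
    (beta : I -> 'rV[C]_n -> {uniform` closed_disc -> 'rV[C]_n}),
    disc_structure X W U beta /\
    exists i, U i = W /\
      forall w z, W w -> closed_disc z -> beta i w z = w.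

End Defs.

(* Main.v *)
(* Both inequalities rest on trigonometric majorants: an upper semicontinuous
   function of mean < c on the circle is bounded there by Re P for some polynomial
   P with Re P(0) < c.

   S <= E is the sub-mean value property of a plurisubharmonic u along a disc f.
   As u is only known on complex lines, suppose the contrary, let Re P majorise
   u o f on the circle, and maximise u(f(z) + rho v) - Re P(z) + eta |z|^2 - A |v|^2;
   at an interior maximum, comparing f with its tangent line contradicts the
   sub-mean value property of u on that line.

   E <= S: let psi(x) be the infimum of the means of phi over the discs beta_i(x).
   It is upper semicontinuous on X, and psi <= phi on W. The envelope u of psi over
   all discs in X is at most psi, and it is plurisubharmonic, so u <= S phi. To see
   that E phi <= u, let g be a disc in X. Over finitely many arcs of the circle,
   take discs centred at g(e^{it}) on which phi has a mean not much larger than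
   psi(g(e^{it})); neighbouring ones are joined by centre homotopies, traversed in
   so short a time that they do not contribute to the mean. This gives a closed
   loop of discs g(e^{it}) + A_t with A_t(0) = 0. If kappa_l is a trigonometric
   partition of unity concentrated at the points e^{i t_l}, then
     h(z) = g(z) + sum_l kappa_l(z) A_{t_l}(z^k)
   is, for large k, a disc with centre g(0) that is near
   g(e^{it}) + A_t(e^{ikt}) at e^{it}, so that by equidistribution the mean of
   phi o h is not much larger than that of psi o g. The same gluing, with X in the
   place of W and psi in the place of phi, shows that u is plurisubharmonic. *)
Require Import Defs.
From HB Require Import structures.
From mathcomp Require Import all_boot all_order all_algebra.
From mathcomp Require Import complex.
From mathcomp Require Import all_classical all_reals all_analysis.
From mathcomp Require Import measurable_realfun.
From mathcomp Require Import zify ring lra.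
Import Order.TTheory GRing.Theory Num.Theory numFieldNormedType.Exports.

Set Implicit Arguments.
Unset Strict Implicit.
Unset Printing Implicit Defensive.

Local Open Scope classical_set_scope.
Local Open Scope ring_scope.
Local Open Scope complex_scope.

(** * Real-valued norm and complex differentiability *)

(** Both E phi and u are infima over discs, but only u can be glued directly. Gluing needs a closed
    loop of discs, hence discs with a common centre must be joinable within their class. Discs with
    boundary in X shrink to their centres; two discs with boundary in W and the same centre need not
    be centre-homotopic. This is why psi uses the discs of the structure only, and why the envelope
    is taken in two stages. Along a disc, u and phi are merely upper semicontinuous and may be -oo.
    A strict inequality for a mean is therefore turned into a strict pointwise inequality against Re
    P on the circle. Such an inequality is stable under small perturbations of the disc, and the
    mean of Re P is exactly Re P(0). The loop A_t depends only continuously on t, so g(e^{it}) + A_t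
    cannot be extended holomorphically in t. Sampling it at finitely many t_l, with weights that are
    Laurent polynomials in z, restores holomorphy; the exponent k is chosen after the weights, so
    the order of their poles is bounded independently of k. *)

Section RealNorm.
Context {R : realType}.
Local Notation C := (R[i]^o).

(* The norm of a normed module over R[i] has its values in R[i]; nr is the same
   number in R. *)
Definition nr {V : normedModType R[i]} (v : V) : R := complex.Re `|v|.

Context {V : normedModType R[i]}.
Implicit Types v w : V.

Lemma nrE v : `|v| = (nr v)%:C.
Proof.
have : 0 <= `|v| by exact: normr_ge0.
by rewrite /nr; case: `|v| => a b; rewrite lecE /= => /andP[/eqP -> _].
Qed.

Lemma nr_ge0 v : 0 <= nr v.
Proof. by rewrite -lecR -nrE normr_ge0. Qed.

Lemma nr0 : nr (0 : V) = 0.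
Proof. by rewrite /nr normr0. Qed.

Lemma nrN v : nr (- v) = nr v.
Proof. by rewrite /nr normrN. Qed.

Lemma nrBC v w : nr (v - w) = nr (w - v).
Proof. by rewrite -nrN opprB. Qed.

Lemma nrD v w : nr (v + w) <= nr v + nr w.
Proof. by rewrite -lecR rmorphD /= -!nrE ler_normD. Qed.

Lemma nr_eq0 v : nr v = 0 -> v = 0.
Proof. by move=> h; apply/eqP; rewrite -normr_eq0 nrE h. Qed.

Lemma nrZ (k : C) v : nr ((k : R[i]) *: v) = nr k * nr v.
Proof.
apply: complexI; rewrite rmorphM /= -!nrE normrZ; congr (_ * _).
Qed.

Lemma nr_sum (I : Type) (r : seq I) (F : I -> V) : nr (\sum_(i <- r) F i) <= \sum_(i <- r) nr (F i).
Proof.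
elim/big_rec2: _ => [|i x y _ h]; first by rewrite nr0.
by apply: (le_trans (nrD _ _)); rewrite lerD2l.
Qed.

Lemma nbhs_nrP v (A : set V) : nbhs v A <-> exists2 e : R, 0 < e & forall w, nr (w - v) < e -> A w.
Proof.
split.
  move=> /nbhs_normP[e /= e0 h]. exists (complex.Re e).
    by move: e0; rewrite ltcE /= => /andP[].
  move=> w hw; apply: h => /=; rewrite -normrN opprB nrE.
  move: e0 hw; rewrite ltcE; case: e => a b /= /andP[/eqP -> _] hw.
  by rewrite ltcR.
move=> [e e0 h]; apply/nbhs_normP; exists e%:C; first by rewrite /= ltcR.
by move=> w /=; rewrite -normrN opprB nrE ltcR; exact: h.
Qed.

End RealNorm.

(** * Epsilon-delta continuity and the rules of complex differentiation *)

Section EpsDelta.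
Context {R : realType}.
Local Notation C := (R[i]^o).

Definition cont_on {U V : normedModType R[i]} (A : set U) (f : U -> V) :=
  forall x, A x -> forall e : R, 0 < e -> exists2 d : R, 0 < d &
    forall y, A y -> nr (y - x) < d -> nr (f y - f x) < e.

Lemma cont_onP {U V : normedModType R[i]} (A : set U) (f : U -> V) :
  {within A, continuous f} <-> cont_on A f.
Proof.
split.
  move=> /subspace_continuousP h x Ax e e0.
  have := h x Ax [set y | nr (y - f x) < e].
  rewrite /nbhs /= => hh.
  have /hh : nbhs (f x) [set y | nr (y - f x) < e] by apply/nbhs_nrP; exists e.
  move=> /nbhs_nrP [d d0 hd]. exists d => // y Ay yx. exact: hd.
move=> h; apply/subspace_continuousP => x Ax B /nbhs_nrP[e e0 hB].
have [d d0 hd] := h x Ax e e0.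
apply/nbhs_nrP; exists d => // y yx Ay /=. apply: hB. exact: hd.
Qed.

Lemma open_nrP {V : normedModType R[i]} (A : set V) :
  open A <-> forall x, A x -> exists2 e : R, 0 < e & forall y, nr (y - x) < e -> A y.
Proof.
rewrite openE; split => h x Ax.
  by apply/nbhs_nrP; exact: h.
by apply/nbhs_nrP; exact: h.
Qed.

(** Differentiability as a first-order expansion with explicit derivative [b]. The bound is
    non-strict, so [w = 0] needs no exception, and no quotient has to be handled. *)
Definition cdiff {V : normedModType R[i]} (f : C -> V) (z : C) (b : V) :=
  forall e : R, 0 < e -> exists2 d : R, 0 < d &
    forall w : C, nr w < d -> nr (f (z + w) - f z - (w : R[i]) *: b) <= e * nr w.

Lemma nrM (x y : C) : nr (x * y : C) = nr x * nr y.
Proof. exact: (nrZ (V := C)). Qed.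

Lemma nr1 : nr (1 : C) = 1.
Proof. by rewrite /nr normr1. Qed.

Lemma nrV (x : C) : nr (x^-1 : C) = (nr x)^-1.
Proof.
apply: complexI; rewrite fmorphV /= -!nrE.
exact: normfV.
Qed.

Lemma nrX (x : C) n : nr (x ^+ n : C) = nr x ^+ n.
Proof. by elim: n => [|n IH]; rewrite ?expr0 ?nr1 // !exprS nrM IH. Qed.

Lemma derivableP_cdiff {V : normedModType R[i]} (f : C -> V) (z : C) :
  derivable f z 1 <-> exists b, cdiff f z b.
Proof.
split.
  move=> /cvg_ex[b hb]; exists b => e e0.
  have /hb : nbhs b [set y | nr (y - b) < e] by apply/nbhs_nrP; exists e.
  move=> /nbhs_nrP[d d0 hd]; exists d => // w wd.
  have [->|w0] := eqVneq w 0; first by rewrite addr0 subrr scale0r subrr !nr0 mulr0.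
  have /= := hd w; rewrite subr0 => /(_ wd w0) h.
  have E : f (z + w) - f z - (w : R[i]) *: b = (w : R[i]) *: ((w : R[i])^-1 *: (f (w *: (1:C) + z) - f z) - b).
    rewrite scalerBr scalerA mulfV // scale1r; congr (f _ - _ - _).
    by rewrite addrC; congr (_ + _); rewrite /GRing.scale /= mulr1.
  rewrite E nrZ mulrC ler_wpM2r ?nr_ge0//. exact: ltW.
move=> [b hb]; apply/cvg_ex; exists b => A /nbhs_nrP[e e0 hA].
have [d d0 hd] := hb (e/2) ltac:(lra).
apply/nbhs_nrP; exists d => // w; rewrite subr0 => wd w0 /=; apply: hA.
have nw0 : 0 < nr w.
  by rewrite lt_neqAle nr_ge0 andbT eq_sym; apply/eqP => /nr_eq0 /eqP; rewrite (negbTE w0).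
have E : (w : R[i])^-1 *: (f (w *: (1:C) + z) - f z) - b = (w^-1 : R[i]) *: (f (z + w) - f z - (w : R[i]) *: b).
  rewrite (scalerBr _ _ (_ *: b)) scalerA mulVf // scale1r; congr (_ *: (f _ - _) - _).
  by rewrite addrC; congr (_ + _); rewrite /GRing.scale /= mulr1.
rewrite E nrZ nrV mulrC ltr_pdivrMr//.
apply: (le_lt_trans (hd _ wd)). by rewrite ltr_pM2r //; lra.
Qed.


Lemma cdiff_lip {V : normedModType R[i]} (f : C -> V) (z : C) (b : V) : cdiff f z b ->
  exists2 L : R, 0 < L & exists2 d : R, 0 < d & forall w, nr w < d -> nr (f (z + w) - f z) <= L * nr w.
Proof.
move=> /(_ 1 ltr01)[d d0 hd]; exists (1 + nr b); first by rewrite ltr_pwDl ?nr_ge0.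
exists d => // w wd.
have -> : f (z + w) - f z = (f (z + w) - f z - (w : R[i]) *: b) + (w : R[i]) *: b by rewrite subrK.
by rewrite (le_trans (nrD _ _))// mulrDl lerD ?hd// nrZ mulrC.
Qed.

Lemma cdiffD {V : normedModType R[i]} (f g : C -> V) (z : C) (a b : V) :
  cdiff f z a -> cdiff g z b -> cdiff (fun x => f x + g x) z (a + b).
Proof.
move=> hf hg e e0.
have [d1 d10 h1] := hf (e/2) ltac:(lra).
have [d2 d20 h2] := hg (e/2) ltac:(lra).
exists (Order.min d1 d2); first by rewrite lt_min d10.
move=> w; rewrite lt_min => /andP[/h1 H1 /h2 H2].
have -> : f (z + w) + g (z + w) - (f z + g z) - (w : R[i]) *: (a + b) =
  (f (z + w) - f z - (w : R[i]) *: a) + (g (z + w) - g z - (w : R[i]) *: b).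
  by rewrite scalerDr (opprD (f z)) (opprD (_ *: a)) (addrACA (f (z + w))) (addrACA (f (z + w) - f z)).
by rewrite (le_trans (nrD _ _))//; lra.
Qed.

Lemma cdiff_cst {V : normedModType R[i]} (v : V) (z : C) : cdiff (fun=> v) z 0.
Proof.
by move=> e e0; exists 1 => // w _; rewrite subrr scaler0 subrr nr0 mulr_ge0 ?nr_ge0 ?ltW.
Qed.

Lemma cdiff_id (z : C) : cdiff (fun x => x) z (1 : C).
Proof.
move=> e e0; exists 1 => // w _.
rewrite /GRing.scale /= mulr1 [z + w]addrC addrK subrr nr0; apply: mulr_ge0; [exact: ltW|exact: nr_ge0].
Qed.

Lemma cdiffZ {V : normedModType R[i]} (k : C -> C) (v : C -> V) (z : C) (a : C) (b : V) :
  cdiff k z a -> cdiff v z b ->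
  cdiff (fun x => (k x : R[i]) *: v x) z ((a : R[i]) *: v z + (k z : R[i]) *: b).
Proof.
move=> hk hv e e0.
have [L L0 [d0 d00 hL]] := cdiff_lip hv.
(* [K] dominates [nr (k z)], [L * nr a], and [nr (v (z + w))] for small [w]; hence [e' * K <= e / 3]
   settles each of the three terms of the increment. *)
pose K := 1 + nr (k z) + nr (v z) + L * (1 + nr a).
have nk := nr_ge0 (k z); have nv := nr_ge0 (v z); have na := nr_ge0 a.
have La : 0 <= L * (1 + nr a) by rewrite mulr_ge0//; lra.
have K0 : 0 < K by rewrite /K; lra.
pose e' := Order.min 1 (e / (3 * K)).
have e'0 : 0 < e' by rewrite lt_min ltr01 divr_gt0// mulr_gt0.
have e'1 : e' <= 1 by rewrite ge_min lexx.
have e'K : e' * K <= e / 3.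
  have : e' <= e / (3 * K) by rewrite ge_min lexx orbT.
  rewrite -(ler_pM2r K0) => /le_trans; apply.
  have -> : e / (3 * K) * K = e / 3 by field; rewrite gt_eqF.
  by [].
clearbody e'.
have [d1 d10 h1] := hk e' e'0.
have [d2 d20 h2] := hv e' e'0.
exists (Order.min e' (Order.min d0 (Order.min d1 d2))); first by rewrite !lt_min e'0 d00 d10.
move=> w; rewrite !lt_min => /and4P[we /hL wL /h1 H1 /h2 H2].
have -> : (k (z + w) : R[i]) *: v (z + w) - (k z : R[i]) *: v z - (w : R[i]) *: ((a : R[i]) *: v z + (k z : R[i]) *: b) =
  ((k (z + w) - k z - (w : R[i]) *: a : C) : R[i]) *: v (z + w) + (w : R[i]) *: ((a : R[i]) *: (v (z + w) - v z))
   + (k z : R[i]) *: (v (z + w) - v z - (w : R[i]) *: b).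
  have {1}-> : k (z + w) = (k (z + w) - k z - (w : R[i]) *: a) + k z + (w : R[i]) *: a by rewrite addrAC subrK subrK.
  move: (k (z + w) - k z - (w : R[i]) *: a : C) => dk.
  rewrite !scalerDl !scalerBr scalerDr !scalerA opprD !addrA [k z * w]mulrC.
  by rewrite [LHS](ACl (1*3*5*2*4*6))%AC.
rewrite (le_trans (nrD _ _))// (le_trans (lerD (nrD _ _) (lexx _)))// !nrZ.
have w0 := nr_ge0 w.
have Hv : nr (v (z + w)) <= K.
  have -> : v (z + w) = (v (z + w) - v z) + v z by rewrite subrK.
  have : L * nr w <= L * (1 + nr a) by rewrite ler_pM2l//; lra.
  by have := nrD (v (z + w) - v z) (v z); rewrite /K; lra.
have T1 : nr (k (z + w) - k z - (w : R[i]) *: a : C) * nr (v (z + w)) <= e / 3 * nr w.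
  apply: (@le_trans _ _ (e' * nr w * K)); first by rewrite ler_pM ?nr_ge0.
  by rewrite mulrAC ler_wpM2r.
have T3 : nr (k z) * nr (v (z + w) - v z - (w : R[i]) *: b) <= e / 3 * nr w.
  apply: (@le_trans _ _ (K * (e' * nr w))); first by rewrite ler_pM ?nr_ge0//; rewrite /K; lra.
  by rewrite mulrA [K * _]mulrC ler_wpM2r.
have T2 : nr w * (nr a * nr (v (z + w) - v z)) <= e / 3 * nr w.
  rewrite mulrC ler_wpM2r//.
  apply: (@le_trans _ _ (nr a * (L * nr w))); first by rewrite ler_wpM2l.
  apply: (@le_trans _ _ (K * e')); last by rewrite mulrC.
  rewrite mulrA ler_pM//; [by rewrite mulr_ge0//; lra| |lra].
  by rewrite /K mulrDr mulr1 [L * _]mulrC; lra.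
have := lerD (lerD T1 T2) T3; lra.
Qed.

Lemma cdiff_comp {V : normedModType R[i]} (f : C -> V) (k : C -> C) (z : C) (b : V) (a : C) :
  cdiff f (k z) b -> cdiff k z a -> cdiff (fun x => f (k x)) z ((a : R[i]) *: b).
Proof.
move=> hf hk e e0.
have [L L0 [d0 d00 hL]] := cdiff_lip hk.
have nb := nr_ge0 b.
have [d1 d10 h1] := hf (e / (2 * L)) ltac:(by rewrite divr_gt0// mulr_gt0).
have [d2 d20 h2] := hk (e / (2 * (1 + nr b))) ltac:(by rewrite divr_gt0// mulr_gt0//; lra).
exists (Order.min d0 (Order.min (d1 / L) d2)); first by rewrite !lt_min d00 divr_gt0.
move=> w; rewrite !lt_min => /and3P[/hL wL w1 /h2 H2].
have w0 := nr_ge0 w.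
have := h1 (k (z + w) - k z).
rewrite (le_lt_trans wL) => [/(_ isT)|]; last by rewrite mulrC -ltr_pdivlMr.
rewrite [k z + _]addrC subrK => H1.
have -> : f (k (z + w)) - f (k z) - (w : R[i]) *: ((a : R[i]) *: b) =
   (f (k (z + w)) - f (k z) - ((k (z + w) - k z : C) : R[i]) *: b) + ((k (z + w) - k z - (w : R[i]) *: a : C) : R[i]) *: b.
  by rewrite (scalerBl (k (z + w) - k z : R[i]) ((w : R[i]) *: a : C)) addrA subrK scalerA.
rewrite (le_trans (nrD _ _))// nrZ.
have T1 : e / (2 * L) * nr (k (z + w) - k z) <= e / 2 * nr w.
  apply: (@le_trans _ _ (e / (2 * L) * (L * nr w))).
    by rewrite ler_wpM2l// divr_ge0 ?mulr_ge0 ?ltW.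
  have -> : e / (2 * L) * (L * nr w) = e / 2 * nr w by field; rewrite gt_eqF.
  by [].
have T2 : nr (k (z + w) - k z - (w : R[i]) *: a) * nr b <= e / 2 * nr w.
  apply: (@le_trans _ _ (e / (2 * (1 + nr b)) * nr w * (1 + nr b))).
    by rewrite ler_pM ?nr_ge0//; lra.
  have -> : e / (2 * (1 + nr b)) * nr w * (1 + nr b) = e / 2 * nr w by field; apply/eqP; lra.
  by [].
lra.
Qed.

Lemma cdiffM (f g : C -> C) (z : C) a b : cdiff f z a -> cdiff g z b ->
  cdiff (fun x => f x * g x : C) z ((a : R[i]) *: g z + (f z : R[i]) *: b).
Proof. exact: cdiffZ. Qed.

Lemma cdiff_cont {V : normedModType R[i]} (f : C -> V) (z : C) b : cdiff f z b ->
  forall e, 0 < e -> exists2 d : R, 0 < d & forall w, nr (w - z) < d -> nr (f w - f z) < e.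
Proof.
move=> /cdiff_lip [L L0 [d d0 h]] e e0; exists (Order.min d (e / L)).
  by rewrite lt_min d0 divr_gt0.
move=> w; rewrite lt_min => /andP[/h]; rewrite [z + _]addrC subrK => H.
by rewrite ltr_pdivlMr// mulrC; apply: le_lt_trans.
Qed.

Lemma cdiffV (z : C) : z != 0 -> cdiff (fun x => x^-1 : C) z (- (z^-1 ^+ 2) : C).
Proof.
move=> z0 e e0.
have nz : 0 < nr z by rewrite lt_neqAle nr_ge0 andbT eq_sym; apply/eqP => /nr_eq0 /eqP; rewrite (negbTE z0).
exists (Order.min (nr z / 2) (e * nr z ^+ 3 / 2)).
  by rewrite lt_min !divr_gt0 ?mulr_gt0 ?exprn_gt0.
move=> w; rewrite lt_min => /andP[w1 w2].
have nzw : nr z / 2 <= nr (z + w).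
  have : nr (z + w - w) <= nr (z + w) + nr (- w) by exact: nrD.
  rewrite addrK nrN; lra.
have zw0 : z + w != 0.
  apply/eqP => h; move: nzw; rewrite h nr0; lra.
have -> : ((z + w)^-1 : C) - z^-1 - (w : R[i]) *: (- (z^-1 ^+ 2) : C) = (w ^+ 2 * (z^-1) ^+ 2 * (z + w)^-1 : C).
  rewrite /GRing.scale /=; move: z0 zw0; clear; move: z w => z w z0 zw0.
  have -> : ((z + w)^-1 : R[i]) - z^-1 - w * (- (z^-1 ^+ 2)) = w ^+ 2 * (z^-1) ^+ 2 * (z + w)^-1 by field; rewrite zw0 z0.
  by [].
rewrite !nrM !nrV.
have w0 := nr_ge0 w.
rewrite ler_pdivrMr; last lra.
have -> : nr w * nr w * ((nr z)^-1 * (nr z)^-1) = nr w * nr w / nr z ^+ 2 by field; rewrite gt_eqF.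
rewrite ler_pdivrMr ?exprn_gt0//.
apply: (@le_trans _ _ (e * nr w * (nr z / 2) * nr z ^+ 2)).
  have := ler_wpM2l w0 (ltW w2); rewrite !exprS expr0; lra.
rewrite ler_pM2r ?exprn_gt0// ler_wpM2l// mulr_ge0//; lra.
Qed.

Lemma cdiffX (z : C) k : exists b, cdiff (fun x => x ^+ k : C) z b.
Proof.
elim: k => [|k [b hb]]; first by exists 0; exact: cdiff_cst.
eexists; have := cdiffM (cdiff_id z) hb.
have -> : (fun x : C => x ^+ k.+1 : C) = (fun x : C => x * x ^+ k : C) by apply/funext => x; rewrite exprS.
exact.
Qed.

Lemma cdiff_sum {V : normedModType R[i]} (I : Type) (r : seq I) (F : I -> C -> V) z :
  (forall i, exists b, cdiff (F i) z b) -> exists b, cdiff (fun x => \sum_(i <- r) F i x) z b.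
Proof.
move=> h; elim: r => [|i r [b hb]].
  exists 0; have -> : (fun x => \sum_(i <- [::]) F i x) = (fun=> 0 : V) by apply/funext => x; rewrite big_nil.
  exact: cdiff_cst.
have [a ha] := h i; exists (a + b).
have -> : (fun x => \sum_(i <- i :: r) F i x) = (fun x => F i x + \sum_(i <- r) F i x).
  by apply/funext => x; rewrite big_cons.
exact: cdiffD.
Qed.

Lemma cdiff_poly (P : {poly R[i]}) (z : C) : exists b : C, cdiff (fun x : C => P.[x] : C) z b.
Proof.
elim/poly_ind: P => [|p c [b hb]].
  exists 0; have -> : (fun x : C => (0 : {poly R[i]}).[x] : C) = (fun=> 0) by apply/funext => x; rewrite horner0.
  exact: cdiff_cst.
eexists.
have -> : (fun x : C => (p * 'X + c%:P).[x] : C) = (fun x : C => (p.[x] * x : C) + (c : C)).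
  by apply/funext => x; rewrite hornerMXaddC.
apply: cdiffD; last exact: cdiff_cst.
by apply: cdiffM; [exact: hb| exact: cdiff_id].
Qed.

End EpsDelta.

(** * The unit circle *)

Section Circle.
Context {R : realType}.
Local Notation C := (R[i]^o).

Definition E (t : R) : C := cos t +i* sin t.

Lemma nr_sqr (z : C) : nr z ^+ 2 = complex.Re z ^+ 2 + complex.Im z ^+ 2.
Proof.
case: z => a b; rewrite /nr /=.
by rewrite sqr_sqrtr// addr_ge0 ?sqr_ge0.
Qed.

Lemma nr_le_sqr (z : C) (a : R) : 0 <= a -> (nr z <= a) = (complex.Re z ^+ 2 + complex.Im z ^+ 2 <= a ^+ 2).
Proof. by move=> a0; rewrite -nr_sqr ler_pXn2r ?nnegrE ?nr_ge0. Qed.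

Lemma nr_Re (z : C) : `|complex.Re z| <= nr z.
Proof.
rewrite -(@ler_pXn2r _ 2) ?nnegrE ?nr_ge0// nr_sqr -normrX ger0_norm ?sqr_ge0//.
by rewrite lerDl sqr_ge0.
Qed.

Lemma nr_Im (z : C) : `|complex.Im z| <= nr z.
Proof.
rewrite -(@ler_pXn2r _ 2) ?nnegrE ?nr_ge0// nr_sqr -normrX ger0_norm ?sqr_ge0//.
by rewrite lerDr sqr_ge0.
Qed.

Lemma nr_ReIm (z : C) : nr z <= `|complex.Re z| + `|complex.Im z|.
Proof.
rewrite nr_le_sqr ?addr_ge0// -(real_normK (num_real (complex.Re z))) -(real_normK (num_real (complex.Im z))).
have := mulr_ge0 (normr_ge0 (complex.Re z)) (normr_ge0 (complex.Im z)).
by rewrite sqrrD -mulr_natl; lra.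
Qed.

Lemma nr_real (a : R) : nr (a%:C : C) = `|a|.
Proof. by rewrite /nr /= expr0n /= addr0 sqrtr_sqr. Qed.

Lemma nr_E t : nr (E t) = 1.
Proof.
apply/eqP; rewrite -(@eqrXn2 _ 2) ?nr_ge0// nr_sqr /= cos2Dsin2 expr1n//.
Qed.

Lemma ED s t : E (s + t) = E s * E t :> C.
Proof. by rewrite /E cosD sinD; congr (_ +i* _); rewrite addrC mulrC [sin s * _]mulrC. Qed.

Lemma E0 : E 0 = 1 :> C.
Proof. by rewrite /E cos0 sin0. Qed.

Lemma EX t k : E (k%:R * t) = E t ^+ k :> C.
Proof.
elim: k => [|k IH]; first by rewrite mul0r E0 expr0.
by rewrite -natr1 mulrDl mul1r ED IH exprSr.
Qed.

Lemma E_neq0 t : E t != 0 :> C.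
Proof. by apply/eqP => /(congr1 nr); rewrite nr_E nr0; apply/eqP; rewrite oner_eq0. Qed.

Lemma EN t : E (- t) = (E t)^-1 :> C.
Proof.
apply: (@mulfI _ (E t : R[i])); first exact: E_neq0.
by rewrite mulfV ?E_neq0//; have := ED t (- t); rewrite subrr E0 => <-.
Qed.

Lemma E2pi : E (2 * pi) = 1 :> C.
Proof. by rewrite /E mulr_natl cos2pi sin2pi. Qed.

Lemma nr_E1 t : nr (E t - 1 : C) ^+ 2 = 2 - 2 * cos t.
Proof.
rewrite nr_sqr /= subr0; have := cos2Dsin2 t.
by rewrite sqrrB expr1n mulr1 -mulr_natl; lra.
Qed.

Lemma E_neq1 t : 0 < t < 2 * pi -> E t != 1 :> C.
Proof.
move=> /andP[t0 t1]; apply/eqP => /(congr1 (@complex.Re R)) /= h.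
have s0 : 0 < sin (t / 2) by apply: sin_gt0_pi; apply/andP; split; lra.
have : cos t = 1 - 2 * sin (t / 2) ^+ 2.
  have {1}-> : t = (t / 2) *+ 2 by rewrite -mulr_natl; lra.
  by rewrite cos_mulr2n sin2cos2 mulr2n; lra.
have := exprn_gt0 2 s0; lra.
Qed.

Lemma E_surj (z : C) : nr z = 1 -> exists2 t : R, 0 <= t <= 2 * pi & z = E t.
Proof.
move=> z1; have zz := nr_sqr z; rewrite z1 expr1n in zz.
have hx : -1 <= complex.Re z <= 1 by rewrite -ler_norml -z1 nr_Re.
have c : cos (acos (complex.Re z)) = complex.Re z by rewrite acosK.
have /andP[a0 a1] : 0 <= acos (complex.Re z) <= pi by rewrite acos_ge0// acos_lepi.
have p0 := pi_gt0 R.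
have ss : sin (acos (complex.Re z)) ^+ 2 = complex.Im z ^+ 2.
  by rewrite sin2cos2 c; lra.
have s0 : 0 <= sin (acos (complex.Re z)) by apply: sin_ge0_pi; rewrite a0 a1.
move: ss; move/eqP; rewrite eqf_sqr => /orP[/eqP ss|/eqP ss].
  exists (acos (complex.Re z)); first by apply/andP; split; lra.
  by rewrite /E c ss; case: (z).
exists (2 * pi - acos (complex.Re z)); first by apply/andP; split; lra.
rewrite ED E2pi mul1r /E cosN sinN c ss opprK; by case: (z).
Qed.

Lemma deriv_lip (f f' : R -> R) : (forall x : R, is_derive x (1 : R) f (f' x)) -> (forall x, `|f' x| <= 1) ->
  forall s t, `|f s - f t| <= `|s - t|.
Proof.
move=> hf hf'.
have aux x y : y <= x -> `|f x - f y| <= `|x - y|.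
  move=> xy.
  have [//||c _ ->] := @MVT_segment R f f' y x.
    apply: continuous_subspaceT => z.
    apply: differentiable_continuous; apply/derivable1_diffP.
    by have [] := hf z.
  by rewrite normrM ler_piMl.
move=> s t; have [/aux|/ltW/aux] := leP t s => //.
by rewrite distrC [X in _ <= X]distrC.
Qed.

Lemma E_lip (s t : R) : nr (E s - E t) <= 2 * `|s - t|.
Proof.
apply: le_trans (nr_ReIm _) _ => /=.
have h1 : `|cos s - cos t| <= `|s - t|.
  apply: (@deriv_lip cos (fun x => - sin x)) => x; by rewrite normrN sin_max.
have h2 : `|sin s - sin t| <= `|s - t|.
  apply: (@deriv_lip sin cos) => x; exact: cos_max.
rewrite mulr_natl mulr2n; exact: lerD.
Qed.

Lemma open_discP (z : C) : open_disc z <-> nr z < 1.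
Proof. by rewrite /open_disc /= nrE -[1]/(1%:C) ltcR. Qed.
Lemma closed_discP (z : C) : closed_disc z <-> nr z <= 1.
Proof. by rewrite /closed_disc /= nrE -[1]/(1%:C) lecR. Qed.
Lemma unit_circleP (z : C) : unit_circle z <-> nr z = 1.
Proof.
rewrite /unit_circle /= nrE; split => [|->//].
by move=> /(congr1 (@complex.Re R)).
Qed.

Lemma unit_circleE t : unit_circle (E t).
Proof. by apply/unit_circleP; exact: nr_E. Qed.

Lemma circle_closed (z : C) : unit_circle z -> closed_disc z.
Proof. by move=> /unit_circleP h; apply/closed_discP; rewrite h. Qed.

Lemma polar (z : C) : exists2 t : R, 0 <= t <= 2 * pi & z = ((nr z)%:C * E t : C).
Proof.
have [->|z0] := eqVneq z 0.
  by exists 0; rewrite ?nr0 ?mul0r// lexx mulr_ge0 ?pi_ge0.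
have nz : nr z != 0 by apply/eqP => /nr_eq0 /eqP; rewrite (negbTE z0).
have [|t ht e] := @E_surj (z * ((nr z)%:C)^-1 : C).
  by rewrite nrM nrV nr_real ger0_norm ?nr_ge0// mulfV.
exists t => //; rewrite -e mulrCA mulfV ?mulr1//.
by apply/eqP => /(congr1 (@complex.Re R)) /= /eqP; rewrite (negbTE nz).
Qed.

Lemma continuous_nrP (T : topologicalType) (V : normedModType R[i]) (f : T -> V) x :
  {for x, continuous f} <-> forall e : R, 0 < e -> \forall y \near x, nr (f y - f x) < e.
Proof.
split.
  by move=> h e e0; apply: (h [set y | nr (y - f x) < e]); apply/nbhs_nrP; exists e.
move=> h A /nbhs_nrP[e e0 hA]; apply: filterS (h e e0) => y; exact: hA.
Qed.

Lemma compact_rect (a b c d : R) : compact (`[a, b] `*` `[c, d] : set (R * R)).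
Proof. by apply: compact_setX; exact: segment_compact. Qed.

Lemma continuous_polar : continuous (fun p : R * R => (p.1%:C * E p.2 : C)).
Proof.
move=> [r t]; apply/continuous_nrP => e e0.
pose d := Order.min (e / 2) (e / (4 * (1 + `|r|))).
have r0 := normr_ge0 r.
have d0 : 0 < d by rewrite lt_min !divr_gt0// mulr_gt0//; lra.
have : \forall p \near (r, t), `|p.1 - r| < d /\ `|p.2 - t| < d.
  exists ([set x | `|x - r| < d], [set y | `|y - t| < d]) => /=.
    by split; apply/nbhs_ballP; exists d => // y; rewrite /ball /= distrC.
  by move=> [x y] /= [].
apply: filterS => -[x y] /= [hx hy].
have -> : (x%:C * E y - r%:C * E t : C) = ((x - r)%:C * E y : C) + (r%:C * (E y - E t) : C).
  by rewrite rmorphB /= mulrBl mulrBr addrA subrK.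
apply: le_lt_trans (nrD _ _) _; rewrite !nrM !nr_real nr_E mulr1.
have h1 : `|x - r| < e / 2 by move: hx; rewrite lt_min => /andP[].
have h2 : `|y - t| < e / (4 * (1 + `|r|)) by move: hy; rewrite lt_min => /andP[].
have h3 : `|r| * nr (E y - E t) <= (1 + `|r|) * (2 * (e / (4 * (1 + `|r|)))).
  apply: ler_pM => //; [exact: nr_ge0|lra|].
  by have := E_lip y t; lra.
have h4 : (1 + `|r|) * (2 * (e / (4 * (1 + `|r|)))) = e / 2 by field; apply/eqP; lra.
lra.
Qed.

Lemma compact_closed_disc : compact (closed_disc : set C).
Proof.
have -> : closed_disc = (fun p : R * R => (p.1%:C * E p.2 : C)) @` (`[0, 1] `*` `[0, 2 * pi]).
  apply/seteqP; split => [z /closed_discP z1|_ [[r t] /= [+ _] <-]].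
    have [t ht e] := polar z.
    by exists (nr z, t) => //=; rewrite !in_itv /= nr_ge0 z1.
  rewrite in_itv /= => /andP[r0 r1]; apply/closed_discP.
  by rewrite nrM nr_real nr_E mulr1 ger0_norm.
apply: continuous_compact; last exact: compact_rect.
exact/continuous_subspaceT/continuous_polar.
Qed.

Lemma compact_unit_circle : compact (unit_circle : set C).
Proof.
have -> : unit_circle = (fun p : R * R => (p.1%:C * E p.2 : C)) @` (`[1, 1] `*` `[0, 2 * pi]).
  apply/seteqP; split => [z /unit_circleP z1|_ [[r t] /= [+ _] <-]].
    have [t ht e] := polar z.
    by exists (nr z, t) => //=; rewrite !in_itv /= z1 lexx.
  rewrite in_itv /= -eq_le => /eqP <-; apply/unit_circleP.
  by rewrite nrM nr_real nr_E mulr1 normr1.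
apply: continuous_compact; last exact: compact_rect.
exact/continuous_subspaceT/continuous_polar.
Qed.

(** The compactness argument used throughout: a local radius becomes a uniform one, provided that
    shrinking the radius weakens the property. Boundedness fits this form when a bound is written as
    [e^-1]. *)
Lemma compact_unif (T : topologicalType) (K : set T) (P : R -> T -> Prop) :
  compact K ->
  (forall d e y, 0 < d -> d <= e -> P e y -> P d y) ->
  (forall x, K x -> exists2 e : R, 0 < e & \forall y \near x, K y -> P e y) ->
  exists2 e : R, 0 < e & forall y, K y -> P e y.
Proof.
move=> /compact_near_coveringP/near_covering_withinP cK mono h.
have : \forall d \near (0 : R)^'+, K `<=` P d.
  apply: (cK R (0^'+) P) => x /h[e e0 he]; exists ([set y | K y -> P e y], [set d | 0 < d <= e]).
    split => //=; near=> d; apply/andP; split; near: d; [exact: nbhs_right_gt|exact: nbhs_right_le].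
  by move=> [y d] /= [Py /andP[d0 de]] Ky; apply: (mono d e) => //; exact: Py.
move=> [e /= e0 he]; exists (e / 2); first lra.
move=> y Ky; apply: (he (e / 2)) => //=; last lra.
by rewrite sub0r normrN gtr0_norm; lra.
Unshelve. all: by end_near.
Qed.

End Circle.

(** * Integrals and circle means *)

(* No measurability is required, since integrals of nonnegative functions are
   suprema over simple functions. *)
Lemma le_integral_pointwise d (T : measurableType d) (R : realType) (mu : {measure set T -> \bar R})
    (D : set T) (f g : T -> \bar R) :
  (forall x, D x -> (f x <= g x)%E) -> (\int[mu]_(x in D) f x <= \int[mu]_(x in D) g x)%E.
Proof.
move=> fg; rewrite /integral; apply: leeB; apply: le_ereal_sup => _ [h hf <-]; exists h => // x.
  apply: (le_trans (hf x)); rewrite !funeposE /=; apply: le_max2 => //.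
  by rewrite /patch; case: ifPn => // /set_mem /fg.
apply: (le_trans (hf x)); rewrite !funenegE /=; apply: le_max2 => //.
by rewrite /patch; case: ifPn => // /set_mem /fg; rewrite leeN2.
Qed.

Lemma integrable_setU d (T : measurableType d) (R : realType) (mu : {measure set T -> \bar R})
    (A B : set T) (f : T -> \bar R) : measurable A -> measurable B -> [disjoint A & B] ->
  mu.-integrable A f -> mu.-integrable B f -> mu.-integrable (A `|` B) f.
Proof.
move=> mA mB AB /integrableP[mfA iA] /integrableP[mfB iB].
apply/integrableP; split; first by rewrite measurable_funU.
rewrite ge0_integral_setU//; first exact: lte_add_pinfty.
by apply: measurableT_comp => //; rewrite measurable_funU.
Qed.

Section Integral.
Context {R : realType}.
Local Notation C := (R[i]^o).
Notation mu := (@lebesgue_measure R).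

Definition rint (a b : R) (f : R -> R) : R := \int[mu]_(t in `[a, b]) f t.
Definition integ (a b : R) (f : R -> R) := mu.-integrable `[a, b] (EFin \o f).

Lemma integ_cont a b f : {within `[a, b], continuous f} -> integ a b f.
Proof. by move=> h; apply: continuous_compact_integrable => //; exact: segment_compact. Qed.

Lemma integS a b c d f : a <= c -> d <= b -> integ a b f -> integ c d f.
Proof.
move=> ac db; apply: integrableS => //; apply: subset_itv; by rewrite bnd_simp.
Qed.

Lemma integD a b f g : integ a b f -> integ a b g -> integ a b (fun t => f t + g t).
Proof. by move=> hf hg; exact: (integrableD _ hf hg). Qed.

Lemma integB a b f g : integ a b f -> integ a b g -> integ a b (fun t => f t - g t).
Proof. by move=> hf hg; exact: (integrableB _ hf hg). Qed.

Lemma rintD a b f g : integ a b f -> integ a b g -> rint a b (fun t => f t + g t) = rint a b f + rint a b g.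
Proof. by move=> hf hg; exact: RintegralD. Qed.

Lemma rintB a b f g : integ a b f -> integ a b g -> rint a b (fun t => f t - g t) = rint a b f - rint a b g.
Proof. by move=> hf hg; exact: RintegralB. Qed.

Lemma le_rint a b f g : integ a b f -> integ a b g ->
  (forall t, a <= t <= b -> f t <= g t) -> rint a b f <= rint a b g.
Proof. by move=> hf hg h; apply: le_Rintegral => // t; rewrite /= in_itv /=; exact: h. Qed.

Lemma eq_rint a b f g : (forall t, a <= t <= b -> f t = g t) -> rint a b f = rint a b g.
Proof. by move=> h; apply: eq_Rintegral => t /set_mem; rewrite /= in_itv /=; exact: h. Qed.

Lemma eq_integ a b f g : (forall t, a <= t <= b -> f t = g t) -> integ a b f -> integ a b g.
Proof.
by move=> h; apply: eq_integrable => // t /set_mem; rewrite /= in_itv /= => /h ->.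
Qed.

Lemma integ_cst a b k : integ a b (fun=> k).
Proof. by apply: integ_cont; apply: continuous_subspaceT => x; exact: cvg_cst. Qed.

Lemma rint_cst a b k : a <= b -> rint a b (fun=> k) = k * (b - a).
Proof.
move=> ab; rewrite /rint Rintegral_cst//= lebesgue_measure_itv/= lte_fin.
by case: ltP => // ba; rewrite (@le_anti _ _ a b) ?ab ?subrr.
Qed.

Lemma rint_split a b c f : a <= c -> c <= b -> integ a b f -> rint a b f = rint a c f + rint c b f.
Proof.
move=> ac cb hf; rewrite /rint.
have := @Rintegral_itvB R f (BLeft a) (BRight b) c hf.
rewrite !bnd_simp => /(_ ac cb) => /eqP; rewrite subr_eq => /eqP ->.
rewrite addrC; congr (_ + _).
by rewrite (@Rintegral_itv_obnd_cbnd R)//; apply: integrableS hf => //; apply: subset_itv; rewrite bnd_simp.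
Qed.

Lemma integ_join a b c f : a <= c -> c <= b -> integ a c f -> integ c b f -> integ a b f.
Proof.
move=> ac cb h1 h2; rewrite /integ (@itv_bndbnd_setU _ _ _ (BRight c)) ?bnd_simp//.
apply: integrable_setU => //.
  apply/disj_setPS => x [/= ]; rewrite !in_itv /= => /andP[_ h] /andP[h' _]; move: h'; rewrite ltNge h//.
rewrite /integ in h2; apply: integrableS h2 => //; apply: subset_itv; by rewrite bnd_simp.
Qed.

(** [f] and [g] may differ at [c], so the right-hand piece is compared with [g] on []c, b]] only. *)
Lemma rint_cat a b c f g : a <= c -> c <= b -> integ a c f -> integ c b g ->
  integ a b (fun t => if t <= c then f t else g t) /\
  rint a b (fun t => if t <= c then f t else g t) = rint a c f + rint c b g.
Proof.
move=> ac cb hf hg; set h := fun t => _.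
have e1 t : a <= t <= c -> f t = h t by move=> /andP[_ tc]; rewrite /h tc.
have i1 : integ a c h by apply: eq_integ hf.
have e2 t : t \in `]c, b] -> h t = g t.
  by rewrite in_itv /= => /andP[ct _]; rewrite /h leNgt ct.
have io : mu.-integrable `]c, b] (EFin \o g).
  by rewrite /integ in hg; apply: integrableS hg => //; apply: subset_itv; rewrite bnd_simp.
have io' : mu.-integrable `]c, b] (EFin \o h).
  by apply: eq_integrable io => // t /set_mem /e2 /= ->.
have i2 : integ c b h.
  rewrite /integ -(@setU1itv _ _ (BRight b) c false) ?bnd_simp//.
  apply: integrable_setU => //.
    by apply/disj_setPS => x [/= ->]; rewrite in_itv /= ltxx.
  apply: (@integrableS _ _ _ mu `[c, c]%classic) => //; first by move=> x ->; rewrite /= in_itv /= lexx.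
  by apply: integS i1.
have i3 : integ a b h by exact: integ_join i1 i2.
split => //; rewrite (rint_split ac cb i3); congr (_ + _).
  by apply: eq_rint => t /e1 ->.
rewrite /rint -(@Rintegral_itv_obnd_cbnd R)// -[RHS](@Rintegral_itv_obnd_cbnd R)//.
by apply: eq_Rintegral => t /set_mem /e2.
Qed.

Lemma rint_FTC a b (f F : R -> R) : a <= b -> continuous f -> (forall t : R, is_derive t (1 : R) F (f t)) ->
  rint a b f = F b - F a.
Proof.
move=> ab cf hF.
have cF : continuous F.
  move=> x; apply: differentiable_continuous; apply/derivable1_diffP.
  by have [] := hF x.
move: ab; rewrite le_eqVlt => /orP[/eqP ->|ab].
  by rewrite subrr /rint set_itv1 Rintegral_set1.
rewrite /rint /Rintegral (@continuous_FTC2 _ f F)//.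
- by apply: continuous_subspaceT => x; exact: cf.
- split; first by move=> x _; have [] := hF x.
    by apply: cvg_at_right_filter; exact: cF.
  by apply: cvg_at_left_filter; exact: cF.
- by move=> x _; rewrite derive1E; have [] := hF x.
Qed.

Lemma circle_mean_mono (g h : C -> \bar R) : (forall z, unit_circle z -> (g z <= h z)%E) ->
  (circle_mean g <= circle_mean h)%E.
Proof.
move=> gh; apply: lee_wpmul2l.
  by rewrite lee_fin invr_ge0 mulr_ge0// pi_ge0.
by apply: le_integral_pointwise => t _; apply: gh; exact: unit_circleE.
Qed.

Lemma circle_mean_le (f : R -> R) (g : C -> \bar R) : integ 0 (2 * pi) f ->
  (forall t, 0 <= t <= 2 * pi -> (g (E t) <= (f t)%:E)%E) ->
  (circle_mean g <= ((2 * pi)^-1 * rint 0 (2 * pi) f)%:E)%E.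
Proof.
move=> hf h; rewrite /circle_mean EFinM; apply: lee_wpmul2l.
  by rewrite lee_fin invr_ge0 mulr_ge0// pi_ge0.
rewrite /rint /Rintegral fineK; last exact: integrable_fin_num.
by apply: le_integral_pointwise => t; rewrite /= in_itv /=; exact: h.
Qed.

End Integral.

(** * A trigonometric partition of unity *)

Section Kernel.
Context {R : realType}.
Local Notation C := (R[i]^o).

Lemma ReM_real (a : R) (z : C) : complex.Re (a%:C * z : C) = a * complex.Re z.
Proof. by case: z => x y /=; rewrite mul0r subr0. Qed.

Lemma Re_sum (I : Type) (r : seq I) (F : I -> C) :
  complex.Re (\sum_(i <- r) F i : C) = \sum_(i <- r) complex.Re (F i).
Proof. by elim/big_rec2: _ => // i x y _ <-; case: (F i) => a b; case: y. Qed.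

(** The subtractions are truncated, so one summand vanishes and the sum is |i - N|. *)
Definition ndist (i N : nat) : nat := ((i - N) + (N - i))%N.

Lemma cos_ndist (i N : nat) (s : R) : cos ((i%:R - N%:R) * s) = cos ((ndist i N)%:R * s).
Proof.
rewrite /ndist; case: (leqP N i) => h.
  by rewrite (eqP h) addn0 natrB.
have hN : (i - N)%N = 0%N by apply/eqP; rewrite subn_eq0 ltnW.
by rewrite hN add0n natrB ?(ltnW h)// -opprB mulNr cosN.
Qed.

(* kr N M is (2 + 2 cos s)^N = (2 cos (s / 2))^(2N) normalised so that, for N < M,
   its translates by the nodes 2 pi l / M sum to 1; it concentrates at 0 as N
   grows. kap N M l is the Laurent polynomial that restricts to its l-th translate
   on the circle. *)
Definition kfac (N M : nat) : R := (M%:R * 'C(2 * N, N)%:R)^-1.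

Definition kr (N M : nat) (s : R) : R := kfac N M * (2 + 2 * cos s) ^+ N.

Definition node (M l : nat) : R := l%:R * (2 * pi / M%:R).

Definition kap (N M l : nat) (z : C) : C :=
  ((kfac N M)%:C : C) * ((z / E (node M l))^-1 ^+ N * (1 + z / E (node M l)) ^+ (2 * N)).

Lemma E_sqr_cos (s : R) : ((E s)^-1 * (1 + E s) ^+ 2 : C) = (2 + 2 * cos s)%:C.
Proof.
have h : ((E s)^-1 : C) = E (- s) by rewrite EN.
have -> : ((E s)^-1 * (1 + E s) ^+ 2 : C) = (E s)^-1 + 2 + E s.
  have key (w : R[i]) : w != 0 -> w^-1 * (1 + w) ^+ 2 = w^-1 + 2 + w by move=> w0; field.
  exact: key (E_neq0 s).
rewrite h /E cosN sinN; apply/eqP; rewrite eq_complex /=; apply/andP; split; apply/eqP; lra.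
Qed.

Lemma kap_circle N M l t : kap N M l (E t) = (kr N M (t - node M l))%:C.
Proof.
rewrite /kap /kr rmorphM rmorphXn /= -E_sqr_cos ED EN exprMn -exprM//.
Qed.

(** Binomial expansion of w^(-N) (1 + w)^(2N) at w = e^{is}. Taking real parts turns the frequencies
    i - N into the natural numbers |i - N| <= N. *)
Lemma cosbin N (s : R) : (2 + 2 * cos s) ^+ N =
  \sum_(i < (2 * N).+1) 'C(2 * N, i)%:R * cos ((ndist i N)%:R * s).
Proof.
have h : (((2 + 2 * cos s) ^+ N)%:C : C) = \sum_(i < (2 * N).+1) (('C(2 * N, i)%:R)%:C : C) * E ((i%:R - N%:R) * s).
  rewrite rmorphXn /= -E_sqr_cos exprMn -exprM exprDn mulr_sumr; apply: eq_bigr => i _.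
  rewrite expr1n mul1r -mulr_natl rmorph_nat mulrCA; congr (_ * _).
  by rewrite mulrBl ED EX EN EX mulrC exprVn.
rewrite -[LHS]/(complex.Re (((2 + 2 * cos s) ^+ N)%:C : C)) h Re_sum.
by apply: eq_bigr => i _; rewrite ReM_real /= cos_ndist.
Qed.

(** The central coefficient is the largest of 2N + 1 coefficients with sum 4^N; the proof uses the
    ratio of consecutive central coefficients. Normalising the kernel thus costs only a factor 2N +
    1 against the geometric decay. *)
Lemma bin_central_ge N : 4 ^+ N <= (2 * N%:R + 1) * 'C(2 * N, N)%:R :> R.
Proof.
elim: N => [|N IH]; first by rewrite expr0 mulr0 add0r mul1r bin0.
have h : (N.+1 * 'C(2 * N.+1, N.+1) = 2 * (2 * N).+1 * 'C(2 * N, N))%N.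
  have h1 : ((2 * N).+2 * 'C((2 * N).+1, N) = N.+1 * 'C((2 * N).+2, N.+1))%N by rewrite mul_bin_diag.
  have h2 : ((2 * N).+1 * 'C(2 * N, N) = N.+1 * 'C((2 * N).+1, N))%N.
    rewrite mul_bin_down; congr (_ * _)%N; lia.
  have -> : (2 * N.+1 = (2 * N).+2)%N by lia.
  rewrite -h1 -mulnA h2; lia.
have hR : (N%:R + 1) * 'C(2 * N.+1, N.+1)%:R = 2 * (2 * N%:R + 1) * 'C(2 * N, N)%:R :> R.
  have := congr1 (fun n : nat => n%:R : R) h.
  by rewrite !natrM -[N.+1%:R]natr1 -[(2 * N).+1%:R]natr1 natrM.
have N0 : 0 <= N%:R :> R by [].
have c0 : 0 <= 'C(2 * N, N)%:R :> R by [].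
have N1 : 0 < N%:R + 1 :> R by lra.
rewrite -(ler_pM2l N1) exprS.
have -> : (N%:R + 1) * ((2 * N.+1%:R + 1) * 'C(2 * N.+1, N.+1)%:R) =
  (2 * N.+1%:R + 1) * ((N%:R + 1) * 'C(2 * N.+1, N.+1)%:R) :> R by ring.
rewrite hR -[N.+1%:R]natr1.
apply: (@le_trans _ _ ((N%:R + 1) * 4 * ((2 * N%:R + 1) * 'C(2 * N, N)%:R))).
  by rewrite [X in X <= _]mulrA ler_pM2l// mulr_gt0.
move: (N%:R : R) ('C(2 * N, N)%:R : R) N0 c0 => x c x0 c0; nra.
Qed.

(** Real part of a geometric sum whose ratio [q] is an M-th root of unity different from 1, as 0 < j
    < M. *)
Lemma sum_nodes_cos (M j : nat) (t : R) : (0 < j < M)%N ->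
  \sum_(l < M) cos (j%:R * (t - node M l)) = 0.
Proof.
move=> /andP[j0 jM].
have M0 : 0 < M%:R :> R by rewrite ltr0n; lia.
pose q : C := E (- (j%:R * (2 * pi / M%:R))).
have hE (l : nat) : E (j%:R * (t - node M l)) = E (j%:R * t) * q ^+ l :> C.
  by rewrite /q -EX -ED /node; congr E; ring.
have q1 : q != 1.
  rewrite /q EN; apply/eqP => /(congr1 (fun x : C => x^-1)); rewrite invrK invr1 => /eqP; apply/negP.
  apply: E_neq1; have p0 := pi_gt0 R.
  rewrite mulr_gt0 ?ltr0n ?divr_gt0 ?mulr_gt0//=.
  rewrite mulrA ltr_pdivrMr// mulrC ltr_pM2l ?mulr_gt0// ltr_nat//.
have qM : q ^+ M = 1.
  rewrite /q -EX mulrN EN.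
  have -> : M%:R * (j%:R * (2 * pi / M%:R)) = j%:R * (2 * pi) :> R by field; rewrite gt_eqF.
  by rewrite EX E2pi expr1n invr1.
have s0 : \sum_(l < M) q ^+ l = 0.
  apply/eqP; have := subrX1 (q : R[i]) M; rewrite qM subrr => /esym/eqP.
  by rewrite mulf_eq0 subr_eq0 (negbTE q1).
have -> : \sum_(l < M) cos (j%:R * (t - node M l)) = complex.Re (\sum_(l < M) E (j%:R * (t - node M l)) : C).
  by rewrite Re_sum.
under eq_bigr do rewrite hE.
by rewrite -mulr_sumr s0 mulr0.
Qed.

Lemma kr_ge0 N M s : 0 <= kr N M s.
Proof.
rewrite /kr mulr_ge0// ?exprn_ge0// ?invr_ge0 ?mulr_ge0//.
Qed.

(** By [cosbin] the frequencies are at most N < M, so summation over the nodes kills all of them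
    except frequency 0, which comes from [i = N]. *)
Lemma sum_kr N M t : (N < M)%N -> \sum_(l < M) kr N M (t - node M l) = 1.
Proof.
move=> NM.
have M0 : (0 < M%:R :> R) by rewrite ltr0n; lia.
rewrite /kr -mulr_sumr.
under eq_bigr do rewrite cosbin.
rewrite exchange_big /=.
have NN : (N < (2 * N).+1)%N by lia.
rewrite (bigD1 (Ordinal NN)) //= [X in _ * (_ + X)]big1 ?addr0; last first.
  move=> i /eqP iN; rewrite -mulr_sumr sum_nodes_cos ?mulr0//.
  have : (i : nat) <> N by move=> h; apply: iN; apply: val_inj.
  have := ltn_ord i; rewrite /ndist; lia.
rewrite -mulr_sumr; under eq_bigr do rewrite /ndist subnn addn0 mul0r cos0.
rewrite sumr_const card_ord /kfac mulrC -mulr_natl mulr1 [_ * M%:R]mulrC mulfV//.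
by rewrite mulf_neq0 ?gt_eqF// ltr0n bin_gt0; lia.
Qed.

(** With q = sqrt r, one factor q^N absorbs 2N + 1: the inequality [bern] bounds N q^N by 1 / (1 -
    q). The other factor q^N tends to 0. *)
Lemma natM_expr_small (r e : R) : 0 <= r < 1 -> 0 < e -> exists N : nat, (2 * N%:R + 1) * r ^+ N <= e.
Proof.
move=> /andP[r0 r1] e0.
pose q := Num.sqrt r.
have q0 : 0 <= q by exact: sqrtr_ge0.
have rq : r = q ^+ 2 by rewrite sqr_sqrtr.
have q1 : q < 1 by rewrite -(@ltr_pXn2r _ 2) ?nnegrE// -rq expr1n.
have bern N : N%:R * q ^+ N * (1 - q) + q ^+ N <= 1.
  elim: N => [|N IH]; first by rewrite mul0r mul0r add0r expr0.
  have h1 : q ^+ N.+1 <= 1 by rewrite exprn_ile1// ltW.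
  have h2 : q ^+ N.+1 * (1 - q) <= 1 - q by rewrite ler_piMl// subr_ge0 ltW.
  have h3 := ler_wpM2l q0 IH.
  rewrite -natr1 exprS in h1 h2 *; lra.
have q2 : 0 < 1 - q by rewrite subr_gt0.
pose K := 2 / (1 - q) + 1.
have K0 : 0 < K by rewrite /K; have := divr_gt0 (ltr0Sn R 1) q2; lra.
have /cvgrPdist_lt/(_ _ (divr_gt0 e0 K0)) : (GRing.exp q : R^nat) n @[n --> \oo] --> (0 : R).
  by apply: cvg_expr; rewrite ger0_norm.
move=> [N _ /(_ N (leqnn N))]; rewrite /= sub0r normrN ger0_norm ?exprn_ge0// => hN.
exists N; rewrite rq -exprM mulnC exprM expr2 mulrA.
have qN := exprn_ge0 N q0.
apply: (@le_trans _ _ (K * q ^+ N)); last by rewrite mulrC -ler_pdivlMr// ltW.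
rewrite ler_wpM2r// /K mulrDl mul1r lerD//; last by rewrite exprn_ile1// ltW.
rewrite -mulrA ler_pM2l// -[leRHS]mul1r ler_pdivlMr//.
have := bern N; lra.
Qed.

(** Since |e^{is} - 1|^2 = 2 - 2 cos s, the base 2 + 2 cos s is at most 4 r with r < 1 away from 0,
    and [bin_central_ge] leaves (2N + 1) r^N. The factor [M] cancels the one in [kfac], so [N] can
    be fixed before [M], and the far nodes together weigh at most [e]. *)
Lemma kr_small (d e : R) : 0 < d -> 0 < e -> exists N : nat, forall M s, (0 < M)%N ->
  d <= nr (E s - 1 : C) -> M%:R * kr N M s <= e.
Proof.
move=> d0 e0.
pose r := 1 - d ^+ 2 / 4.
have [r0|r0] := leP r 0.
  exists 1%N => M s M0 ds.
  have := nr_E1 s; have := @ler_pXn2r R 2 isT d (nr (E s - 1 : C)).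
  rewrite !nnegrE nr_ge0 ltW// => /(_ isT isT); rewrite ds => h1 h2.
  have h3 : 2 + 2 * cos s <= 0 by rewrite /r in r0; lra.
  apply: (@le_trans _ _ 0); last exact: ltW.
  apply: mulr_ge0_le0 => //; rewrite /kr expr1; apply: mulr_ge0_le0 => //.
  by rewrite invr_ge0 mulr_ge0.
have r1 : r < 1 by rewrite /r; have := exprn_gt0 2 d0; lra.
have [N hN] : exists N : nat, (2 * N%:R + 1) * r ^+ N <= e.
  by apply: natM_expr_small => //; rewrite r1 ltW.
exists N => M s M0 ds.
have M0' : 0 < M%:R :> R by rewrite ltr0n.
have hc : 0 < 'C(2 * N, N)%:R :> R by rewrite ltr0n bin_gt0; lia.
have -> : M%:R * kr N M s = (2 + 2 * cos s) ^+ N / 'C(2 * N, N)%:R.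
  by rewrite /kr /kfac; field; rewrite !gt_eqF.
rewrite ler_pdivrMr//; apply: (@le_trans _ _ ((4 * r) ^+ N)).
  apply: lerXn2r; rewrite ?nnegrE; [by have := cos_geN1 s; lra | by rewrite mulr_ge0 ?ltW|].
  have := nr_E1 s; have := @ler_pXn2r R 2 isT d (nr (E s - 1 : C)).
  by rewrite !nnegrE nr_ge0 ltW// => /(_ isT isT); rewrite ds /r => h1 h2; lra.
rewrite exprMn.
apply: (@le_trans _ _ ((2 * N%:R + 1) * 'C(2 * N, N)%:R * r ^+ N)).
  by rewrite ler_wpM2r ?bin_central_ge// exprn_ge0// ltW.
by rewrite mulrAC ler_wpM2r// ltW.
Qed.

End Kernel.

(** * Approximation by real parts of polynomials *)

Section Trig.
Context {R : realType}.
Local Notation C := (R[i]^o).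

Lemma nr_EB (s t : R) : nr (E (s - t) - 1 : C) = nr (E s - E t).
Proof.
have -> : (E s - E t : C) = (E t * (E (s - t) - 1) : C).
  by rewrite mulrBr mulr1 -ED [t + _]addrC subrK.
by rewrite nrM nr_E mul1r.
Qed.

(** The nodes are split by their distance from [E t]: the near ones have total weight at most 1, the
    far ones at most [eta]. *)
Lemma kr_avg (N M : nat) (t d e B eta : R) (x : nat -> R) : (N < M)%N -> 0 <= e -> 0 <= B -> 0 <= eta ->
  (forall s, d <= nr (E s - 1 : C) -> M%:R * kr N M s <= eta) ->
  (forall l, (l < M)%N -> nr (E t - E (node M l)) < d -> x l <= e) ->
  (forall l, (l < M)%N -> x l <= B) ->
  \sum_(l < M) kr N M (t - node M l) * x l <= e + eta * B.
Proof.
move=> NM e0 B0 eta0 far xe xB.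
have M0 : 0 < M%:R :> R by rewrite ltr0n; lia.
apply: (@le_trans _ _ (\sum_(l < M) (kr N M (t - node M l) * e + eta / M%:R * B))).
  apply: ler_sum => l _.
  have k0 := kr_ge0 N M (t - node M l).
  have [near|far'] := ltP (nr (E t - E (node M l))) d.
    rewrite -[X in X <= _]addr0; apply: lerD; first by rewrite ler_wpM2l// xe.
    by rewrite mulr_ge0// divr_ge0// ltW.
  rewrite -[X in X <= _]add0r; apply: lerD; first by rewrite mulr_ge0.
  apply: (@le_trans _ _ (kr N M (t - node M l) * B)); first by rewrite ler_wpM2l// xB.
  rewrite ler_wpM2r// ler_pdivlMr// mulrC far// nr_EB//.
rewrite big_split /= -mulr_suml sum_kr// mul1r lerD2l sumr_const card_ord.
rewrite -[_ *+ M]mulr_natl; have -> : M%:R * (eta / M%:R * B) = eta * B by field; rewrite gt_eqF.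
by [].
Qed.

(** As cos(m s) = Re e^{ims}, only nonnegative powers are needed: a real trigonometric polynomial is
    the real part of an ordinary polynomial on the circle. *)
Lemma trig_poly (N M : nat) (g : nat -> R) : exists P : {poly R[i]},
  forall t, complex.Re (P.[E t] : C) = \sum_(l < M) g l * kr N M (t - node M l).
Proof.
pose a (l : 'I_M) (i : 'I_(2 * N).+1) : R[i] :=
  (g l * (kfac N M * 'C(2 * N, i)%:R))%:C * (E (node M l))^-1 ^+ ndist i N.
exists (\sum_(l < M) \sum_(i < (2 * N).+1) a l i *: 'X^(ndist i N)) => t.
rewrite horner_sum (Re_sum (R:=R)); apply: eq_bigr => l _.
rewrite horner_sum (Re_sum (R:=R)) /kr cosbin !mulr_sumr; apply: eq_bigr => i _.
rewrite hornerZ hornerXn /a -mulrA -exprMn.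
have -> : (E (node M l))^-1 * E t = E (t - node M l) :> C by rewrite ED EN mulrC.
by rewrite -(EX (t - node M l)) (ReM_real (R:=R)) /= !mulrA.
Qed.

Definition ucont_circle (G : C -> R) := forall e : R, 0 < e -> exists2 d : R, 0 < d &
  forall z w, unit_circle z -> unit_circle w -> nr (z - w) < d -> `|G z - G w| < e.

Lemma ucont_circle_bounded (G : C -> R) : ucont_circle G ->
  exists2 B : R, 0 <= B & forall z, unit_circle z -> `|G z| <= B.
Proof.
move=> uG; have [d d0 hd] := uG 1 ltr01.
have [|||e e0 he] := @compact_unif R C unit_circle (fun e z => `|G z| <= e^-1).
- exact: compact_unit_circle.
- by move=> a b y a0 ab /le_trans; apply; rewrite lef_pV2// posrE//; exact: lt_le_trans ab.
- move=> x Tx; exists (`|G x| + 1)^-1; first by rewrite invr_gt0 ltr_wpDl.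
  apply/nbhs_nrP; exists d => // y yx Ty; rewrite invrK.
  have := hd _ _ Ty Tx yx => h.
  have -> : G y = G x + (G y - G x) by rewrite addrC subrK.
  by apply: le_trans (ler_normD _ _) _; rewrite lerD2l ltW.
by exists e^-1 => //; rewrite invr_ge0 ltW.
Qed.

(** The approximant averages the values of [G] at the nodes with weights [kr], so the error is an
    average of |G(node) - G(E t)|: small for near nodes by uniform continuity, bounded by [B] for
    the others. *)
Lemma trig_approx (G : C -> R) (e : R) : ucont_circle G -> 0 < e -> exists P : {poly R[i]},
  forall t, `|complex.Re (P.[E t] : C) - G (E t)| <= e.
Proof.
move=> uG e0.
have [B B0 hB] : exists2 B : R, 0 <= B & forall t s, `|G (E t) - G (E s)| <= B.
  have [b b0 hb] := ucont_circle_bounded uG.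
  exists (b + b); first by rewrite addr_ge0.
  by move=> t s; apply: le_trans (ler_normB _ _) _; rewrite lerD// hb//; exact: unit_circleE.
have [d d0 hd] := uG (e / 2) ltac:(lra).
have eB : 0 < e / (2 * (B + 1)) by rewrite divr_gt0// mulr_gt0//; lra.
have [N hN] := kr_small d0 eB.
pose M := N.+1.
have [P hP] := trig_poly N M (fun l => G (E (node M l))).
exists P => t; rewrite hP.
have -> : \sum_(l < M) G (E (node M l)) * kr N M (t - node M l) - G (E t) =
  \sum_(l < M) kr N M (t - node M l) * (G (E (node M l)) - G (E t)).
  under [RHS]eq_bigr do rewrite mulrBr mulrC.
  by rewrite sumrB -mulr_suml sum_kr// mul1r.
apply: le_trans (ler_norm_sum _ _ _) _.
under eq_bigr do rewrite normrM (ger0_norm (kr_ge0 _ _ _)).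
apply: (@le_trans _ _ (e / 2 + e / (2 * (B + 1)) * B)).
  apply: (kr_avg (d := d) (x := fun l => `|G (E (node M l)) - G (E t)|)) => //; [lra|exact: ltW| |].
    by move=> s; exact: hN.
  move=> l _ h; apply: ltW; apply: hd; [exact: unit_circleE|exact: unit_circleE|by rewrite nrBC].
have : e / (2 * (B + 1)) * (B + 1) = e / 2 by field; apply/eqP; lra.
have := ltW eB; nra.
Qed.

Lemma is_derive_linM (c t : R) : is_derive t (1 : R) (fun x : R => c * x) c.
Proof.
have -> : (fun x : R => c * x) = c \*: (id : R -> R) by [].
apply: is_derive_eq; by rewrite /GRing.scale /= mulr1.
Qed.

Lemma is_derive_sinM (c t : R) : is_derive t (1 : R) (fun x : R => sin (c * x)) (c * cos (c * t)).
Proof.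
rewrite mulrC; exact: (@is_derive1_comp R sin (fun x => c * x) t _ _ (is_derive_sin _) (is_derive_linM c t)).
Qed.

Lemma is_derive_cosM (c t : R) : is_derive t (1 : R) (fun x : R => cos (c * x)) (c * - sin (c * t)).
Proof.
rewrite mulrC; exact: (@is_derive1_comp R cos (fun x => c * x) t _ _ (is_derive_cos _) (is_derive_linM c t)).
Qed.

(** Without its constant term, Re P(e^{it}) can be integrated term by term, and the primitive is
    again a trigonometric polynomial, hence bounded and periodic. *)
Lemma trig_primitive (P : {poly R[i]}) : exists S : R -> R, exists2 B : R, 0 <= B &
  (forall t : R, is_derive t (1 : R) S (complex.Re (P.[E t] : C) - complex.Re (P.[0] : C))) /\
  (forall t, `|S t| <= B) /\ S (2 * pi) = S 0.
Proof.
have key (a : nat -> R[i]) n : exists S : R -> R, exists2 B : R, 0 <= B &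
  (forall t : R, is_derive t (1 : R) S (complex.Re (\sum_(i < n) a i * E t ^+ i : C) - complex.Re (\sum_(i < n) a i * 0 ^+ i : C))) /\
  (forall t, `|S t| <= B) /\ S (2 * pi) = S 0.
  elim: n => [|n [S [B B0 [dS [bS pS]]]]].
    exists (cst 0); exists 0 => //; split; last by split => // t; rewrite normr0.
    by move=> t; rewrite !big_ord0 subrr; exact: is_derive_cst.
  (* The constant coefficient cancels against the value at 0, so its primitive is zero; every later
     coefficient is divided by its positive frequency. *)
  case: n dS => [|n] dS.
    exists (cst 0); exists 0 => //; split; last by split => // t; rewrite normr0.
    move=> t; rewrite !big_ord_recr !big_ord0 /= !expr0 subrr; exact: is_derive_cst.
  case ea : (a n.+1) => [u v].
  pose T := fun t : R => (u * sin (n.+1%:R * t) + v * cos (n.+1%:R * t)) / n.+1%:R.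
  have n0 : n.+1%:R != 0 :> R by rewrite pnatr_eq0.
  exists (fun t => S t + T t); exists (B + (`|u| + `|v|)); first by rewrite addr_ge0 ?addr_ge0.
  split.
    move=> t; rewrite big_ord_recr [X in _ - complex.Re X]big_ord_recr /=.
    rewrite expr0n /= mulr0 addr0.
    have -> : complex.Re (\sum_(i < n.+1) a i * E t ^+ i + a n.+1 * E t ^+ n.+1) = 
      complex.Re (\sum_(i < n.+1) a i * E t ^+ i : C) + (u * cos (n.+1%:R * t) - v * sin (n.+1%:R * t)).
      by rewrite ea -(EX t n.+1); case: (\sum_(i < n.+1) _) => x y.
    rewrite addrAC; apply: is_deriveD.
    have hT := is_deriveZ (n.+1%:R^-1) (is_deriveD (is_deriveZ u (is_derive_sinM n.+1%:R t)) (is_deriveZ v (is_derive_cosM n.+1%:R t))).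
    have -> : T = n.+1%:R^-1 \*: (u \*: (fun x => sin (n.+1%:R * x)) + v \*: (fun x => cos (n.+1%:R * x))).
      by apply/funext => x; rewrite /T mulrC.
    apply: is_derive_eq hT _.
    by rewrite /GRing.scale /=; field.
  split.
    move=> t; apply: le_trans (ler_normD _ _) _; apply: lerD => //.
    rewrite /T normrM normfV (ger0_norm (ler0n _ _)) ler_pdivrMr ?ltr0n//.
    apply: (@le_trans _ _ (`|u| + `|v|)).
      apply: le_trans (ler_normD _ _) _; rewrite !normrM; apply: lerD; rewrite ler_piMr//.
        exact: sin_max.
      exact: cos_max.
    by rewrite ler_peMr ?addr_ge0// ler1n.
  rewrite pS /T mulr0 sin0 cos0.
  have : E (n.+1%:R * (2 * pi)) = 1 :> C by rewrite EX E2pi expr1n.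
  by move=> [-> ->].
have [S [B B0 [dS h]]] := key (fun i => P`_i) (size P).
exists S; exists B => //; split => // t.
have e (x : C) : P.[x] = \sum_(i < size P) P`_i * x ^+ i by rewrite horner_coef.
by rewrite !e; exact: dS.
Qed.

End Trig.

(** * Trigonometric majorants *)

Section Majorant.
Context {R : realType}.
Local Notation C := (R[i]^o).

Definition pc (P : {poly R[i]}) (z : C) : R := complex.Re (P.[z] : C).

Lemma pc_cont (P : {poly R[i]}) (z : C) (e : R) : 0 < e ->
  exists2 d : R, 0 < d & forall w, nr (w - z) < d -> `|pc P w - pc P z| < e.
Proof.
move=> e0; have [b hb] := cdiff_poly P z.
have [d d0 hd] := cdiff_cont hb e0; exists d => // w /hd; apply: le_lt_trans.
apply: le_trans (nr_Re _); rewrite /pc.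
by case: (P.[w]) => x y; case: (P.[z]) => x' y' /=.
Qed.

Lemma continuous_eps (f : R -> R) : (forall t e, 0 < e -> exists2 d, 0 < d & forall s, `|s - t| < d -> `|f s - f t| < e) ->
  continuous f.
Proof.
move=> h t; apply/cvgrPdist_lt => e e0; have [d d0 hd] := h t e e0.
apply/nbhs_ballP; exists d => // s; rewrite /ball /= distrC => /hd; by rewrite distrC.
Qed.

Lemma circle_lip (k t s : R) : nr (E (k * s) - E (k * t)) <= (2 * `|k| + 1) * `|s - t|.
Proof.
apply: le_trans (E_lip _ _) _; rewrite -mulrBr normrM mulrA ler_wpM2r//; lra.
Qed.

Lemma pcE_cont (P : {poly R[i]}) (k : R) : continuous (fun t : R => pc P (E (k * t))).
Proof.
apply: continuous_eps => t e e0; have [d d0 hd] := pc_cont P (E (k * t)) e0.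
have K0 : 0 < 2 * `|k| + 1 by have := normr_ge0 k; lra.
exists (d / (2 * `|k| + 1)); first by rewrite divr_gt0.
move=> s; rewrite ltr_pdivlMr// mulrC => h; apply: hd; exact: le_lt_trans (circle_lip _ _ _) h.
Qed.

Lemma pcE1_cont (P : {poly R[i]}) : continuous (fun t : R => pc P (E t)).
Proof.
have := @pcE_cont P 1; have -> // : (fun t : R => pc P (E (1 * t))) = (fun t => pc P (E t)).
by apply/funext => t; rewrite mul1r.
Qed.

Lemma integ_pcE (P : {poly R[i]}) (k a b : R) : integ a b (fun t : R => pc P (E (k * t))).
Proof. by apply: integ_cont; apply: continuous_subspaceT => x; exact: pcE_cont. Qed.

(** If [S] is the bounded primitive of Re P(e^{it}) - Re P(0), then S(kt) / k is one for the
    rescaled integrand; hence an error [B / k] that does not depend on the interval. *)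
Lemma rint_equidist (P : {poly R[i]}) : exists2 B : R, 0 <= B & forall (k : nat) a b, (0 < k)%N -> a <= b ->
  `|rint a b (fun t => pc P (E (k%:R * t))) - (b - a) * pc P 0| <= B / k%:R.
Proof.
have [S [B B0 [dS [bS _]]]] := trig_primitive P.
exists (B + B); first by rewrite addr_ge0.
move=> k a b k0 ab.
have k0' : 0 < k%:R :> R by rewrite ltr0n.
have -> : rint a b (fun t => pc P (E (k%:R * t))) - (b - a) * pc P 0 =
   rint a b (fun t => pc P (E (k%:R * t)) - pc P 0).
  rewrite rintB; [|exact: integ_pcE|exact: integ_cst].
  by rewrite rint_cst// [_ * (b - a)]mulrC.
have -> : rint a b (fun t => pc P (E (k%:R * t)) - pc P 0) = k%:R^-1 * S (k%:R * b) - k%:R^-1 * S (k%:R * a).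
  apply: (@rint_FTC R a b _ (fun t => k%:R^-1 * S (k%:R * t))) => //.
    move=> t; apply: cvgB; [exact: pcE_cont|exact: cvg_cst].
  move=> t.
  have h1 := @is_derive1_comp R S (fun x => k%:R * x) t _ _ (dS _) (is_derive_linM k%:R t).
  have := is_deriveZ k%:R^-1 h1.
  by move/is_derive_eq; apply; rewrite /GRing.scale /= mulrCA mulVf ?mulr1// gt_eqF.
rewrite -mulrBr normrM mulrC normfV (ger0_norm (ler0n _ _)) ler_wpM2r ?invr_ge0//.
by apply: le_trans (ler_normB _ _) _; rewrite lerD.
Qed.

Lemma rint_pc (P : {poly R[i]}) : rint 0 (2 * pi) (fun t => pc P (E t)) = 2 * pi * pc P 0.
Proof.
have p0 := pi_gt0 R.
have [S [B B0 [dS [_ pS]]]] := trig_primitive P.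
have c1 := @pcE1_cont P.
have i1 : integ 0 (2 * pi) (fun t => pc P (E t)).
  by apply: integ_cont; apply: continuous_subspaceT => x; exact: c1.
have : rint 0 (2 * pi) (fun t => pc P (E t) - pc P 0) = S (2 * pi) - S 0.
  apply: rint_FTC => //; first by rewrite mulr_ge0// ltW.
  move=> t; apply: cvgB; [exact: c1|exact: cvg_cst].
rewrite pS subrr rintB//; last exact: integ_cst.
by rewrite rint_cst ?mulr_ge0 ?ltW// subr0 => h; lra.
Qed.

Lemma circle_mean_pc (P : {poly R[i]}) (g : C -> \bar R) : (forall z, unit_circle z -> (g z <= (pc P z)%:E)%E) ->
  (circle_mean g <= (pc P 0)%:E)%E.
Proof.
move=> h.
have i1 : integ 0 (2 * pi) (fun t => pc P (E t)).
  by have := @integ_pcE P 1 0 (2 * pi); apply: eq_integ => t _; rewrite mul1r.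
apply: le_trans (circle_mean_le i1 _) _.
  by move=> t _; apply: h; exact: unit_circleE.
by rewrite rint_pc mulrA mulVf ?mul1r// mulf_neq0// gt_eqF// pi_gt0.
Qed.

Lemma usc_nr {V : normedModType R[i]} (U : set V) (v : V -> \bar R) : usc_on U v ->
  forall x a, U x -> (v x < a%:E)%E ->
  exists2 d : R, 0 < d & forall y, U y -> nr (y - x) < d -> (v y < a%:E)%E.
Proof.
by move=> uv x a Ux /(proj2 (uv x Ux)) => /nbhs_nrP[d d0 hd]; exists d => // y Uy yx; exact: hd.
Qed.

Lemma usc_circle_bounded (v : C -> \bar R) : usc_on unit_circle v ->
  exists2 B : R, 0 <= B & forall z, unit_circle z -> (v z < B%:E)%E.
Proof.
move=> uv.
have [|||e e0 he] := @compact_unif R C unit_circle (fun e z => (v z < (e^-1)%:E)%E).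
- exact: compact_unit_circle.
- by move=> a b y a0 ab /lt_le_trans; apply; rewrite lee_fin lef_pV2// posrE//; exact: lt_le_trans ab.
- move=> x Tx; have [vx _] := uv x Tx.
  have [b b0 hb] : exists2 b : R, 0 < b & (v x < b%:E)%E.
    case: (v x) vx => [r| |]// _; last by exists 1 => //; rewrite ltNyr.
    exists (`|r| + 1); first by rewrite ltr_wpDl.
    by rewrite lte_fin; have := ler_norm r; lra.
  have [d d0 hd] := usc_nr uv Tx hb.
  exists b^-1; first by rewrite invr_gt0.
  by apply/nbhs_nrP; exists d => // y yx Ty; rewrite invrK; exact: hd.
by exists e^-1 => //; rewrite invr_ge0 ltW.
Qed.

Section SupConv.
Variables (v : C -> \bar R) (uv : usc_on unit_circle v) (B : R).
Hypothesis (B0 : 0 <= B) (vB : forall z, unit_circle z -> (v z < B%:E)%E).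

(* G i is the sup-convolution of max(v, -i): it is i-Lipschitz and decreases to v. *)
Let rr (i : nat) (w : C) : R := fine (maxe (v w) (- i%:R)%:E).
Let Gs (i : nat) (z : C) := [set rr i w - i%:R * nr (z - w) | w in unit_circle].
Let G (i : nat) (z : C) : R := sup (Gs i z).

Let rrE i w : unit_circle w -> (rr i w)%:E = maxe (v w) (- i%:R)%:E.
Proof.
move=> /vB h; rewrite /rr fineK//.
by move: h; case: (v w) => [r| |]// _; rewrite ?maxNye// -EFin_max.
Qed.

Let rr_le i w : unit_circle w -> rr i w <= B.
Proof.
move=> Tw; rewrite -lee_fin rrE// ge_max (ltW (vB Tw)) /= lee_fin.
by apply: le_trans B0; rewrite oppr_le0.
Qed.

Let Gs_ub i z : ubound (Gs i z) B.
Proof.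
move=> _ [w Tw <-]; apply: le_trans (rr_le i Tw); rewrite lerBlDr lerDl.
by rewrite mulr_ge0// nr_ge0.
Qed.

Let Gs_sup i z : has_sup (Gs i z).
Proof.
split; last by exists B; exact: Gs_ub.
by exists (rr i 1 - i%:R * nr (z - 1)), 1 => //; exact/unit_circleP/nr1.
Qed.

Let G_ge i z : unit_circle z -> (v z <= (G i z)%:E)%E.
Proof.
move=> Tz; apply: (@le_trans _ _ (rr i z)%:E).
  by rewrite rrE// le_max lexx.
rewrite lee_fin; apply: sup_upper_bound; first exact: Gs_sup.
by exists z => //; rewrite subrr nr0 mulr0 subr0.
Qed.

Let G_le i z : G i z <= B.
Proof. by apply: ge_sup; [case: (Gs_sup i z)|exact: Gs_ub]. Qed.

Let G_lip i z z' : G i z <= G i z' + i%:R * nr (z - z').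
Proof.
apply: ge_sup; first by case: (Gs_sup i z).
move=> _ [w Tw <-]; rewrite -lerBlDr.
apply: (@le_trans _ _ (rr i w - i%:R * nr (z' - w))); last first.
  by apply: sup_upper_bound; [exact: Gs_sup|exists w].
rewrite -addrA lerD2l -opprD lerN2 -mulrDr ler_wpM2l//.
have -> : z' - w = (z' - z) + (z - w) by rewrite addrA subrK.
by rewrite addrC [nr (z - z')]nrBC; exact: nrD.
Qed.

Let G_dec i z : G i.+1 z <= G i z.
Proof.
apply: ge_sup; first by case: (Gs_sup i.+1 z).
move=> _ [w Tw <-]; apply: (@le_trans _ _ (rr i w - i%:R * nr (z - w))); last first.
  by apply: sup_upper_bound; [exact: Gs_sup|exists w].
apply: lerB; last by rewrite ler_wpM2r ?nr_ge0// ler_nat.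
rewrite -lee_fin !rrE//; apply: le_max2 => //.
by rewrite lee_fin lerN2 ler_nat.
Qed.

Let G_lim z (a : R) : unit_circle z -> (v z < a%:E)%E -> exists i0, forall i, (i0 <= i)%N -> G i z <= a.
Proof.
move=> Tz va; have [d d0 hd] := usc_nr uv Tz va.
(* From [i0] on, the truncation level [- i] is at most [a], and a point [w] at distance at least [d]
   from [z] pays a penalty of at least [B - a]. *)
have [i0 hi0] : exists i0 : nat, - a <= i0%:R /\ B - a <= i0%:R * d.
  pose x := Order.max (- a) ((B - a) / d).
  exists (Num.truncn `|x|).+1.
  have hx : x < (Num.truncn `|x|).+1%:R by apply: le_lt_trans (ler_norm x) _; exact: truncnS_gt.
  move: hx; rewrite gt_max => /andP[/ltW ? h]; split => //.
  by rewrite -ler_pdivrMr// ltW.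
exists i0 => i ii; have ii' : i0%:R <= i%:R :> R by rewrite ler_nat.
apply: ge_sup; first by case: (Gs_sup i z).
move=> _ [w Tw <-].
have [near|far] := ltP (nr (w - z)) d.
  apply: (@le_trans _ _ (rr i w)); first by rewrite lerBlDr lerDl mulr_ge0// nr_ge0.
  rewrite -lee_fin rrE// ge_max (ltW (hd _ Tw near)) /= lee_fin; lra.
have h1 := rr_le i Tw.
have h2 : i0%:R * d <= i%:R * nr (z - w) by rewrite nrBC ler_pM// ltW.
lra.
Qed.

Let GE_cont i : continuous (fun t => G i (E t)).
Proof.
apply: continuous_eps => t e e0.
have K0 : 0 < i%:R * 2 + 1 :> R by rewrite ltr_wpDl// mulr_ge0.
exists (e / (i%:R * 2 + 1)); first exact: divr_gt0.
move=> s; rewrite ltr_pdivlMr// => h.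
have l1 := G_lip i (E s) (E t); have l2 := G_lip i (E t) (E s); rewrite nrBC in l2.
have l3 : i%:R * nr (E s - E t) <= i%:R * (2 * `|s - t|) by rewrite ler_wpM2l// E_lip.
have l4 : i%:R * (2 * `|s - t|) <= `|s - t| * (i%:R * 2 + 1) by have := normr_ge0 (s - t); lra.
rewrite ltr_norml; apply/andP; split; lra.
Qed.

Let iG i : integ 0 (2 * pi) (fun t => G i (E t)).
Proof. by apply: integ_cont; apply: continuous_subspaceT => x; exact: GE_cont. Qed.

(** Some [G i] has mean below [c]. Otherwise monotone convergence of the nonnegative functions
    [B - G i] gives a limit [W] of integral at most 2 pi (B - c); since B - W <= v pointwise, the
    mean of [v] would be at least [c]. *)
Lemma supconv_mean (c : R) : (circle_mean v < c%:E)%E -> exists G0 : C -> R,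
  [/\ ucont_circle G0, (forall z, unit_circle z -> (v z <= (G0 z)%:E)%E),
      integ 0 (2 * pi) (fun t => G0 (E t)) & rint 0 (2 * pi) (fun t => G0 (E t)) < 2 * pi * c].
Proof.
move=> vc; apply: contrapT => hn.
have p0 := pi_gt0 R.
have Gc i : 2 * pi * c <= rint 0 (2 * pi) (fun t => G i (E t)).
  rewrite leNgt; apply/negP => h; apply: hn; exists (G i); split => //; last 1 first.
    by move=> z; exact: G_ge.
  move=> e e0; have K0 : 0 < i%:R + 1 :> R by rewrite ltr_wpDl.
  exists (e / (i%:R + 1)); first exact: divr_gt0.
  move=> z w _ _; rewrite ltr_pdivlMr// => hzw.
  have l1 := G_lip i z w; have l2 := G_lip i w z; rewrite nrBC in l2.
  have l4 : i%:R * nr (z - w) <= nr (z - w) * (i%:R + 1) by have := nr_ge0 (z - w); lra.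
  rewrite ltr_norml; apply/andP; split; lra.
pose D : set R := `[0, 2 * pi]%classic.
pose g (i : nat) (t : R) : \bar R := (B - G i (E t))%:E.
have mg i : measurable_fun D (g i).
  have /integrableP[] // : (@lebesgue_measure R).-integrable D (g i).
  by apply: integB => //; exact: integ_cst.
have g0 i t : D t -> (0 <= g i t)%E by move=> _; rewrite lee_fin subr_ge0; exact: G_le.
have ndg t : D t -> {homo g^~ t : n m / (n <= m)%N >-> (n <= m)%E}.
  move=> _; apply: (@homo_leq _ (g^~ t) (fun x y => (x <= y)%E)) => //; first exact: le_trans.
  by move=> i; rewrite lee_fin lerB ?G_dec.
have mcv := @monotone_convergence _ _ R (@lebesgue_measure R) D (measurable_itv _) g mg g0 ndg.
set W := fun t => limn (g^~ t) in mcv.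
have cvgW t : cvgn (g^~ t).
  apply: ereal_nondecreasing_is_cvgn; apply: homo_leq => //; first exact: le_trans.
  by move=> i; rewrite lee_fin lerB ?G_dec.
have W0 t : (0 <= W t)%E by apply: lime_ge => //; apply: nearW => i; rewrite lee_fin subr_ge0; exact: G_le.
have mW : measurable_fun D W.
  by apply: emeasurable_fun_cvg => // t _; exact: cvgW.
have intW : (\int[lebesgue_measure]_(t in D) W t <= (2 * pi * (B - c))%:E)%E.
  rewrite mcv; apply: lime_le.
    apply: ereal_nondecreasing_is_cvgn => i j ij; apply: le_integral_pointwise => t Dt; exact: ndg.
  apply: nearW => i.
  have -> : (\int[lebesgue_measure]_(x in D) g i x = (rint 0 (2 * pi) (fun t => B - G i (E t)))%:E)%E.
    rewrite /rint /Rintegral fineK//; apply: integrable_fin_num => //.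
    by apply: integB => //; exact: integ_cst.
  rewrite lee_fin rintB//; last exact: integ_cst.
  rewrite rint_cst; [have := Gc i; lra|lra].
have iW : (@lebesgue_measure R).-integrable D W.
  apply/integrableP; split => //.
  under eq_integral do rewrite gee0_abs//.
  by apply: le_lt_trans intW _; rewrite ltry.
(* [W t] may be [+oo], where the claim is trivial. Otherwise no real [a] lies strictly between
   [v (E t)] and [B - W t], because [G i <= a] for large [i] forces [W t >= B - a]. *)
have vW t : D t -> (B%:E - W t <= v (E t))%E.
  move=> _; rewrite leNgt; apply/negP => h.
  have [a [ha1 ha2]] : exists a : R, (v (E t) < a%:E)%E /\ (a%:E < B%:E - W t)%E.
    have W0t := W0 t; have wfin : W t \is a fin_num.
      rewrite ge0_fin_numE// ltey; apply/eqP => Wy; move: h; rewrite Wy /=.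
      by rewrite ltNge leNye.
    move: h; rewrite -(fineK wfin) -EFinB; set w := fine _.
    case: (v (E t)) => [r| |].
    - rewrite lte_fin => h; exists ((r + (B - w)) / 2); rewrite !lte_fin; split; lra.
    - by rewrite ltNge leey.
    - by move=> _; exists (B - w - 1); rewrite ltNyr lte_fin; split => //; lra.
  have [i0 hi0] := G_lim (unit_circleE t) ha1.
  have : ((B - a)%:E <= W t)%E.
    apply: lime_ge => //; exists i0 => // i /= /hi0 hi; rewrite lee_fin; lra.
  move: ha2; have := W0 t; case: (W t) => [w| |] //=.
  rewrite -EFinB !lte_fin !lee_fin; lra.
have : (circle_mean v >= c%:E)%E.
  rewrite /circle_mean.
  have -> : c%:E = ((2 * pi)^-1%:E * (2 * pi * c)%:E)%E.
    by rewrite -EFinM mulrA mulVf ?mul1r// gt_eqF// mulr_gt0.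
  apply: lee_wpmul2l; first by rewrite lee_fin invr_ge0 mulr_ge0// ltW.
  apply: (@le_trans _ _ (\int[lebesgue_measure]_(t in D) (B%:E - W t))%E); last exact: le_integral_pointwise.
  have iB : (@lebesgue_measure R).-integrable D (EFin \o (fun=> B)) by exact: integ_cst.
  rewrite (integralB _ iB iW)//.
  have -> : (\int[lebesgue_measure]_(x in D) (EFin \o (fun=> B)) x = (2 * pi * B)%:E)%E.
    have <- : rint 0 (2 * pi) (fun=> B) = 2 * pi * B by rewrite rint_cst; lra.
    by rewrite /rint /Rintegral fineK//; exact: integrable_fin_num.
  apply: (@le_trans _ _ ((2 * pi * B)%:E - (2 * pi * (B - c))%:E)%E).
    by rewrite -EFinB lee_fin; lra.
  exact: leeB.
  exact: measurable_itv.
by move=> /(lt_le_trans vc); rewrite ltxx.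
Qed.

End SupConv.

Lemma trig_majorant (v : C -> \bar R) (c : R) : usc_on unit_circle v -> (circle_mean v < c%:E)%E ->
  exists P : {poly R[i]}, (forall z, unit_circle z -> (v z < (pc P z)%:E)%E) /\ pc P 0 < c.
Proof.
move=> uv vc; have [B B0 vB] := usc_circle_bounded uv.
have [G [uG vG iG hG]] := supconv_mean uv B0 vB vc.
have p0 := pi_gt0 R.
have [e e0 he] : exists2 e, 0 < e & rint 0 (2 * pi) (fun t => G (E t)) + 2 * pi * (3 * e) < 2 * pi * c.
  exists ((2 * pi * c - rint 0 (2 * pi) (fun t => G (E t))) / (4 * (2 * pi))).
    by rewrite divr_gt0 ?subr_gt0// !mulr_gt0.
  set r := rint _ _ _ in hG *.
  have -> : 2 * pi * (3 * ((2 * pi * c - r) / (4 * (2 * pi)))) = (2 * pi * c - r) * (3 / 4).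
    by field; apply/eqP; lra.
  lra.
have [P0 hP0] := trig_approx uG e0.
(* [P0] is within [e] of [G]; after a shift by [2 * e] it lies strictly above [G], and by at most
   [3 * e], the excess allowed by [he]. *)
exists (P0 + ((2 * e)%:C)%:P).
have pcP z : pc (P0 + ((2 * e)%:C)%:P) z = pc P0 z + 2 * e.
  by rewrite /pc hornerD hornerC; case: (P0.[z]).
split.
  move=> z /unit_circleP /E_surj[t _ ->]; apply: le_lt_trans (vG _ (unit_circleE t)) _.
  rewrite lte_fin pcP; have := hP0 t; rewrite ler_norml /pc => /andP[]; lra.
have : 2 * pi * pc (P0 + ((2 * e)%:C)%:P) 0 <= rint 0 (2 * pi) (fun t => G (E t)) + 2 * pi * (3 * e).
  rewrite -rint_pc.
  have -> : rint 0 (2 * pi) (fun t => G (E t)) + 2 * pi * (3 * e) = rint 0 (2 * pi) (fun t => G (E t) + 3 * e).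
    rewrite rintD//; last exact: integ_cst.
    by rewrite rint_cst ?mulr_ge0 ?ltW// subr0 [_ * (2 * pi)]mulrC.
  apply: le_rint.
  - have := @integ_pcE (P0 + ((2 * e)%:C)%:P) 1 0 (2 * pi); by apply: eq_integ => t _; rewrite mul1r.
  - by apply: integD => //; exact: integ_cst.
  - move=> t _; rewrite pcP; have := hP0 t; rewrite ler_norml /pc => /andP[]; lra.
move=> h; rewrite -(ltr_pM2l (_ : 0 < 2 * pi :> R)) ?mulr_gt0//; lra.
Qed.

End Majorant.

(** * Mean value property of holomorphic functions *)

Section Goursat.
Context {R : realType}.
Local Notation C := (R[i]^o).

Lemma nested_dyadic (a : nat -> R) (w : R) : 0 <= w -> (forall n, a n <= a n.+1) ->
  (forall n, a n.+1 + w / 2 ^+ n.+1 <= a n + w / 2 ^+ n) ->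
  exists x, forall n, a n <= x <= a n + w / 2 ^+ n.
Proof.
move=> w0 inca decb.
have wn n : 0 <= w / 2 ^+ n by rewrite divr_ge0.
have ia : {homo a : n m / (n <= m)%N >-> n <= m} by exact: homo_leq le_trans inca.
have db n m : (n <= m)%N -> a m + w / 2 ^+ m <= a n + w / 2 ^+ n.
  elim: m => [|m IH]; first by rewrite leqn0 => /eqP ->.
  rewrite leq_eqVlt => /orP[/eqP -> //|/IH]; exact: le_trans.
have ub n : ubound (range a) (a n + w / 2 ^+ n).
  move=> _ [m _ <-]; have [nm|mn] := leqP n m.
    by apply: le_trans (db _ _ nm); rewrite lerDl.
  apply: (@le_trans _ _ (a n)); first exact/ia/ltnW.
  by rewrite lerDl.
have hs : has_sup (range a) by split; [exists (a 0%N), 0%N|exists (a 0%N + w / 2 ^+ 0); exact: ub].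
exists (sup (range a)) => n; apply/andP; split.
  by apply: sup_upper_bound => //; exists n.
by apply: ge_sup; [case: hs|exact: ub].
Qed.

Variables (f : C -> C).
Let U (s t : R) : R := complex.Re (f (s +i* t)).
Let V (s t : R) : R := complex.Im (f (s +i* t)).
(* The imaginary part of the integral of f along the boundary of [a, b] x [c, d]. *)
Let J a b c d : R := rint c d (U b) - rint c d (U a) - (rint a b (V^~ d) - rint a b (V^~ c)).

Lemma ReB (x y : C) : complex.Re (x - y : C) = complex.Re x - complex.Re y.
Proof. by case: x; case: y. Qed.

Lemma ImB (x y : C) : complex.Im (x - y : C) = complex.Im x - complex.Im y.
Proof. by case: x; case: y. Qed.

Let U_cont s t b : cdiff f (s +i* t) b -> forall e, 0 < e ->
  exists2 d, 0 < d & forall t', `|t' - t| < d -> `|U s t' - U s t| < e.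
Proof.
move=> hf e e0; have [d d0 hd] := cdiff_cont hf e0; exists d => // t' ht.
rewrite /U -ReB; apply: le_lt_trans (nr_Re _) _; apply: hd.
apply: le_lt_trans (nr_ReIm _) _ => /=.
by rewrite subrr normr0 add0r.
Qed.

Let V_cont s t b : cdiff f (s +i* t) b -> forall e, 0 < e ->
  exists2 d, 0 < d & forall s', `|s' - s| < d -> `|V s' t - V s t| < e.
Proof.
move=> hf e e0; have [d d0 hd] := cdiff_cont hf e0; exists d => // t' ht.
rewrite /V -ImB; apply: le_lt_trans (nr_Im _) _; apply: hd.
apply: le_lt_trans (nr_ReIm _) _ => /=.
by rewrite subrr normr0 addr0.
Qed.

Lemma within_cont_eps (g : R -> R) a b :
  (forall t, a <= t <= b -> forall e, 0 < e -> exists2 d, 0 < d & forall s, `|s - t| < d -> `|g s - g t| < e) ->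
  {within `[a, b], continuous g}.
Proof.
move=> h; apply/subspace_continuousP => t; rewrite /= in_itv /= => ht.
apply/cvgrPdist_lt => e e0; have [d d0 hd] := h t ht e e0.
apply/nbhs_ballP; exists d => // s; rewrite /ball /= distrC => /hd; by rewrite distrC.
Qed.

Lemma rint_abs_le a b (g : R -> R) k : a <= b -> integ a b g -> (forall t, a <= t <= b -> `|g t| <= k) ->
  `|rint a b g| <= k * (b - a).
Proof.
move=> ab ig gk; rewrite ler_norml -mulNr; apply/andP; split.
  rewrite -rint_cst//; apply: le_rint => //; first exact: integ_cst.
  by move=> t /gk; rewrite ler_norml => /andP[].
rewrite -rint_cst//; apply: le_rint => //; first exact: integ_cst.
by move=> t /gk; rewrite ler_norml => /andP[].
Qed.

Section Rect.
Variables (a0 b0 c0 d0 : R).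
Hypothesis hf : forall s t, a0 <= s <= b0 -> c0 <= t <= d0 -> exists b, cdiff f (s +i* t) b.

Let iU s c d : a0 <= s <= b0 -> c0 <= c -> d <= d0 -> integ c d (U s).
Proof.
move=> hs hc hd; apply: integ_cont; apply: within_cont_eps => t /andP[ct td].
have [|b hb] := hf hs (t := t); first by apply/andP; split; lra.
exact: U_cont hb.
Qed.

Let iV t a b : c0 <= t <= d0 -> a0 <= a -> b <= b0 -> integ a b (V^~ t).
Proof.
move=> ht ha hb; apply: integ_cont; apply: within_cont_eps => s /andP[cs sd].
have [|b' hb'] := hf (s := s) _ ht; first by apply/andP; split; lra.
exact: V_cont hb'.
Qed.

Let J_splits a m b c d : a0 <= a -> a <= m -> m <= b -> b <= b0 -> c0 <= c -> c <= d -> d <= d0 ->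
  J a b c d = J a m c d + J m b c d.
Proof.
move=> h1 h2 h3 h4 h5 h6 h7; rewrite /J.
rewrite (@rint_split R a b m (V^~ d))// ?(@rint_split R a b m (V^~ c))//; last 2 first.
- by apply: iV => //; apply/andP; split; lra.
- by apply: iV => //; apply/andP; split; lra.
ring.
Qed.

Let J_splitt a b c m d : a0 <= a -> a <= b -> b <= b0 -> c0 <= c -> c <= m -> m <= d -> d <= d0 ->
  J a b c d = J a b c m + J a b m d.
Proof.
move=> h1 h2 h3 h4 h5 h6 h7; rewrite /J.
rewrite (@rint_split R c d m (U b))// ?(@rint_split R c d m (U a))//; last 2 first.
- by apply: iU => //; apply/andP; split; lra.
- by apply: iU => //; apply/andP; split; lra.
ring.
Qed.

(** With p the real part of the derivative, both differences [U b - U a] and [V^~ d - V^~ c] are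
    constant to first order, namely p (b - a) and p (d - c). Their integrals both equal p (b - a) (d
    - c) and cancel in [J]; the errors [2 * e * D], integrated over the two sides, add up to the
    bound. *)
Let J_local s t e : a0 <= s <= b0 -> c0 <= t <= d0 -> 0 < e ->
  exists2 k, 0 < k & forall a b c d, a0 <= a -> a <= s <= b -> b <= b0 -> c0 <= c -> c <= t <= d -> d <= d0 ->
    (b - a) + (d - c) < k -> `|J a b c d| <= 2 * e * (b - a + (d - c)) ^+ 2.
Proof.
move=> hs ht e0; have [be hbe] := hf hs ht.
have [k k0 hk] := hbe e e0; exists k => // a b c d ha /andP[as' sb] hb hc /andP[ct td] hd hk'.
set D := b - a + (d - c) in hk' *.
have est s' t' : a <= s' <= b -> c <= t' <= d ->
   nr (f (s' +i* t') - f (s +i* t) - (((s' - s) +i* (t' - t)) : R[i]) *: be : C) <= e * D.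
  move=> /andP[h1 h2] /andP[h3 h4].
  have small : nr (((s' - s) +i* (t' - t)) : C) <= D.
    apply: le_trans (nr_ReIm _) _ => /=; rewrite /D; apply: lerD; rewrite ler_norml; apply/andP; split; lra.
  have := hk ((s' - s) +i* (t' - t)) (le_lt_trans small hk').
  have -> : (s +i* t) + ((s' - s) +i* (t' - t)) = (s' +i* t') :> C.
    by apply/eqP; rewrite eq_complex /= !(addrC _ (_ - _)) !subrK !eqxx.
  move=> /le_trans; apply; by rewrite ler_pM2l.
have [p [q ebe]] : exists p q, be = (p +i* q) by exists (complex.Re be), (complex.Im be); case: (be).
have hU t' : c <= t' <= d -> `|U b t' - U a t' - p * (b - a)| <= 2 * e * D.
  move=> ht'; have e1 := est b t' ltac:(apply/andP; split; lra) ht'.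
  have e2 := est a t' ltac:(apply/andP; split; lra) ht'.
  have r1 := le_trans (nr_Re _) e1; have r2 := le_trans (nr_Re _) e2.
  rewrite !ReB ebe /= -/(U b t') -/(U s t) -/(U a t') in r1 r2.
  move: r1 r2; rewrite !ler_norml => /andP[? ?] /andP[? ?]; apply/andP; split; lra.
have hV s' : a <= s' <= b -> `|V s' d - V s' c - p * (d - c)| <= 2 * e * D.
  move=> hs'; have e1 := est s' d hs' ltac:(apply/andP; split; lra).
  have e2 := est s' c hs' ltac:(apply/andP; split; lra).
  have r1 := le_trans (nr_Im _) e1; have r2 := le_trans (nr_Im _) e2.
  rewrite !ImB ebe /= -/(V s' d) -/(V s t) -/(V s' c) in r1 r2.
  move: r1 r2; rewrite !ler_norml => /andP[? ?] /andP[? ?]; apply/andP; split; lra.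
have iUb : integ c d (U b) by apply: iU => //; apply/andP; split; lra.
have iUa : integ c d (U a) by apply: iU => //; apply/andP; split; lra.
have iVd : integ a b (V^~ d) by apply: iV => //; apply/andP; split; lra.
have iVc : integ a b (V^~ c) by apply: iV => //; apply/andP; split; lra.
have ab : a <= b by lra.
have cd : c <= d by lra.
have IU := rint_abs_le cd (integB (integB iUb iUa) (integ_cst c d (p * (b - a)))) hU.
have IV := rint_abs_le ab (integB (integB iVd iVc) (integ_cst a b (p * (d - c)))) hV.
rewrite !rintB ?rint_cst// in IU; last 2 first.
- exact: integB.
- exact: integ_cst.
rewrite !rintB ?rint_cst// in IV; last 2 first.
- exact: integB.
- exact: integ_cst.
move: IU IV; rewrite !ler_norml => /andP[u1 u2] /andP[v1 v2].
have eq : 2 * e * D ^+ 2 = 2 * e * D * (d - c) + 2 * e * D * (b - a) by rewrite /D; ring.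
rewrite eq /J; apply/andP; split; lra.
Qed.

(** Some quarter of a rectangle carries at least a quarter of |J|. After n steps around the limit
    point, [J_local] gives |J| <= 4^n * 2 e ((w + h) / 2^n)^2 = 2 e (w + h)^2 for every e > 0. *)
Lemma goursat_rect : a0 <= b0 -> c0 <= d0 -> J a0 b0 c0 d0 = 0.
Proof.
move=> ab cd; set w := b0 - a0; set h := d0 - c0.
have w0 : 0 <= w by rewrite subr_ge0.
have h0 : 0 <= h by rewrite subr_ge0.
pose JJ n (p : R * R) := J p.1 (p.1 + w / 2 ^+ n) p.2 (p.2 + h / 2 ^+ n).
pose inside n (p : R * R) := [/\ a0 <= p.1, p.1 + w / 2 ^+ n <= b0, c0 <= p.2 & p.2 + h / 2 ^+ n <= d0].
pose next n (p q : R * R) := [/\ `|JJ n p| <= 4 * `|JJ n.+1 q|, p.1 <= q.1, p.2 <= q.2,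
   q.1 + w / 2 ^+ n.+1 <= p.1 + w / 2 ^+ n & q.2 + h / 2 ^+ n.+1 <= p.2 + h / 2 ^+ n].
have step n p : inside n p -> exists q, next n p q.
  case: p => a c [/= h1 h2 h3 h4].
  have wn : w / 2 ^+ n = w / 2 ^+ n.+1 + w / 2 ^+ n.+1.
    by rewrite exprS; field; rewrite expf_neq0.
  have hn : h / 2 ^+ n = h / 2 ^+ n.+1 + h / 2 ^+ n.+1.
    by rewrite exprS; field; rewrite expf_neq0.
  have w1 : 0 <= w / 2 ^+ n.+1 by rewrite divr_ge0// exprn_ge0.
  have h1' : 0 <= h / 2 ^+ n.+1 by rewrite divr_ge0// exprn_ge0.
  rewrite /next /JJ /= wn hn in h2 h4 *.
  move: w1 h1' h2 h4; set W := w / _; set H := h / _ => w1 h1' h2 h4.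
  rewrite (@J_splits a (a + W))//; try lra.
  rewrite !(@J_splitt _ _ c (c + H) (c + (H + H)))//; try lra.
  have t4 : `|J a (a + W) c (c + H) + J a (a + W) (c + H) (c + (H + H)) +
     (J (a + W) (a + (W + W)) c (c + H) + J (a + W) (a + (W + W)) (c + H) (c + (H + H)))| <=
      `|J a (a + W) c (c + H)| + `|J a (a + W) (c + H) (c + (H + H))| +
     (`|J (a + W) (a + (W + W)) c (c + H)| + `|J (a + W) (a + (W + W)) (c + H) (c + (H + H))|).
    by apply: le_trans (ler_normD _ _) _; apply: lerD; exact: ler_normD.
  rewrite !addrA in t4 *.
  set T := `|_| in t4 *.
  have [b1|] := leP T (4 * `|J a (a + W) c (c + H)|); first by exists (a, c); split => //=; lra.
  have [b2|] := leP T (4 * `|J a (a + W) (c + H) (c + H + H)|); first by exists (a, c + H); split => //=; lra.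
  have [b3|] := leP T (4 * `|J (a + W) (a + W + W) c (c + H)|); first by exists (a + W, c); split => //=; lra.
  have [b4|] := leP T (4 * `|J (a + W) (a + W + W) (c + H) (c + H + H)|); first by exists (a + W, c + H); split => //=; lra.
  lra.
(* The default [(a0, c0)] of [xget] is never taken: [step] supplies a quarter as long as the
   rectangle is inside, and [next] keeps it inside. *)
pose s := fix s n := match n with 0%N => (a0, c0) | S m => xget (a0, c0) (next m (s m)) end.
have ins : forall n, inside n (s n).
  elim=> [|n IH]; first by rewrite /inside /= !expr0 /w /h; split; lra.
  have [q hq] := step n _ IH.
  have : next n (s n) (s n.+1) by exact: xgetPex (ex_intro _ q hq).
  move: IH; rewrite /inside /next; move: (s n) (s n.+1) => [? ?] [? ?] /= [? ? ? ?] [_ ? ? ? ?]; split; lra.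
have nx n : next n (s n) (s n.+1).
  by have [q hq] := step n _ (ins n); exact: xgetPex (ex_intro _ q hq).
have [x hx] := @nested_dyadic (fun n => (s n).1) w w0 ltac:(by move=> n; case: (nx n)) ltac:(by move=> n; case: (nx n)).
have [y hy] := @nested_dyadic (fun n => (s n).2) h h0 ltac:(by move=> n; case: (nx n)) ltac:(by move=> n; case: (nx n)).
have JJn n : `|J a0 b0 c0 d0| <= 4 ^+ n * `|JJ n (s n)|.
  elim: n => [|n IH].
    have -> : JJ 0%N (s 0%N) = J a0 b0 c0 d0.
      by rewrite /JJ /= expr0 !divr1 /w /h ![_ + (_ - _)]addrC !subrK.
    by rewrite expr0 mul1r.
  apply: le_trans IH _; rewrite exprSr -mulrA ler_wpM2l ?exprn_ge0//.
  by case: (nx n).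
have small e : 0 < e -> `|J a0 b0 c0 d0| <= 2 * e * (w + h) ^+ 2.
  move=> e0.
  have hx0 := hx 0%N; have hy0 := hy 0%N; rewrite /= expr0 !divr1 /w /h in hx0 hy0.
  have [|| k k0 hk] := J_local (s := x) (t := y) _ _ e0.
  - by move: hx0 => /andP[? ?]; apply/andP; split; lra.
  - by move: hy0 => /andP[? ?]; apply/andP; split; lra.
  have [n hn] : exists n : nat, (w + h) / 2 ^+ n < k.
    have K0 : 0 < w + h + 1 by lra.
    have /cvgrPdist_lt/(_ _ (divr_gt0 k0 K0)) : (GRing.exp (2^-1 : R) : R^nat) n @[n --> \oo] --> (0 : R).
      by apply: cvg_expr; rewrite ger0_norm; lra.
    move=> [n _ /(_ n (leqnn n))]; rewrite /= sub0r normrN exprVn ger0_norm ?invr_ge0 ?exprn_ge0// ltr_pdivlMr// => hn.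
    exists n; apply: le_lt_trans hn.
    by rewrite mulrC ler_wpM2l ?invr_ge0 ?exprn_ge0//; lra.
  have [i1 i2 i3 i4] := ins n.
  have := hk (s n).1 ((s n).1 + w / 2 ^+ n) (s n).2 ((s n).2 + h / 2 ^+ n) i1 (hx n) i2 i3 (hy n) i4.
  have -> : (s n).1 + w / 2 ^+ n - (s n).1 + ((s n).2 + h / 2 ^+ n - (s n).2) = (w + h) / 2 ^+ n by lra.
  move=> /(_ hn) est; apply: le_trans (JJn n) _.
  apply: (@le_trans _ _ (4 ^+ n * (2 * e * ((w + h) / 2 ^+ n) ^+ 2))).
    by rewrite ler_wpM2l// exprn_ge0.
  have -> : 4 ^+ n = (2 ^+ n) ^+ 2 :> R by rewrite -exprM mulnC exprM; congr (_ ^+ _); lra.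
  have n0 : 2 ^+ n != 0 :> R by rewrite expf_neq0.
  by move: (2 ^+ n : R) n0 => m m0; rewrite le_eqVlt; apply/orP; left; apply/eqP; field.
apply/eqP; rewrite -normr_le0 leNgt; apply/negP => J0.
have K0 : 0 < 2 * (w + h) ^+ 2 + 1 by have := sqr_ge0 (w + h); lra.
have := small (`|J a0 b0 c0 d0| / (2 * (2 * (w + h) ^+ 2 + 1))).
rewrite divr_gt0 ?mulr_gt0// => /(_ isT).
set N := `|_| in J0 *.
have -> : 2 * (N / (2 * (2 * (w + h) ^+ 2 + 1))) * (w + h) ^+ 2 = N * ((w + h) ^+ 2 / (2 * (w + h) ^+ 2 + 1)).
  by field; apply/eqP; lra.
apply/negP; rewrite -ltNge gtr_pMr// ltr_pdivrMr// mul1r; have := sqr_ge0 (w + h); lra.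
Qed.

End Rect.
End Goursat.

(** * The complex exponential and circle means *)

Section MeanValue.
Context {R : realType}.
Local Notation C := (R[i]^o).

Lemma is_derive_eps (g : R -> R) (x l : R) : is_derive x (1 : R) g l ->
  forall e, 0 < e -> exists2 d, 0 < d & forall h, `|h| < d -> `|g (x + h) - g x - l * h| <= e * `|h|.
Proof.
move=> [/cvg_ex[l' hl]]; rewrite /derive (cvg_lim _ hl)// => ll; move: hl; rewrite {}ll => hl e e0.
move/cvgrPdist_lt : hl => /(_ e e0) /nbhs_ballP [d /= d0 hd]; exists d => // h hh.
have [->|h0] := eqVneq h 0; first by rewrite addr0 subrr mulr0 subrr normr0 mulr0.
have := hd h; rewrite /ball /= sub0r normrN => /(_ hh h0).
have nh : 0 < `|h| by rewrite normr_gt0.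
rewrite -(ltr_pM2r nh) -normrM => /ltW; rewrite distrC; apply: le_trans.
rewrite le_eqVlt; apply/orP; left; apply/eqP; congr `|_|.
by rewrite /GRing.scale /= mulr1 [h + x]addrC; field; rewrite h0.
Qed.

Definition cexp (w : C) : C := (expR (complex.Re w))%:C * E (complex.Im w).

Lemma cexpD (w z : C) : cexp (w + z) = cexp w * cexp z.
Proof.
case: w => a b; case: z => c d; rewrite /cexp /= expRD ED rmorphM /=.
by rewrite mulrACA.
Qed.

Lemma cdiff_cexp0 : cdiff cexp 0 (1 : C).
Proof.
move=> e e0.
have e8 : 0 < e / 8 by lra.
have [d1 d10 h1] := is_derive_eps (is_derive_expR 0) e8.
have [d2 d20 h2] := is_derive_eps (is_derive_cos 0) e8.
have [d3 d30 h3] := is_derive_eps (is_derive_sin 0) e8.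
exists (Order.min (Order.min d1 (e / 8)) (Order.min d2 d3)); first by rewrite !lt_min d10 e8 d20.
move=> [s t]; rewrite !lt_min => /andP[/andP[w1 we] /andP[w2 w3]].
set w : C := s +i* t in w1 we w2 w3 *.
have ns : `|s| <= nr w := nr_Re w; have nt : `|t| <= nr w := nr_Im w.
have := h1 s (le_lt_trans ns w1); have := h2 t (le_lt_trans nt w2); have := h3 t (le_lt_trans nt w3).
rewrite !add0r expR0 cos0 sin0 mul1r oppr0 mul0r !subr0 mul1r addr0 => H3 H2 H1.
rewrite [X in nr X](_ : _ = 
    ((expR s - 1 - s)%:C * E t : C) + (s%:C * (E t - 1) : C) + ((cos t - 1) +i* (sin t - t)) :> C); last first.
  rewrite /cexp /= expR0 E0 /GRing.scale /= !mulr1 /w.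
  apply/eqP; rewrite eq_complex /=; apply/andP; split; apply/eqP; ring.
apply: le_trans (nrD _ _) _; apply: le_trans (lerD (nrD _ _) (lexx _)) _.
rewrite !nrM !nr_real nr_E mulr1.
have b1 : `|s| * nr (E t - 1 : C) <= `|s| * (2 * (e / 8)).
  rewrite ler_wpM2l//; have := E_lip t 0; rewrite E0 subr0; lra.
have b2 := nr_ReIm (((cos t - 1) +i* (sin t - t)) : C); rewrite /= in b2.
have b3 : e / 8 * `|s| <= e / 8 * nr w by rewrite ler_pM2l.
have b4 : e / 8 * `|t| <= e / 8 * nr w by rewrite ler_pM2l.
have b5 : 0 <= e * nr w by rewrite mulr_ge0 ?nr_ge0 ?ltW.
lra.
Qed.

Lemma cdiff_cexp (w : C) : cdiff cexp w (cexp w).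
Proof.
move=> e e0; have n0 := nr_ge0 (cexp w).
have e1 : 0 < e / (nr (cexp w) + 1) by rewrite divr_gt0//; lra.
have [d d0 hd] := cdiff_cexp0 e1.
exists d => // x /hd h.
have c0 : cexp 0 = 1 by rewrite /cexp /= expR0 E0 mulr1.
rewrite [X in nr X](_ : _ = (cexp w * (cexp (0 + x) - cexp 0 - (x : R[i]) *: (1 : C)) : C)); last first.
  by rewrite c0 add0r cexpD /GRing.scale /= mulr1 !mulrBr mulr1 [x * _]mulrC.
rewrite nrM; apply: (@le_trans _ _ ((nr (cexp w) + 1) * (e / (nr (cexp w) + 1) * nr x))).
  by rewrite ler_pM ?nr_ge0//; lra.
by rewrite mulrA mulrCA mulfV ?mulr1// gt_eqF//; lra.
Qed.

Lemma cdiff_circle_cont (k : C -> C) (z0 : C) (rho r : R) :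
  (forall z, nr (z - z0) < rho -> exists b, cdiff k z b) -> 0 < r < rho ->
  continuous (fun t => complex.Re (k (z0 + r%:C * E t))).
Proof.
move=> hk /andP[r0 rrho]; apply: continuous_eps => t e' e'0.
have [|b' hb'] := hk (z0 + r%:C * E t).
  by rewrite addrC addKr nrM nr_real nr_E mulr1 gtr0_norm.
have [d' d'0 hd'] := cdiff_cont hb' e'0.
exists (d' / (2 * r)); first by rewrite divr_gt0// mulr_gt0.
move=> s hs; rewrite -ReB; apply: le_lt_trans (nr_Re _) _; apply: hd'.
have -> : (z0 + r%:C * E s) - (z0 + r%:C * E t) = (r%:C * (E s - E t) : C).
  by rewrite mulrBr opprD addrACA subrr add0r.
rewrite nrM nr_real gtr0_norm//.
have l1 := E_lip s t.
have : r * nr (E s - E t) <= r * (2 * `|s - t|) by rewrite ler_pM2l.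
move: hs; rewrite ltr_pdivlMr ?mulr_gt0//; lra.
Qed.

Lemma cdiff_circle_integ (k : C -> C) (z0 : C) (rho r : R) :
  (forall z, nr (z - z0) < rho -> exists b, cdiff k z b) -> 0 < r < rho ->
  integ 0 (2 * pi) (fun t => complex.Re (k (z0 + r%:C * E t))).
Proof.
by move=> hk hr; apply: integ_cont; apply: continuous_subspaceT => t; exact: cdiff_circle_cont hk hr t.
Qed.

(* The exponential maps [ln x, ln r] x [0, 2 pi] onto an annulus around z0, so
   Goursat's lemma makes the circle means independent of the radius. *)
Lemma mean_value (k : C -> C) (z0 : C) (rho r : R) :
  (forall z, nr (z - z0) < rho -> exists b, cdiff k z b) -> 0 < r < rho ->
  rint 0 (2 * pi) (fun t => complex.Re (k (z0 + r%:C * E t))) = 2 * pi * complex.Re (k z0).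
Proof.
move=> hk /andP[r0 rrho].
have p0 := pi_gt0 R.
have p2 : 0 <= 2 * pi :> R by lra.
have zr x t : 0 < x -> nr (z0 + x%:C * E t - z0) = x.
  by move=> x0; rewrite addrC addKr nrM nr_real nr_E mulr1 gtr0_norm.
have M x : 0 < x -> x < r -> rint 0 (2 * pi) (fun t => complex.Re (k (z0 + r%:C * E t))) =
   rint 0 (2 * pi) (fun t => complex.Re (k (z0 + x%:C * E t))).
  move=> x0 xr.
  pose f : C -> C := fun w => k (z0 + cexp w).
  have cE s t : cexp (s +i* t) = ((expR s)%:C * E t : C) by [].
  have hf s t : ln x <= s <= ln r -> 0 <= t <= 2 * pi -> exists b, cdiff f (s +i* t) b.
    move=> /andP[_ sr] _.
    have [|b hb] := hk (z0 + cexp (s +i* t)).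
      rewrite cE zr ?expR_gt0//; apply: le_lt_trans rrho.
      by rewrite -[r]lnK ?posrE// ler_expR.
    eexists; apply: (cdiff_comp (k := fun w => z0 + cexp w) hb).
    apply: cdiffD; [exact: cdiff_cst|exact: cdiff_cexp].
  have xr' : ln x <= ln r by rewrite ler_ln ?posrE// ltW.
  have key (A B X Y : R) : A - B - (X - Y) = 0 -> X = Y -> A = B by move=> h1 h2; lra.
  (* The two horizontal sides are mapped onto the same radius, as [E] takes the same value at 0 and
     2 pi; only the vertical sides, that is the two circles, remain. *)
  have eqV : rint (ln x) (ln r) (fun s => complex.Im (f (s +i* (2 * pi)))) =
     rint (ln x) (ln r) (fun s => complex.Im (f (s +i* 0))).
    by apply: eq_rint => s _; rewrite /f !cE E2pi E0.
  have := key _ _ _ _ (goursat_rect hf xr' p2) eqV.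
  rewrite (@eq_rint _ _ _ _ (fun t => complex.Re (k (z0 + r%:C * E t)))); last first.
    by move=> t _; rewrite /f cE lnK.
  move=> ->; apply: eq_rint => t _; by rewrite /f cE lnK.
have [b hb] := hk z0 ltac:(rewrite subrr nr0; lra).
(* The integral over the circle of radius [r] equals that over an arbitrarily small one, on which
   [k] is close to [k z0]. *)
have small e : 0 < e -> `|rint 0 (2 * pi) (fun t => complex.Re (k (z0 + r%:C * E t))) - 2 * pi * complex.Re (k z0)| <= e * (2 * pi).
  move=> e0; have [d d0 hd] := cdiff_cont hb e0.
  pose x := Order.min (d / 2) (r / 2).
  have x0 : 0 < x by rewrite lt_min; apply/andP; split; lra.
  have xd : x < d by rewrite gt_min; apply/orP; left; lra.
  have xr : x < r by rewrite gt_min; apply/orP; right; lra.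
  rewrite (M x)//.
  have ix : integ 0 (2 * pi) (fun t => complex.Re (k (z0 + x%:C * E t))).
    by apply: (cdiff_circle_integ (rho := rho)) => //; apply/andP; split => //; exact: lt_trans rrho.
  have -> : rint 0 (2 * pi) (fun t => complex.Re (k (z0 + x%:C * E t))) - 2 * pi * complex.Re (k z0) =
     rint 0 (2 * pi) (fun t => complex.Re (k (z0 + x%:C * E t)) - complex.Re (k z0)).
    rewrite rintB//; last exact: integ_cst.
    by rewrite rint_cst// subr0 [_ * (2 * pi)]mulrC.
  rewrite -[X in e * X]subr0; apply: rint_abs_le => //; first by apply: integB => //; exact: integ_cst.
  move=> t _; rewrite -ReB; apply: le_trans (nr_Re _) _; apply: ltW; apply: hd.
  by rewrite zr.
apply/eqP; rewrite -subr_eq0 -normr_le0 leNgt; apply/negP => J0.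
set N := `|_| in J0 small.
have := small (N / (4 * pi)) (divr_gt0 J0 (mulr_gt0 (ltr0Sn R 3) p0)).
have -> : N / (4 * pi) * (2 * pi) = N / 2 by field; apply/eqP; lra.
lra.
Qed.

End MeanValue.

(** * Sub-mean value property along closed discs *)

Section Coord.
Context {R : realType} {n : nat}.
Local Notation C := (R[i]^o).

Lemma nr_ltP (y : 'rV[C]_n) (e : R) : 0 < e -> (nr y < e) <-> (forall i, nr (y 0 i) < e).
Proof.
move=> e0.
have h : ball (0 : 'rV[C]_n) e%:C y <-> nr y < e.
  by rewrite -ball_normE /ball_ /= sub0r normrN nrE ltcR.
rewrite -h; split.
  move=> [_ hb] i; have := hb 0 i; rewrite mxE -ball_normE /ball_ /= sub0r normrN nrE ltcR.
  exact.
move=> hy; split; first by rewrite ltcR.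
move=> i j; rewrite mxE -ball_normE /ball_ /= sub0r normrN nrE ltcR.
rewrite (ord1 i); exact: hy.
Qed.

Lemma nr_coord (y : 'rV[C]_n) i : nr (y 0 i) <= nr y.
Proof.
apply/ler_addgt0Pr => e e0; apply: ltW.
have : nr y < nr y + e by rewrite ltrDl.
by move/nr_ltP; apply; rewrite ltr_wpDl// nr_ge0.
Qed.

Lemma nr_le_coord (y : 'rV[C]_n) (e : R) : 0 <= e -> (forall i, nr (y 0 i) <= e) -> nr y <= e.
Proof.
move=> e0 h; apply/ler_addgt0Pr => d d0; apply: ltW; apply/nr_ltP; first by rewrite ltr_wpDl.
by move=> i; rewrite ltr_pwDr.
Qed.

Lemma cdiff_coord (f : C -> 'rV[C]_n) z b i : cdiff f z b -> cdiff (fun x => f x 0 i) z (b 0 i).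
Proof.
move=> hf e e0; have [d d0 hd] := hf e e0; exists d => // w /hd.
apply: le_trans; apply: le_trans (nr_coord _ i).
by rewrite !mxE.
Qed.

Lemma compact_polydisc : compact [set v : 'rV[C]_n | forall i, closed_disc (v 0 i)].
Proof. exact: (@rV_compact C n (fun=> closed_disc) (fun=> compact_closed_disc)). Qed.

Lemma ereal_between (a b : \bar R) : (a < b)%E -> exists c : R, (a < c%:E)%E /\ (c%:E < b)%E.
Proof.
case: a => [a| |]; case: b => [b| |] h.
- by move: h; rewrite lte_fin => h; exists ((a + b) / 2); rewrite !lte_fin; split; lra.
- by exists (a + 1); rewrite lte_fin ltry; split => //; lra.
- by move: h; rewrite ltNge leNye.
- by move: h; rewrite ltNge leey.
- by move: h; rewrite ltNge leey.
- by move: h; rewrite ltNge leey.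
- by exists (b - 1); rewrite lte_fin ltNyr; split => //; lra.
- by exists 0; rewrite ltry ltNyr.
- by move: h; rewrite ltxx.
Qed.

Lemma usc_max (T : topologicalType) (K : set T) (F : T -> \bar R) : compact K -> K !=set0 ->
  (forall x, K x -> (F x < +oo)%E) ->
  (forall x a, K x -> (F x < a%:E)%E -> \forall y \near x, K y -> (F y < a%:E)%E) ->
  exists2 x0, K x0 & forall x, K x -> (F x <= F x0)%E.
Proof.
move=> cK [k Kk] Foo uF; apply: contrapT => hn.
pose M := ereal_sup [set F x | x in K].
have ltM x : K x -> (F x < M)%E.
  move=> Kx; rewrite lt_neqAle ereal_sup_ubound ?andbT; last by exists x.
  apply/eqP => FM; apply: hn; exists x => // y Ky; rewrite FM; apply: ereal_sup_ubound; by exists y.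
(* Real levels that increase to [M] as [e] decreases to 0, for [M] finite or [+oo]; [M = -oo] is
   excluded by [ltM]. A uniform level below [M] contradicts the definition of the supremum. *)
pose Me (e : R) : \bar R := if M is r%:E then (r - e)%:E else (e^-1)%:E.
have [d e x d0 de|x Kx|e e0 he] := @compact_unif R T K (fun e x => (F x <= Me e)%E) cK.
- move=> /le_trans; apply; rewrite /Me; case: (M) => [r| |]; rewrite lee_fin.
  + by rewrite lerD2l lerN2.
  + by rewrite lef_pV2// posrE//; exact: lt_le_trans de.
  + by rewrite lef_pV2// posrE//; exact: lt_le_trans de.
- have [c [Fc cM]] := ereal_between (ltM x Kx).
  have [e e0 ce] : exists2 e : R, 0 < e & (c%:E <= Me e)%E.
    move: cM; rewrite /Me; case: (M) => [r| |].
    + by rewrite lte_fin => h; exists (r - c); rewrite ?subr_gt0// lee_fin; lra.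
    + move=> _; exists (`|c| + 1)^-1; first by rewrite invr_gt0 ltr_wpDl.
      by rewrite invrK lee_fin; have := ler_norm c; lra.
    + by rewrite ltNge leNye.
  exists e => //; apply: filterS (uF x c Kx Fc) => y hy Ky.
  by apply: le_trans (ltW (hy Ky)) ce.
have MMe : (M <= Me e)%E by apply: ge_ereal_sup => _ [x Kx <-]; exact: he.
have := ltM k Kk; move: MMe; rewrite /Me; case: (M) => [r| |].
- by rewrite lee_fin => h _; lra.
- by rewrite leNgt ltry.
- by move=> _; rewrite ltNge leNye.
Qed.

Lemma cont_onS (A B : set C) (f : C -> 'rV[C]_n) : A `<=` B -> cont_on B f -> cont_on A f.
Proof.
move=> AB cf x /AB Bx e e0; have [d d0 hd] := cf x Bx e e0; exists d => // y /AB; exact: hd.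
Qed.

Lemma usc_onP {V : normedModType R[i]} (U : set V) (v : V -> \bar R) :
  (forall x, U x -> (v x < +oo)%E) ->
  (forall x a, U x -> (v x < a%:E)%E ->
  exists2 d : R, 0 < d & forall y, U y -> nr (y - x) < d -> (v y < a%:E)%E) -> usc_on U v.
Proof.
move=> h1 h2 x Ux; split; first exact: h1.
by move=> a va; have [d d0 hd] := h2 x a Ux va; apply/nbhs_nrP; exists d => // y yx Uy; exact: hd.
Qed.

Lemma usc_comp {V V' : normedModType R[i]} (U : set V) (U' : set V') (g : V' -> V) (v : V -> \bar R) : 
  usc_on U v -> cont_on U' g -> (forall x, U' x -> U (g x)) -> usc_on U' (v \o g).
Proof.
move=> uv cg gU; apply: usc_onP => [x /gU /uv[]//|x a U'x vx].
have [d d0 hd] := usc_nr uv (gU _ U'x) vx.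
have [d' d'0 hd'] := cg x U'x d d0.
exists d' => // y U'y yx; apply: hd; [exact: gU|exact: hd'].
Qed.

(** Turns a condition that is open along the graph of [f] into one with a uniform margin; membership
    in an open set and strict majorants of [phi] are the instances. *)
Lemma tube {V : normedModType R[i]} (K : set C) (f : C -> V) (Q : C -> V -> Prop) : compact K ->
  cont_on K f ->
  (forall x, K x -> exists2 e : R, 0 < e & forall x', K x' -> nr (x' - x) < e -> forall y, nr (y - f x) < e -> Q x' y) ->
  exists2 r : R, 0 < r & forall x y, K x -> nr (y - f x) < r -> Q x y.
Proof.
move=> cK cf h.
have [d e x d0 de|x Kx|e e0 he] := @compact_unif R C K (fun e x => forall y, nr (y - f x) < e -> Q x y) cK.
- by move=> H y yx; apply: H; exact: lt_le_trans de.
- have [e e0 he] := h x Kx.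
  have e2 : 0 < e / 2 by lra.
  have [d d0 hd] := cf x Kx (e / 2) e2.
  exists (e / 2) => //; apply/nbhs_nrP; exists (Order.min d e); first by rewrite lt_min d0.
  move=> x'; rewrite lt_min => /andP[x1 x2] Kx' y hy; apply: (he x') => //.
  have -> : y - f x = (y - f x') + (f x' - f x) by rewrite addrA subrK.
  by apply: le_lt_trans (nrD _ _) _; have := hd x' Kx' x1; lra.
by exists e => // x y Kx; exact: he.
Qed.

Lemma tube_open {V : normedModType R[i]} (K : set C) (f : C -> V) (X : set V) : compact K ->
  cont_on K f -> open X -> (forall x, K x -> X (f x)) ->
  exists2 r : R, 0 < r & forall x y, K x -> nr (y - f x) < r -> X y.
Proof.
move=> cK cf /open_nrP oX fX; apply: tube => // x Kx.
have [e e0 he] := oX _ (fX x Kx); exists e => // x' Kx' _ y; exact: he.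
Qed.

Lemma tube_usc {V : normedModType R[i]} (f : C -> V) (W : set V) (phi : V -> \bar R) (P : {poly R[i]}) :
  cont_on unit_circle f -> open W -> (forall x, unit_circle x -> W (f x)) -> usc_on W phi ->
  (forall z, unit_circle z -> (phi (f z) < (pc P z)%:E)%E) ->
  exists2 r : R, 0 < r & forall z y, unit_circle z -> nr (y - f z) < r -> W y /\ (phi y < (pc P z)%:E)%E.
Proof.
move=> cf oW fW uphi hphi; apply: tube => //; first exact: compact_unit_circle.
move=> x Tx; have [c [c1 c2]] := ereal_between (hphi x Tx).
have [d1 d10 h1] := usc_nr uphi (fW x Tx) c1.
move/open_nrP : oW => /(_ _ (fW x Tx))[d2 d20 h2].
rewrite lte_fin in c2.
have c3 : 0 < pc P x - c by rewrite subr_gt0.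
have [d3 d30 h3] := pc_cont P x c3.
exists (Order.min d1 (Order.min d2 d3)); first by rewrite !lt_min d10 d20.
move=> x' Tx'; rewrite !lt_min => /and3P[_ _ /h3 hx'] y; rewrite !lt_min => /and3P[y1 y2 _].
have Wy : W y by exact: h2.
split => //; apply: lt_le_trans (h1 y Wy y1) _.
by rewrite lee_fin; move: hx'; rewrite ltr_norml => /andP[]; lra.
Qed.

End Coord.

(** * Maxima of the penalised function *)

Section PenalisedMaximum.
Context {R : realType} {n : nat}.
Local Notation C := (R[i]^o).

Definition cj (z : C) : C := complex.Re z +i* (- complex.Im z).

Lemma nr_sqrD (a b : C) : nr (a + b) ^+ 2 = nr a ^+ 2 + 2 * complex.Re (cj a * b : C) + nr b ^+ 2.
Proof. rewrite !nr_sqr; case: a => a1 a2; case: b => b1 b2 /=; ring. Qed.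

Lemma nr_sqr_lip (a b : C) : nr a <= 1 -> nr b <= 1 -> `|nr a ^+ 2 - nr b ^+ 2| <= 2 * nr (a - b).
Proof.
move=> a1 b1; have a0 := nr_ge0 a; have b0 := nr_ge0 b.
have -> : nr a ^+ 2 - nr b ^+ 2 = (nr a - nr b) * (nr a + nr b) by ring.
rewrite normrM (ger0_norm (addr_ge0 a0 b0)) mulrC; apply: ler_pM => //; [by rewrite addr_ge0|lra|].
have h1 := nrD (a - b) b; have h2 := nrD (b - a) a; rewrite !subrK [nr (b - a)]nrBC in h1 h2.
rewrite ler_norml; apply/andP; split; lra.
Qed.

(** The squared Euclidean norm: unlike the maximum [nr], it has an increment whose first-order part
    is the real part of a complex linear form, and this part is harmonic after substitution of a
    holomorphic map. *)
Definition N2 (v : 'rV[C]_n) : R := \sum_i nr (v 0 i) ^+ 2.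
Definition polydisc : set 'rV[C]_n := [set v | forall i, closed_disc (v 0 i)].

Lemma N2_lip (v w : 'rV[C]_n) : polydisc v -> polydisc w -> `|N2 v - N2 w| <= n%:R * (2 * nr (v - w)).
Proof.
move=> hv hw; rewrite /N2 -sumrB; apply: le_trans (ler_norm_sum _ _ _) _.
apply: (@le_trans _ _ (\sum_(i < n) (2 * nr (v - w)))).
  apply: ler_sum => i _; apply: le_trans (nr_sqr_lip _ _) _.
  - exact/closed_discP/hv.
  - exact/closed_discP/hw.
  - by rewrite ler_pM2l//; have := nr_coord (v - w) i; rewrite !mxE.
by rewrite sumr_const card_ord -[X in X <= _]mulr_natl.
Qed.

Lemma nr_polydisc (v : 'rV[C]_n) : polydisc v -> nr v <= 1.
Proof. by move=> h; apply: nr_le_coord => // i; exact/closed_discP/h. Qed.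

Section Maximum.
Variables (X : set 'rV[C]_n) (u : 'rV[C]_n -> \bar R) (f : C -> 'rV[C]_n) (P : {poly R[i]}) (rho eta : R).
Hypothesis uu : usc_on X u.
Hypothesis cf : cont_on closed_disc f.
Hypothesis rho0 : 0 < rho.
Hypothesis eta0 : 0 < eta.
Let G (p : C * 'rV[C]_n) := f p.1 + (rho%:C : R[i]) *: p.2.
Let K : set (C * 'rV[C]_n) := closed_disc `*` polydisc.
Hypothesis GX : forall p, K p -> X (G p).
Let s (A : R) (p : C * 'rV[C]_n) := - pc P p.1 + eta * nr p.1 ^+ 2 - A * N2 p.2.

Lemma near_prod (p : C * 'rV[C]_n) d : 0 < d -> \forall q \near p, nr (q.1 - p.1) < d /\ nr (q.2 - p.2) < d.
Proof.
move=> d0; exists ([set z | nr (z - p.1) < d], [set z | nr (z - p.2) < d]) => //=.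
by split; apply/nbhs_nrP; exists d.
Qed.

Lemma penalty_max A : 0 <= A -> exists2 p, K p & forall q, K q -> (u (G q) + (s A q)%:E <= u (G p) + (s A p)%:E)%E.
Proof.
move=> A0; apply: (@usc_max R _ K (fun p => (u (G p) + (s A p)%:E)%E)).
- by apply: compact_setX; [exact: compact_closed_disc|exact: compact_polydisc].
- by exists (0, 0); split => [|i] /=; apply/closed_discP; rewrite ?mxE nr0.
- by move=> p Kp; rewrite lte_add_pinfty ?ltry//; case: (uu (GX Kp)).
move=> p a Kp ha.
have [c [c1 c2]] : exists c, (u (G p) < c%:E)%E /\ c + s A p < a.
  have : (u (G p) < (a - s A p)%:E)%E by rewrite EFinB lteBrDr.
  by move=> /ereal_between[c [h1 h2]]; exists c; split => //; move: h2; rewrite lte_fin; lra.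
have [d d0 hd] := usc_nr uu (GX Kp) c1.
have d02 : 0 < d / 2 by lra.
have [d1 d10 hd1] := cf Kp.1 d02.
pose e := a - c - s A p; have e0 : 0 < e by rewrite /e; lra.
have e04 : 0 < e / 4 by lra.
have [d2 d20 hd2] := pc_cont P p.1 e04.
(* By [nr_sqr_lip] and [N2_lip], [L - 1] is a Lipschitz constant of eta |z|^2 - A N2(v); the 1 makes
   [L] positive. *)
pose L := 2 * eta + A * (n%:R * 2) + 1.
have L0 : 0 < L by rewrite /L ltr_wpDl// addr_ge0 ?mulr_ge0// ltW.
pose d3 := Order.min (d / (2 * rho)) (e / (4 * L)).
have d30 : 0 < d3 by rewrite lt_min !divr_gt0// mulr_gt0.
have [d3a d3b] : d3 <= d / (2 * rho) /\ d3 <= e / (4 * L) by split; rewrite ge_min lexx ?orbT.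
clearbody d3.
have dm : 0 < Order.min d1 (Order.min d2 d3) by rewrite !lt_min d10 d20.
apply: filterS (near_prod p dm) => q; rewrite !lt_min => -[/and3P[q1 q2 q4'] /and3P[_ _ q5']] Kq.
have q4 := lt_le_trans q4' d3b; have q5 := lt_le_trans q5' d3a; have q6 := lt_le_trans q5' d3b.
have uq : (u (G q) < c%:E)%E.
  apply: hd; first exact: GX.
  have -> : G q - G p = (f q.1 - f p.1) + (rho%:C : R[i]) *: (q.2 - p.2).
    by rewrite /G opprD addrACA scalerBr.
  apply: le_lt_trans (nrD _ _) _; rewrite nrZ nr_real gtr0_norm//.
  have := hd1 _ Kq.1 q1; move: q5; rewrite ltr_pdivlMr ?mulr_gt0//; lra.
have sq : s A q < s A p + e.
  have l1 := hd2 _ q2; rewrite ltr_norml in l1.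
  have l2 := nr_sqr_lip (proj1 (closed_discP _) Kq.1) (proj1 (closed_discP _) Kp.1).
  have l3 := N2_lip Kq.2 Kp.2.
  have x1 : eta * `|nr q.1 ^+ 2 - nr p.1 ^+ 2| <= eta * (2 * (e / (4 * L))).
    rewrite ler_pM2l//; apply: le_trans l2 _; rewrite ler_pM2l// ltW//.
  have x2 : A * `|N2 q.2 - N2 p.2| <= A * (n%:R * (2 * (e / (4 * L)))).
    rewrite ler_wpM2l//; apply: le_trans l3 _; rewrite ler_wpM2l// ler_pM2l// ltW//.
  have x3 : eta * (2 * (e / (4 * L))) + A * (n%:R * (2 * (e / (4 * L)))) <= e / 4.
    have -> : eta * (2 * (e / (4 * L))) + A * (n%:R * (2 * (e / (4 * L)))) = (L - 1) / L * (e / 4).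
      by rewrite /L; field; apply/eqP; rewrite -/L; lra.
    by rewrite ler_piMl ?ler_pdivrMr//; lra.
  have y1 : eta * (nr q.1 ^+ 2 - nr p.1 ^+ 2) <= eta * `|nr q.1 ^+ 2 - nr p.1 ^+ 2| by rewrite ler_pM2l// ler_norm.
  have y2 : A * (N2 p.2 - N2 q.2) <= A * `|N2 q.2 - N2 p.2| by rewrite ler_wpM2l// distrC ler_norm.
  by move: l1 => /andP[? ?]; rewrite /s; lra.
apply: (@lt_trans _ _ (c%:E + (s A q)%:E)%E); first by rewrite lteD2rE.
by rewrite -EFinD lte_fin; move: sq; rewrite /e; lra.
Qed.

End Maximum.

End PenalisedMaximum.

Section SubmeanDisc.
Context {R : realType} {n : nat}.
Local Notation C := (R[i]^o).

(* With b = f'(z) and x = f z + rho v, the curve t |-> (z + t, V t) is mapped onto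
   the line x + t b, and |V t - v| = o(t). At an interior maximum (z, v), u is thus
   bounded along this line by its value at x plus a harmonic function minus
   (eta - o(1)) |t|^2, against the sub-mean value property. *)
Lemma interior_max_false (X : set 'rV[C]_n) (u : 'rV[C]_n -> \bar R) (f : C -> 'rV[C]_n) (P : {poly R[i]})
   (rho eta A U : R) (z : C) (v : 'rV[C]_n) :
  plurisubharmonic X u -> (forall z, open_disc z -> exists b, cdiff f z b) ->
  0 < rho -> 0 < eta -> 0 <= A -> nr z < 1 -> nr v < 1 ->
  (forall q, closed_disc q.1 -> polydisc q.2 -> X (f q.1 + (rho%:C : R[i]) *: q.2)) ->
  u (f z + (rho%:C : R[i]) *: v) = U%:E ->
  (forall q, closed_disc q.1 -> polydisc q.2 ->
    (u (f q.1 + (rho%:C : R[i]) *: q.2)%R + (- pc P q.1 + eta * nr q.1 ^+ 2 - A * N2 q.2)%:E <=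
     U%:E + (- pc P z + eta * nr z ^+ 2 - A * N2 v)%:E)%E) -> False.
Proof.
move=> [uu su] df rho0 eta0 A0 z1 v1 GX uU maxp.
set x := f z + _ in uU.
have [b hb] := df z (proj2 (open_discP _) z1).
have nv1 : 0 < 1 - nr v by lra.
have nz1 : 0 < 1 - nr z by lra.
(* Since |w t| <= e |t|, [Kc * e ^+ 2 * nr t ^+ 2] bounds the quadratic part of the change of A N2
   from [v] to [V t]; [e] is then taken so small that eta |t|^2 outweighs it. *)
pose Kc := A * n%:R / rho ^+ 2.
have Kc0 : 0 <= Kc by apply: divr_ge0; [exact: mulr_ge0|exact: exprn_ge0 (ltW rho0)].
have [e [e0 e1 eKc]] : exists e, [/\ 0 < e, e < 1 & Kc * e ^+ 2 < eta].
  pose e := eta / (Kc + eta + 1); exists e.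
  have e0 : 0 < e by rewrite divr_gt0//; lra.
  have e1 : e < 1 by rewrite ltr_pdivrMr; lra.
  split => //.
  have h1 : e * (Kc + eta + 1) = eta by rewrite divfK//; apply/eqP; lra.
  have h2 : Kc * e ^+ 2 <= Kc * e by rewrite ler_wpM2l// expr2 ler_piMl// ltW.
  have h3 := mulr_gt0 e0 eta0; lra.
have [d d0 hd] := hb e e0.
(* For |t| <= r the expansion of [f] at [z] holds, z + t remains in the disc, and V t in the
   polydisc, because |w t| / rho <= r / rho <= 1 - |v|. *)
have [r [r0 rd rz rv]] : exists r, [/\ 0 < r, r < d, r < 1 - nr z & r <= rho * (1 - nr v)].
  have m0 : 0 < rho * (1 - nr v) by rewrite mulr_gt0.
  exists (Order.min (d / 2) (Order.min ((1 - nr z) / 2) (rho * (1 - nr v)))); split.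
  - rewrite !lt_min m0 andbT; apply/andP; split; lra.
  - rewrite gt_min; apply/orP; left; lra.
  - rewrite !gt_min; apply/orP; right; apply/orP; left; lra.
  - by rewrite !ge_min lexx !orbT.
pose w (t : C) := f (z + t) - f z - (t : R[i]) *: b.
have nw t : nr t <= r -> nr (w t) <= e * nr t by move=> tr; apply: hd; exact: le_lt_trans rd.
pose V (t : C) := v - ((rho^-1)%:C : R[i]) *: w t.
have GV t : f (z + t) + (rho%:C : R[i]) *: V t = x + (t : R[i]) *: b.
  rewrite /V scalerBr scalerA -rmorphM mulfV ?gt_eqF// scale1r /w /x opprB opprB.
  by rewrite !addrA [LHS](ACl ((1*5)*(4*2*3)))%AC /= subrr add0r.
have zt t : nr t <= r -> closed_disc (z + t).
  by move=> tr; apply/closed_discP; have := nrD z t; lra.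
have Vt t : nr t <= r -> polydisc (V t).
  move=> tr i; apply/closed_discP.
  apply: le_trans (nr_coord _ _) _; apply: le_trans (nrD _ _) _; rewrite nrN nrZ nr_real.
  rewrite gtr0_norm ?invr_gt0// mulrC.
  have h : nr (w t) / rho <= 1 - nr v.
    rewrite ler_pdivrMr// mulrC; apply: le_trans rv; apply: le_trans (nw t tr) _.
    by have h0 := nr_ge0 t; apply: le_trans tr; rewrite ler_piMl// ltW.
  lra.
(* [k] collects the increment of P and the linear parts of the increments of - eta |z|^2 and A N2.
   It is holomorphic and vanishes at 0, so its real part has mean 0 over the circle of radius
   [r]. *)
pose k (t : C) : C := (P.[z + t] - P.[z] : C) + ((- (2 * eta))%:C * (cj z * t) : C) +
  ((- (2 * A / rho))%:C * \sum_(i < n) (cj (v 0 i) * w t 0 i) : C).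
have ktE (t : C) : nr t <= r -> (u (x + (t : R[i]) *: b)%R <= (U + (complex.Re (k t) - eta * nr t ^+ 2 + Kc * e ^+ 2 * nr t ^+ 2))%:E)%E.
  move=> tr; have := maxp (z + t, V t) (zt t tr) (Vt t tr).
  rewrite /= GV -EFinD -leeBrDr; [rewrite -EFinN -EFinD |by []]; move=> /le_trans; apply; rewrite lee_fin.
  have Rek : complex.Re (k t) = pc P (z + t) - pc P z - 2 * eta * complex.Re (cj z * t : C)
       - 2 * A / rho * \sum_(i < n) complex.Re (cj (v 0 i) * w t 0 i : C).
    rewrite /k /pc -Re_sum.
    rewrite -[in RHS](ReM_real (2 * eta)) -(ReM_real (2 * A / rho)) -!ReB.
    by rewrite !rmorphN /= !mulNr.
  have N2V : N2 (V t) <= N2 v - 2 / rho * \sum_(i < n) complex.Re (cj (v 0 i) * w t 0 i : C) + n%:R * (e * nr t / rho) ^+ 2.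
    have -> : n%:R * (e * nr t / rho) ^+ 2 = \sum_(i < n) (e * nr t / rho) ^+ 2 by rewrite sumr_const card_ord mulr_natl.
    rewrite /N2 mulr_sumr -sumrB -big_split /=.
    apply: ler_sum => i _.
    have -> : V t 0 i = (v 0 i - (rho^-1)%:C * w t 0 i : C) by rewrite /V !mxE.
    rewrite nr_sqrD nrN nrM nr_real gtr0_norm ?invr_gt0//.
    have -> : complex.Re (cj (v 0 i) * - ((rho^-1)%:C * w t 0 i) : C) = - (rho^-1 * complex.Re (cj (v 0 i) * w t 0 i : C)).
      by rewrite mulrN mulrCA -ReM_real; case: (_ * _).
    have h : (rho^-1 * nr (w t 0 i)) ^+ 2 <= (e * nr t / rho) ^+ 2.
      have wi := le_trans (nr_coord (w t) i) (nw t tr).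
      apply: lerXn2r; rewrite ?nnegrE; [by rewrite mulr_ge0 ?invr_ge0 ?nr_ge0// ltW | |].
        by rewrite divr_ge0 ?mulr_ge0 ?nr_ge0 ?ltW.
      by rewrite mulrC ler_pM2r// invr_gt0.
    lra.
  have AN : A * N2 (V t) <= A * (N2 v - 2 / rho * \sum_(i < n) complex.Re (cj (v 0 i) * w t 0 i : C) + n%:R * (e * nr t / rho) ^+ 2).
    by rewrite ler_wpM2l.
  have KE : A * (n%:R * (e * nr t / rho) ^+ 2) = Kc * e ^+ 2 * nr t ^+ 2.
    by rewrite /Kc; field; rewrite gt_eqF.
  have AE : A * (2 / rho * \sum_(i < n) complex.Re (cj (v 0 i) * w t 0 i : C)) =
    2 * A / rho * \sum_(i < n) complex.Re (cj (v 0 i) * w t 0 i : C) by field; rewrite gt_eqF.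
  rewrite Rek nr_sqrD.
  move: AN KE AE; clear; set S1 := \sum_(i < n) _; lra.
have dk (t : C) : nr t < 1 - nr z -> exists b', cdiff k t b'.
  move=> tz.
  have zto : open_disc (z + t) by apply/open_discP; have := nrD z t; lra.
  have [b1 hb1] := cdiff_poly P (z + t).
  have [b2 hb2] := df _ zto.
  have sh : cdiff (fun t : C => z + t) t (0 + 1 : C) by apply: cdiffD; [exact: cdiff_cst|exact: cdiff_id].
  have [bw cw] : exists bw, cdiff w t bw.
    have -> : w = fun t : C => (f (z + t) + (- f z)) + (t : R[i]) *: (- b).
      by apply/funext => t'; rewrite /w scalerN.
    eexists; apply: cdiffD; last by apply: cdiffZ; [exact: cdiff_id|exact: cdiff_cst].
    by apply: cdiffD; [exact: cdiff_comp hb2 sh|exact: cdiff_cst].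
  have [bS cS] : exists bS : C, cdiff (fun t => \sum_(i < n) (cj (v 0 i) * w t 0 i : C)) t bS.
    apply: cdiff_sum => i; eexists; apply: cdiffM; [exact: cdiff_cst|exact: cdiff_coord cw].
  eexists; apply: cdiffD; last by apply: cdiffM; [exact: cdiff_cst|exact: cS].
  apply: cdiffD; last by apply: cdiffM; [exact: cdiff_cst|apply: cdiffM; [exact: cdiff_cst|exact: cdiff_id]].
  by apply: cdiffD; [exact: (cdiff_comp (f := fun x : C => P.[x] : C) hb1 sh)|exact: cdiff_cst].
have k0 : k 0 = 0.
  rewrite /k addr0 subrr !mulr0 !add0r big1 ?mulr0// => i _.
  by rewrite /w addr0 subrr scale0r subrr mxE mulr0.
have hr : 0 < r < 1 - nr z by rewrite r0.
have dk' (t : C) : nr (t - 0) < 1 - nr z -> exists b', cdiff k t b' by rewrite subr0; exact: dk.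
have ik := cdiff_circle_integ dk' hr.
have mk := mean_value dk' hr; rewrite k0 mulr0 in mk.
have [_ /(_ 0 r r0)] := su x b.
have sub : [set w0 : C | `|w0 - 0| <= r%:C] `<=` [set z0 | X (x + z0 *: b)].
  move=> t /=; rewrite subr0 nrE lecR => tr.
  by rewrite -GV; exact: (GX (z + t, V t) (zt t tr) (Vt t tr)).
move=> /(_ sub); rewrite scale0r addr0 uU.
pose g (th : R) := (U + (- eta + Kc * e ^+ 2) * r ^+ 2) + complex.Re (k (0 + r%:C * E th)).
have ig : integ 0 (2 * pi) g by apply: integD => //; exact: integ_cst.
have cm := @circle_mean_le R g (fun w0 => u (x + (0 + r%:C * w0) *: b)) ig.
rewrite leNgt => /negP; apply; apply: le_lt_trans (cm _) _.
  move=> th _; have nrt : nr (r%:C * E th : C) = r by rewrite nrM nr_real nr_E mulr1 gtr0_norm.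
  rewrite !add0r /g; apply: le_trans (ktE _ _) _; first by rewrite nrt.
  by rewrite nrt lee_fin add0r; lra.
have p0 := pi_gt0 R.
rewrite rintD//; last exact: integ_cst.
rewrite mk rint_cst; last lra.
rewrite lte_fin addr0 subr0 mulrCA mulVf ?mulr1; last by apply/eqP; lra.
have : (- eta + Kc * e ^+ 2) * r ^+ 2 < 0 by rewrite nmulr_rlt0 ?exprn_gt0//; lra.
lra.
Qed.

(* For large A, a maximum point of
   u (f z + rho v) - Re P(z) + eta |z|^2 - A |v|^2 is interior. *)
Lemma psh_submean_disc (X : set 'rV[C]_n) (u : 'rV[C]_n -> \bar R) (f : C -> 'rV[C]_n) :
  open X -> plurisubharmonic X u -> cont_on closed_disc f -> (forall z, open_disc z -> exists b, cdiff f z b) ->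
  (forall z, closed_disc z -> X (f z)) -> (u (f 0%R) <= circle_mean (u \o f))%E.
Proof.
move=> oX [uu su] cf df fX; rewrite leNgt; apply/negP => lt.
have [c [mc cu]] := ereal_between lt.
have cfT : cont_on unit_circle f by apply: cont_onS cf => x; exact: circle_closed.
have fT x : unit_circle x -> X (f x) by move=> /circle_closed; exact: fX.
have [P [hP P0]] := trig_majorant (usc_comp uu cfT fT) mc.
have [r1 r10 hX] := tube_open compact_closed_disc cf oX fX.
have [r2 r20 hu] := tube_usc cfT oX fT uu hP.
pose rho := Order.min (r1 / 2) (r2 / 2).
have rho0 : 0 < rho by rewrite lt_min; apply/andP; split; lra.
have [rho1 rho2] : rho < r1 /\ rho < r2.
  by split; rewrite gt_min; apply/orP; [left|right]; lra.
clearbody rho.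
pose G (p : C * 'rV[C]_n) := f p.1 + (rho%:C : R[i]) *: p.2.
have Gf p : polydisc p.2 -> nr (G p - f p.1) <= rho.
  move=> hp; rewrite /G addrC addKr nrZ nr_real gtr0_norm// ler_piMr ?(ltW rho0)//.
  exact: nr_polydisc.
have GX p : closed_disc p.1 -> polydisc p.2 -> X (G p).
  by move=> h1 h2; apply: hX h1 _; exact: le_lt_trans (Gf p h2) rho1.
(* At z = 0, v = 0 the penalised function exceeds c - Re P(0) = 2 eta, whereas for |z| = 1 it is
   below eta, since u < Re P(z) within the tube. A maximum thus has |z| < 1. *)
pose eta := (c - pc P 0) / 2.
have eta0 : 0 < eta by rewrite /eta; lra.
have GX' p : (closed_disc `*` polydisc) p -> X (f p.1 + (rho%:C : R[i]) *: p.2).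
  by move=> [h1 h2]; exact: GX.
have [p0 Kp0 max0] := penalty_max P uu cf rho0 eta0 GX' (lexx 0).
have [M M0 hM] : exists2 M : R, 0 <= M & forall q, closed_disc q.1 -> polydisc q.2 ->
    (u (G q) + (- pc P q.1 + eta * nr q.1 ^+ 2)%:E < M%:E)%E.
  have : (u (G p0) + (- pc P p0.1 + eta * nr p0.1 ^+ 2 - 0 * N2 p0.2)%:E < +oo)%E.
    by rewrite lte_add_pinfty ?ltry//; case: (uu _ (GX' _ Kp0)).
  move=> /ereal_between[M0 [h1 _]]; exists (`|M0|) => // q q1 q2.
  have := max0 q (conj q1 q2); rewrite mul0r subr0 => /le_lt_trans; apply; apply: lt_le_trans h1 _.
  by rewrite lee_fin ler_norm.
(* [M] bounds the function without penalty. If some coordinate of v has modulus 1, then N2 v >= 1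
   and the penalised value is below M - A = -1, whereas the maximum is positive. *)
pose A := M + 1.
have A0 : 0 < A by rewrite /A; lra.
have [[z v] [Kz Kv] maxp] := penalty_max P uu cf rho0 eta0 GX' (ltW A0).
rewrite /= in Kz Kv maxp.
set x := f z + _ in maxp.
have lower : ((c - pc P 0)%:E < u x + (- pc P z + eta * nr z ^+ 2 - A * N2 v)%:E)%E.
  have K00 : (closed_disc `*` polydisc) (0 : C, 0 : 'rV[C]_n).
    by split => [|i] /=; apply/closed_discP; rewrite ?mxE nr0.
  apply: lt_le_trans (maxp _ K00); rewrite /= scaler0 addr0 nr0 expr0n /= mulr0 addr0.
  have -> : N2 (0 : 'rV[C]_n) = 0 by rewrite /N2 big1// => i _; rewrite mxE nr0 expr0n.
  by rewrite mulr0 subr0 EFinB EFinN lteD2rE.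
have cP : 0 < c - pc P 0 by lra.
have N20 : 0 <= N2 v by apply: sumr_ge0 => i _; rewrite sqr_ge0.
have Kxz := GX (z, v) Kz Kv.
have ufin : u x \is a fin_num.
  rewrite fin_real// (proj1 (uu _ Kxz)) andbT ltNge; apply/negP => h.
  by move: lower; move: h; case: (u x) => // _; rewrite addNye ltNge leNye.
move: lower; rewrite -(fineK ufin) -EFinD lte_fin; set U := fine (u x) => lower.
have z1 : nr z < 1.
  have := proj1 (closed_discP _) Kz; rewrite le_eqVlt => /orP[/eqP z1|//].
  have := (hu z x (proj2 (unit_circleP _) z1) (le_lt_trans (Gf (z, v) Kv) rho2)).2.
  rewrite -(fineK ufin) lte_fin -/U => h; exfalso.
  have h2 : 0 <= A * N2 v by rewrite mulr_ge0// ltW.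
  move: lower; rewrite z1 expr1n mulr1 /eta; lra.
have v1 : nr v < 1.
  apply/nr_ltP => // i; have := proj1 (closed_discP _) (Kv i); rewrite le_eqVlt => /orP[/eqP vi|//].
  exfalso.
  have h1 : 1 <= N2 v.
    by rewrite /N2 (bigD1 i)//= vi expr1n lerDl sumr_ge0// => j _; rewrite sqr_ge0.
  have := hM (z, v) Kz Kv; rewrite /= -/x -(fineK ufin) -EFinD lte_fin -/U => h2.
  have h3 : A <= A * N2 v by rewrite ler_peMr// ltW.
  move: h2 h3 lower M0 cP; rewrite /A; clear; move: (pc P z) (pc P 0) (N2 v) (nr z ^+ 2) => a1 a2 a3 a4; lra.
apply: (interior_max_false (U := U) (z := z) (v := v) (conj uu su) df rho0 eta0 (ltW A0) z1 v1 (P := P)).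
- by move=> q h1 h2; exact: GX.
- by rewrite -(fineK ufin).
- by move=> q h1 h2; have := maxp q (conj h1 h2); rewrite -{1}(fineK ufin).
Qed.

End SubmeanDisc.

(** * Families and paths of discs *)

Section Families.
Context {R : realType} {n : nat}.
Local Notation C := (R[i]^o).
Local Notation V := ('rV[R[i]^o]_n).

Definition hdisc (f : C -> V) := cont_on closed_disc f /\ forall z, open_disc z -> exists b, cdiff f z b.

Definition adisc (X W : set V) (f : C -> V) :=
  [/\ hdisc f, forall z, closed_disc z -> X (f z) & forall z, unit_circle z -> W (f z)].

Lemma adiscP X W f : analytic_disc_bd X W f <-> adisc X W f.
Proof.
split.
  move=> [[/cont_onP cf df fX] fW]; split.
  - by split => // z /df /derivableP_cdiff.
  - by move=> z Dz; apply: fX; exists z.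
  - by move=> z Tz; apply: fW; exists z.
move=> [[cf df] fX fW]; split; first split.
- exact/cont_onP.
- by move=> z /df /derivableP_cdiff.
- by move=> _ [z Dz <-]; exact: fX.
- by move=> _ [z Tz <-]; exact: fW.
Qed.

Lemma cont_onD (A : set C) (f g : C -> V) : cont_on A f -> cont_on A g -> cont_on A (fun z => f z + g z).
Proof.
move=> cf cg x Ax e e0; have e2 : 0 < e / 2 by lra.
have [d1 d10 h1] := cf x Ax _ e2; have [d2 d20 h2] := cg x Ax _ e2.
exists (Order.min d1 d2); first by rewrite lt_min d10.
move=> y Ay; rewrite lt_min => /andP[/(h1 _ Ay) H1 /(h2 _ Ay) H2].
by rewrite opprD addrACA; apply: le_lt_trans (nrD _ _) _; lra.
Qed.

Lemma cont_on_cst (A : set C) (v : V) : cont_on A (fun=> v).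
Proof. by move=> x _ e e0; exists 1 => // y _ _; rewrite subrr nr0. Qed.

Lemma hdiscD f g : hdisc f -> hdisc g -> hdisc (fun z => f z + g z).
Proof.
move=> [cf df] [cg dg]; split; first exact: cont_onD.
by move=> z Dz; have [a ha] := df z Dz; have [b hb] := dg z Dz; exists (a + b); exact: cdiffD.
Qed.

Lemma hdisc_cst v : hdisc (fun=> v).
Proof. by split; [exact: cont_on_cst|move=> z _; exists 0; exact: cdiff_cst]. Qed.

Definition equicont (F : R -> C -> V) (a b : R) := forall e : R, 0 < e -> exists2 d : R, 0 < d &
  forall t t', a <= t <= b -> a <= t' <= b -> `|t - t'| < d -> forall z, closed_disc z -> nr (F t z - F t' z) < e.

(** A centre homotopy seen as a path of discs, continuous in [t] uniformly on the closed disc; in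
    this form homotopies are composed, reversed and traversed at any speed. *)
Definition dpath (X W : set V) (x : V) (f0 f1 : C -> V) := exists F : R -> C -> V,
  [/\ forall t, 0 <= t <= 1 -> adisc X W (F t) /\ F t 0 = x, equicont F 0 1,
      forall z, closed_disc z -> F 0 z = f0 z & forall z, closed_disc z -> F 1 z = f1 z].

(** The requirements on a disc with room [e] to spare, so that maps closer than [e] to [f] inherit
    them; [q] is a majorant of [phi] that may vary along the circle. *)
Definition margin (X W : set V) (phi : V -> \bar R) (e : R) (f : C -> V) (q : C -> R) :=
  (forall z y, closed_disc z -> nr (y - f z) < e -> X y) /\
  (forall z y, unit_circle z -> nr (y - f z) < e -> W y /\ (phi y < (q z)%:E)%E).

Lemma adisc_bounded (X W : set V) (phi : V -> \bar R) f : usc_on W phi -> adisc X W f ->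
  exists2 B : R, 0 <= B & forall z, unit_circle z -> (phi (f z) < B%:E)%E.
Proof.
move=> uphi [[cf df] fX fW].
have cT : cont_on unit_circle f by apply: cont_onS cf => z; exact: circle_closed.
exact: usc_circle_bounded (usc_comp uphi cT fW).
Qed.

Lemma adisc_margin (X W : set V) (phi : V -> \bar R) f (P : {poly R[i]}) : open X -> open W -> usc_on W phi ->
  adisc X W f -> (forall z, unit_circle z -> (phi (f z) < (pc P z)%:E)%E) -> exists2 e, 0 < e & margin X W phi e f (pc P).
Proof.
move=> oX oW uphi [[cf df] fX fW] hP.
have cT : cont_on unit_circle f by apply: cont_onS cf => z; exact: circle_closed.
have [r1 r10 h1] := tube_open compact_closed_disc cf oX fX.
have [r2 r20 h2] := tube_usc cT oW fW uphi hP.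
exists (Order.min r1 r2); first by rewrite lt_min r10.
split=> z y hz; rewrite lt_min => /andP[y1 y2]; first exact: h1 z y hz y1.
exact: h2 z y hz y2.
Qed.

Lemma pc_cst (B : R) (z : C) : pc (B%:C)%:P z = B.
Proof. by rewrite /pc hornerC. Qed.

(** One parameter serves as radius and, inverted, as bound of [phi], so that [compact_unif] applies
    along the path. A crude bound suffices for a path that is traversed in a short time. *)
Lemma dpath_margin (X W : set V) (phi : V -> \bar R) (F : R -> C -> V) : open X -> open W -> usc_on W phi ->
  (forall t, 0 <= t <= 1 -> adisc X W (F t)) -> equicont F 0 1 ->
  exists2 e, 0 < e & forall t, 0 <= t <= 1 -> margin X W phi e (F t) (fun=> e^-1).
Proof.
move=> oX oW uphi aF eF.
have [d e t d0 de [h1 h2]|t ht|e e0 he] := @compact_unif R R `[0, 1]%classic (fun e t => margin X W phi e (F t) (fun=> e^-1))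
  (segment_compact (a:=0) (b:=1)).
- split=> z y hz hy; first exact: h1 z y hz (lt_le_trans hy de).
  have [? ?] := h2 z y hz (lt_le_trans hy de); split => //.
  apply: (@lt_le_trans _ _ (e^-1)%:E) => //; rewrite lee_fin lef_pV2 ?posrE//; exact: lt_le_trans de.
- rewrite /= in_itv /= in ht.
  have [B B0 hB] := adisc_bounded uphi (aF t ht).
  have [e e0 [h1 h2]] := adisc_margin (P := (B%:C)%:P) oX oW uphi (aF t ht) ltac:(by move=> z /hB; rewrite pc_cst).
  have e2 : 0 < e / 2 by lra.
  have [d d0 hd] := eF _ e2.
  have B1 : 0 < (B + 1)^-1 by rewrite invr_gt0; lra.
  exists (Order.min (e / 2) (B + 1)^-1); first by rewrite lt_min e2.
  apply/nbhs_ballP; exists d => // t'; rewrite /ball /= => tt'; rewrite in_itv /= => ht'.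
  have near z y : closed_disc z -> nr (y - F t' z) < e / 2 -> nr (y - F t z) < e.
    move=> Dz hy; have -> : y - F t z = (y - F t' z) + (F t' z - F t z) by rewrite addrA subrK.
    have := hd t' t ht' ht; rewrite distrC => /(_ tt' z Dz) h.
    by apply: le_lt_trans (nrD _ _) _; lra.
  split=> z y hz; rewrite lt_min => /andP[y1 y2].
    exact: h1 _ _ hz (near z y hz y1).
  have [? h3] := h2 z y hz (near z y (circle_closed hz) y1); split => //.
  apply: lt_le_trans h3 _; rewrite lee_fin pc_cst.
  have m0 : 0 < Order.min (e / 2) (B + 1)^-1 by rewrite lt_min e2.
  have : (Order.min (e / 2) (B + 1)^-1)^-1 >= (B + 1)^-1^-1.
    by rewrite lef_pV2// ?posrE// ge_min lexx orbT.
  rewrite invrK; lra.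
- by exists e => // t ht; apply: he; rewrite /= in_itv.
Qed.

Variables (X W : set V) (phi : V -> \bar R) (g : C -> V) (Gam : R -> R).
Hypothesis cGam : continuous Gam.

Let iGam a b : integ a b Gam.
Proof. by apply: integ_cont; apply: continuous_subspaceT => t; exact: cGam. Qed.

(* g (E t) + A t, a <= t <= b, is a family of discs in X with boundaries in W, where
   A t 0 = 0. As k grows, the mean of phi along t |-> g (E t) + A t (E (k t)) is
   almost the mean over t of those of the discs of the family; the latter are
   dominated by Gam, up to a total error sl. *)
Definition disc_family (a b : R) (A : R -> C -> V) (sl : R) :=
  [/\ forall t, a <= t <= b -> hdisc (A t) /\ A t 0 = 0,
      equicont A a b &
      exists2 e : R, 0 < e &
        (forall t, a <= t <= b -> (forall z y, closed_disc z -> nr (y - (g (E t) + A t z)) < e -> X y) /\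
                                  (forall z y, unit_circle z -> nr (y - (g (E t) + A t z)) < e -> W y)) /\
        exists k0 : nat, forall k : nat, (k0 <= k)%N -> exists2 th : R -> R, integ a b th &
          rint a b th <= rint a b Gam + sl /\
          forall t y, a <= t <= b -> nr (y - (g (E t) + A t (E (k%:R * t)))) < e -> (phi y <= (th t)%:E)%E].

Lemma family_cat a b c A A' sl sl' : a <= b -> b <= c -> disc_family a b A sl -> disc_family b c A' sl' ->
  (forall z, closed_disc z -> A b z = A' b z) ->
  disc_family a c (fun t => if t <= b then A t else A' t) (sl + sl').
Proof.
move=> ab bc [hA eA [e1 e10 [mA [k1 tA]]]] [hA' eA' [e2 e20 [mA' [k2 tA']]]] AA'.
have case1 t : a <= t <= c -> (a <= t <= b /\ t <= b = true) \/ (b <= t <= c /\ t <= b = false).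
  move=> /andP[h1 h2]; have [tb|tb] := leP t b; [left|right]; split => //; apply/andP; split; lra.
split.
- by move=> t /case1[[? ->]|[? ->]]; [exact: hA|exact: hA'].
- move=> e e0; have e02 : 0 < e / 2 by lra.
  have [d1 d10 h1] := eA _ e02; have [d2 d20 h2] := eA' _ e02.
  exists (Order.min d1 d2); first by rewrite lt_min d10.
  (* Across [b] the distance is split at [b], where the two families agree on the closed disc. *)
  have mixed t t' : a <= t <= b -> b <= t' <= c -> `|t - t'| < Order.min d1 d2 ->
      forall z, closed_disc z -> nr (A t z - A' t' z) < e.
    move=> /andP[? ?] /andP[? ?]; rewrite lt_min => /andP[x1 x2] z Dz.
    have -> : A t z - A' t' z = (A t z - A b z) + (A' b z - A' t' z) by rewrite AA'// addrA subrK.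
    have y1 : `|t - b| < d1 by move: x1; rewrite !ltr_norml => /andP[? ?]; apply/andP; split; lra.
    have y2 : `|b - t'| < d2 by move: x2; rewrite !ltr_norml => /andP[? ?]; apply/andP; split; lra.
    have z1 := h1 t b ltac:(apply/andP; split; lra) ltac:(apply/andP; split; lra) y1 z Dz.
    have z2 := h2 b t' ltac:(apply/andP; split; lra) ltac:(apply/andP; split; lra) y2 z Dz.
    by apply: le_lt_trans (nrD _ _) _; lra.
  move=> t t' /case1[[ht ->]|[ht ->]] /case1[[ht' ->]|[ht' ->]].
  + by rewrite lt_min => /andP[x1 x2] z Dz; apply: lt_trans (h1 t t' ht ht' x1 z Dz) _; lra.
  + exact: mixed.
  + by move=> x z Dz; rewrite nrBC; apply: mixed => //; rewrite distrC.
  + by rewrite lt_min => /andP[x1 x2] z Dz; apply: lt_trans (h2 t t' ht ht' x2 z Dz) _; lra.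
- exists (Order.min e1 e2); first by rewrite lt_min e10.
  split.
    move=> t /case1[[ht ->]|[ht ->]].
      by have [m1 m2] := mA t ht; split=> z y hz; rewrite lt_min => /andP[y1 y2]; [exact: m1 z y hz y1|exact: m2 z y hz y1].
    by have [m1 m2] := mA' t ht; split=> z y hz; rewrite lt_min => /andP[y1 y2]; [exact: m1 z y hz y2|exact: m2 z y hz y2].
  exists (maxn k1 k2) => k; rewrite geq_max => /andP[/tA[th ith [rth hth]] /tA'[th' ith' [rth' hth']]].
  have [ii rr] := rint_cat ab bc ith ith'.
  exists (fun t => if t <= b then th t else th' t) => //.
  split; first by rewrite rr (rint_split ab bc (iGam a c)); lra.
  move=> t y /case1[[ht ->]|[ht ->]]; rewrite lt_min => /andP[y1 y2]; first exact: hth t y ht y1.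
  exact: hth' t y ht y2.
Qed.

(** All discs are translates of one, with the common majorant [P]. By equidistribution the integral
    of Re P(e^{ikt}) tends to (b - a) Re P(0), and [del] absorbs the difference for large [k]. *)
Lemma family_const a b c0 (P : {poly R[i]}) (eps del e : R) : a <= b -> 0 < del -> 0 < e ->
  hdisc c0 -> c0 0 = 0 ->
  (forall t, a <= t <= b -> margin X W phi e (fun z => g (E t) + c0 z) (pc P)) ->
  (forall t, a <= t <= b -> pc P 0 <= Gam t + eps) ->
  disc_family a b (fun=> c0) (eps * (b - a) + del).
Proof.
move=> ab del0 e0 hc c00 hm hG; split; first by [].
  by move=> e' e'0; exists 1 => // t t' _ _ _ z _; rewrite subrr nr0.
exists e => //; split.
  move=> t /hm[m1 m2]; split => z y hz hy; first exact: m1 z y hz hy.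
  by have [] := m2 z y hz hy.
have [B B0 hB] := rint_equidist P.
have [k0 hk0] : exists k0 : nat, B / del < k0%:R by exists (Num.truncn (B / del)).+1; exact: truncnS_gt.
exists k0.+1 => k kk.
exists (fun t => pc P (E (k%:R * t))); first exact: integ_pcE.
split.
  have k0' : (0 < k)%N by lia.
  have := hB k a b k0' ab; rewrite ler_norml => /andP[_ h].
  have hb : B / k%:R <= del.
    rewrite ler_pdivrMr ?ltr0n// mulrC -ler_pdivrMr//; apply: le_trans (ltW hk0) _.
    by rewrite ler_nat; lia.
  have hi : (b - a) * pc P 0 <= rint a b Gam + eps * (b - a).
    rewrite [_ * pc P 0]mulrC -(rint_cst (pc P 0) ab) -(rint_cst eps ab) -rintD//; last exact: integ_cst.
    by apply: le_rint => //; [exact: integ_cst|apply: integD => //; exact: integ_cst].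
  lra.
move=> t y /hm[_ m2] hy; apply: ltW.
by have [] := m2 _ y (unit_circleE (k%:R * t)) hy.
Qed.

End Families.

(** * Families along arcs of the circle *)

Section Chains.
Context {R : realType} {n : nat}.
Local Notation C := (R[i]^o).
Local Notation V := ('rV[R[i]^o]_n).
Variables (X W : set V) (phi : V -> \bar R) (g : C -> V) (Gam : R -> R).
Hypothesis oX : open X.
Hypothesis oW : open W.
Hypothesis uphi : usc_on W phi.
Hypothesis dg : hdisc g.
Hypothesis cGam : continuous Gam.

Let iGam a b : integ a b Gam.
Proof. by apply: integ_cont; apply: continuous_subspaceT => t; exact: cGam. Qed.

Let fam := disc_family X W phi g Gam.

Lemma family_le a b A sl sl' : sl <= sl' -> fam a b A sl -> fam a b A sl'.
Proof.
move=> ll [h1 h2 [e e0 [h3 [k0 h4]]]]; split => //; exists e => //; split => //.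
exists k0 => k /h4[th ith [rth hth]]; exists th => //; split => //; lra.
Qed.

Lemma hdisc_circle_cont b e : 0 < e -> exists2 d : R, 0 < d & forall t, `|t - b| < d -> nr (g (E t) - g (E b)) < e.
Proof.
move=> e0; have [d d0 hd] := dg.1 (E b) (circle_closed (unit_circleE b)) e e0.
exists (d / 2); first lra.
move=> t ht; apply: hd; first exact: circle_closed (unit_circleE t).
apply: le_lt_trans (E_lip _ _) _; lra.
Qed.

(* The path is traversed so fast that it contributes at most del to the integral,
   whatever phi is there. *)
Lemma family_path (b : R) (p : R -> C -> V) (del : R) : 0 < del ->
  (forall t, 0 <= t <= 1 -> adisc X W (p t) /\ p t 0 = g (E b)) -> equicont p 0 1 ->
  exists2 tau0 : R, 0 < tau0 & forall tau, 0 < tau -> tau <= tau0 ->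
    fam (b - tau) b (fun t z => p ((t - (b - tau)) / tau) z - g (E b)) del.
Proof.
move=> del0 hp ep.
have [e e0 he] := dpath_margin oX oW uphi (fun t ht => (hp t ht).1) ep.
have e2 : 0 < e / 2 by lra.
have [d d0 hd] := hdisc_circle_cont b e2.
have [d' d'0 hd'] : exists2 d' : R, 0 < d' & forall t, `|t - b| < d' -> `|Gam t - Gam b| < 1.
  have /cvgrPdist_lt/(_ 1 ltr01)/nbhs_ballP[d' d'0 h] := @cGam b; exists d' => // t ht.
  by rewrite distrC; apply: h; rewrite /ball /= distrC.
pose B := e^-1.
have Bp : 0 < `|B - Gam b + 1| + 1 by rewrite ltr_wpDl.
(* During a time [tau] at most this long, [g] moves by less than [e / 2], half of the margin of the
   path; [Gam] stays above [Gam b - 1]; and the excess of the bound [B] over [Gam] integrates to at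
   most [del]. *)
pose tau0 := Order.min (d / 2) (Order.min (d' / 2) (del / (`|B - Gam b + 1| + 1))).
exists tau0; first by rewrite !lt_min; apply/and3P; split; rewrite ?divr_gt0.
move=> tau tau_gt0; rewrite !le_min => /and3P[td td' tB].
have unit_t t : b - tau <= t <= b -> 0 <= (t - (b - tau)) / tau <= 1.
  move=> /andP[h1 h2]; rewrite ler_pdivrMr// divr_ge0 ?(ltW tau_gt0)//=; lra.
have gE t : b - tau <= t <= b -> nr (g (E t) - g (E b)) < e / 2.
  move=> /andP[h1 h2]; apply: hd; rewrite ltr_norml; apply/andP; split; lra.
have near t z y : b - tau <= t <= b ->
   nr (y - (g (E t) + (p ((t - (b - tau)) / tau) z - g (E b)))) < e / 2 ->
   nr (y - p ((t - (b - tau)) / tau) z) < e.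
  move=> ht hy; set q := p _ z in hy *.
  have -> : y - q = (y - (g (E t) + (q - g (E b)))) + (g (E t) - g (E b)).
    by rewrite opprD opprB !addrA [RHS](ACl ((1*4)*(2*5)*(3*6)))%AC /= addNr subrr !addr0.
  by apply: le_lt_trans (nrD _ _) _; have := gE t ht; lra.
split.
- move=> t /unit_t ht; have [[hF _ _] hF0] := hp _ ht.
  split; first exact: (hdiscD hF (hdisc_cst (- g (E b)))).
  by rewrite hF0 subrr.
- move=> e' e'0; have [k k0 hk] := ep e' e'0.
  exists (k * tau); first exact: mulr_gt0.
  move=> t t' ht ht' tt' z Dz.
  have key (x y w : V) : x - w - (y - w) = x - y by rewrite opprB addrA subrK.
  rewrite key; apply: hk => //; [exact: unit_t|exact: unit_t|].
  have -> : (t - (b - tau)) / tau - (t' - (b - tau)) / tau = (t - t') / tau by field; rewrite gt_eqF.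
  by rewrite normrM normfV (gtr0_norm tau_gt0) ltr_pdivrMr.
- exists (e / 2) => //; split.
    move=> t ht; have [m1 m2] := he _ (unit_t t ht).
    split=> z y hz hy; first exact: m1 z y hz (near t z y ht hy).
    by have [] := m2 z y hz (near t z y ht hy).
  exists 0%N => k _; exists (fun=> B); first exact: integ_cst.
  split.
    rewrite rint_cst; last lra.
    have h1 : (Gam b - 1) * (b - (b - tau)) <= rint (b - tau) b Gam.
      rewrite -rint_cst; last lra.
      apply: le_rint => //; first exact: integ_cst.
      move=> t /andP[h1 h2]; have := hd' t; rewrite ltr_norml => /(_ _).
      have tb : - d' < t - b < d' by apply/andP; split; lra.
      by move=> /(_ tb); rewrite ltr_norml => /andP[]; lra.
    have h2 : (B - Gam b + 1) * tau <= del.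
      apply: (@le_trans _ _ ((`|B - Gam b + 1| + 1) * tau)).
        by rewrite ler_pM2r//; have := ler_norm (B - Gam b + 1); lra.
      by rewrite mulrC -ler_pdivlMr.
    have -> : b - (b - tau) = tau by lra.
    have h3 : b - (b - tau) = tau by lra.
    rewrite h3 in h1; lra.
  move=> t y ht hy; have [_ m2] := he _ (unit_t t ht).
  by apply: ltW; have [] := m2 _ y (unit_circleE _) (near t _ y ht hy).
Qed.

(** [c0] is carried along the arc until shortly before [b]; the path from [c0] to [c1], translated
    from the centre [g (E b)] to [g (E t)], takes the remaining time. Each of the two pieces costs
    [del]. *)
Lemma family_arc a b c0 c1 (P : {poly R[i]}) (eps del e : R) : a < b -> 0 < del -> 0 < e -> 0 <= eps ->
  hdisc c0 -> c0 0 = 0 ->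
  (forall t, a <= t <= b -> margin X W phi e (fun z => g (E t) + c0 z) (pc P)) ->
  (forall t, a <= t <= b -> pc P 0 <= Gam t + eps) ->
  dpath X W (g (E b)) (fun z => g (E b) + c0 z) (fun z => g (E b) + c1 z) ->
  exists A, [/\ fam a b A (eps * (b - a) + 2 * del),
    forall z, closed_disc z -> A a z = c0 z & forall z, closed_disc z -> A b z = c1 z].
Proof.
move=> ab del0 e0 eps0 hc c00 hm hG [p [hp ep p0 p1]].
have [tau0 t0 htau] := family_path del0 hp ep.
pose tau := Order.min tau0 ((b - a) / 2).
have tau_gt0 : 0 < tau by rewrite lt_min t0; lra.
have tau1 : tau <= tau0 by rewrite ge_min lexx.
have tau2 : tau <= (b - a) / 2 by rewrite ge_min lexx orbT.
have f2 := htau tau tau_gt0 tau1.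
clearbody tau.
have f1 : fam a (b - tau) (fun=> c0) (eps * (b - tau - a) + del).
  apply: (family_const cGam (P := P) (e := e)) => //; first lra.
    by move=> t /andP[? ?]; apply: hm; apply/andP; split; lra.
  by move=> t /andP[? ?]; apply: hG; apply/andP; split; lra.
exists (fun t => if t <= b - tau then c0 else (fun z => p ((t - (b - tau)) / tau) z - g (E b))).
split.
- apply: (family_le (sl := (eps * (b - tau - a) + del) + del)).
    have : eps * (b - tau - a) <= eps * (b - a) by rewrite ler_wpM2l//; lra.
    lra.
  apply: (family_cat cGam _ _ f1 f2); [lra|lra|].
  by move=> z Dz; rewrite subrr mul0r p0// addrC addKr.
- by move=> z Dz; have -> : a <= b - tau by lra.
- move=> z Dz; have -> : (b <= b - tau) = false by apply/negbTE; rewrite -ltNge; lra.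
  have -> : (b - (b - tau)) / tau = 1 by field; rewrite gt_eqF.
  by rewrite p1// addrC addKr.
Qed.

(** Concatenation of arcs: each adds [eps * L + 2 * del] to the error and ends with the disc with
    which the next one starts. *)
Lemma family_chain (m : nat) (L : R) (c : nat -> C -> V) (P : nat -> {poly R[i]}) (e : nat -> R) (eps del : R) :
  0 < L -> 0 < del -> 0 <= eps -> (forall j, 0 < e j) ->
  (forall j, (j < m)%N -> hdisc (c j) /\ c j 0 = 0) ->
  (forall j t, (j < m)%N -> j%:R * L <= t <= j.+1%:R * L ->
     margin X W phi (e j) (fun z => g (E t) + c j z) (pc (P j)) /\ pc (P j) 0 <= Gam t + eps) ->
  (forall j, (j < m)%N -> dpath X W (g (E (j.+1%:R * L))) (fun z => g (E (j.+1%:R * L)) + c j z) (fun z => g (E (j.+1%:R * L)) + c j.+1 z)) ->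
  forall j, (j < m)%N -> exists A, [/\ fam 0 (j.+1%:R * L) A (eps * (j.+1%:R * L) + 2 * del * j.+1%:R),
    forall z, closed_disc z -> A 0 z = c 0%N z & forall z, closed_disc z -> A (j.+1%:R * L) z = c j.+1 z].
Proof.
move=> L0 del0 eps0 e0 hc hm hp.
have arc j : (j < m)%N -> exists A, [/\ fam (j%:R * L) (j.+1%:R * L) A (eps * (j.+1%:R * L - j%:R * L) + 2 * del),
    forall z, closed_disc z -> A (j%:R * L) z = c j z & forall z, closed_disc z -> A (j.+1%:R * L) z = c j.+1 z].
  move=> jm; have [h1 h2] := hc j jm.
  apply: (family_arc (P := P j) (e := e j)) => //.
  - by rewrite ltr_pM2r// ltr_nat.
  - by move=> t ht; have [] := hm j t jm ht.
  - by move=> t ht; have [] := hm j t jm ht.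
  - exact: hp.
elim=> [|j IH] jm.
  have [A [h1 h2 h3]] := arc 0%N jm; exists A; rewrite mul0r subr0 in h1 h2.
  by split; [apply: family_le h1; rewrite mulr1|exact: h2|exact: h3].
have [A [h1 h2 h3]] := IH (ltnW jm).
have [A' [h1' h2' h3']] := arc j.+1 jm.
have j0 : 0 < j.+1%:R * L by rewrite mulr_gt0.
have jj : j.+1%:R * L < j.+2%:R * L by rewrite ltr_pM2r// ltr_nat.
exists (fun t => if t <= j.+1%:R * L then A t else A' t); split.
- apply: family_le (family_cat cGam (ltW j0) (ltW jj) h1 h1' _).
    rewrite -[j.+2%:R]natr1; lra.
  by move=> z Dz; rewrite h3// h2'.
- by move=> z Dz; rewrite (ltW j0); exact: h2.
- by move=> z Dz; rewrite leNgt jj /=; exact: h3'.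
Qed.

End Chains.

(** * Gluing *)

Section KernelDisc.
Context {R : realType} {n : nat}.
Local Notation C := (R[i]^o).
Local Notation V := ('rV[R[i]^o]_n).

Lemma hdisc_bounded (f : C -> V) : hdisc f -> exists2 B : R, 0 <= B & forall z, closed_disc z -> nr (f z) <= B.
Proof.
move=> [cf _].
have [d e x d0 de|x Kx|e e0 he] := @compact_unif R C closed_disc (fun e z => nr (f z) <= e^-1) compact_closed_disc.
- by move=> /le_trans; apply; rewrite lef_pV2 ?posrE//; exact: lt_le_trans de.
- have [d d0 hd] := cf x Kx 1 ltr01; have nf := nr_ge0 (f x).
  exists (nr (f x) + 1)^-1; first by rewrite invr_gt0; lra.
  apply/nbhs_nrP; exists d => // y yx Ky; rewrite invrK.
  have -> : f y = (f y - f x) + f x by rewrite subrK.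
  by apply: le_trans (nrD _ _) _; have := hd y Ky yx; lra.
- by exists e^-1 => //; rewrite invr_ge0 ltW.
Qed.

(** A Schwarz estimate with a crude constant: differentiability at 0 gives it near the centre,
    boundedness elsewhere. Applied at z^k, it yields a zero of order k. *)
Lemma hdisc_schwarz (f : C -> V) : hdisc f -> f 0 = 0 -> exists2 D : R, 0 <= D & forall z, closed_disc z -> nr (f z) <= D * nr z.
Proof.
move=> hf f0; have [B B0 hB] := hdisc_bounded hf.
have D0 : open_disc (0 : C) by apply/open_discP; rewrite nr0.
have [b hb] := hf.2 0 D0.
have [L L0 [d d0 hL]] := cdiff_lip hb.
have Bd : 0 <= B / d by rewrite divr_ge0// ltW.
exists (L + B / d); first by rewrite addr_ge0// ltW.
move=> z Dz; have nz := nr_ge0 z; rewrite mulrDl.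
have Lz : 0 <= L * nr z by rewrite mulr_ge0// ltW.
have [zd|zd] := ltP (nr z) d.
  have := hL z zd; rewrite add0r f0 subr0.
  have : 0 <= B / d * nr z by rewrite mulr_ge0.
  lra.
have : B <= B / d * nr z by rewrite mulrAC ler_pdivlMr// ler_wpM2l.
have := hB z Dz; lra.
Qed.

Lemma kap_bound N M l (z : C) : z != 0 -> nr z <= 1 -> nr (kap N M l z) <= `|kfac N M| * 4 ^+ N / nr z ^+ N.
Proof.
move=> z0 z1; rewrite /kap nrM nr_real -mulrA ler_wpM2l// nrM !nrX nrV nrM nrV nr_E invr1 mulr1 exprVn mulrC.
rewrite ler_wpM2r ?invr_ge0 ?exprn_ge0 ?nr_ge0//.
have -> : 4 ^+ N = 2 ^+ (2 * N) :> R by rewrite exprM; congr (_ ^+ _); lra.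
apply: lerXn2r; rewrite ?nnegrE ?nr_ge0//.
by apply: le_trans (nrD _ _) _; rewrite nr1 nrM nrV nr_E invr1 mulr1; lra.
Qed.

Lemma kap_cdiff N M l (z : C) : z != 0 -> exists b : C, cdiff (kap N M l) z b.
Proof.
move=> z0.
have zE0 : (z / E (node M l) : C) != 0 by apply: mulf_neq0 => //; rewrite invr_eq0; exact: E_neq0.
have h1 : exists b : C, cdiff (fun x : C => x / E (node M l) : C) z b.
  eexists; apply: cdiffM; [exact: cdiff_id|exact: cdiff_cst].
have [b1 hb1] := h1.
have [b2 hb2] := cdiffX ((z / E (node M l))^-1 : C) N.
have [b3 hb3] := cdiffX (1 + z / E (node M l) : C) (2 * N).
have h2 := cdiff_comp (f := fun x : C => x^-1 : C) (k := fun x : C => x / E (node M l) : C) (cdiffV zE0) hb1.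
have h3 := cdiff_comp (f := fun x : C => x ^+ N : C) (k := fun x : C => (x / E (node M l))^-1 : C) hb2 h2.
have h4 := cdiffD (cdiff_cst (1 : C) z) hb1.
have h5 := cdiff_comp (f := fun x : C => x ^+ (2 * N) : C) (k := fun x : C => 1 + x / E (node M l) : C) hb3 h4.
eexists; exact: cdiffM (cdiff_cst _ z) (cdiffM h3 h5).
Qed.

(** |e^{is} - 1| has a positive lower bound for s in [d, 2 pi - d]; so parameters of nearby points
    of the circle are close, or close to opposite ends of [0, 2 pi]. *)
Lemma circ_mod (d : R) : 0 < d -> exists2 k : R, 0 < k & forall t t', 0 <= t -> t <= t' -> t' <= 2 * pi -> 
  nr (E t - E t' : C) < k -> t' - t < d \/ 2 * pi - d < t' - t.
Proof.
move=> d0.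
have [e1 e2 s s0 s1|s Ks|e e0 he] := @compact_unif R R `[d, (2 * pi - d)]%classic (fun e s => e <= nr (E s - 1 : C))
  (segment_compact (a:=d) (b:=2 * pi - d)).
- exact: le_trans.
- rewrite /= in_itv /= in Ks; case/andP: Ks => s1 s2.
  have m0 : 0 < nr (E s - 1 : C).
    rewrite lt_neqAle nr_ge0 andbT eq_sym; apply/eqP => /nr_eq0 /eqP; rewrite subr_eq0; apply/negP.
    by apply: E_neq1; apply/andP; split; lra.
  exists (nr (E s - 1 : C) / 2); first lra.
  apply/nbhs_ballP; exists (nr (E s - 1 : C) / 4) => /=; first lra.
  move=> y; rewrite /ball /= => ys _.
  have h := nrD (E s - E y : C) (E y - 1); rewrite addrA subrK in h.
  have := E_lip s y; lra.
exists e => // t t' t0 tt' t'2 h.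
have [h1|h1] := ltP (t' - t) d; first by left.
have [h2|h2] := ltP (2 * pi - d) (t' - t); first by right.
exfalso; have := he (t' - t); rewrite /= in_itv /= h1 h2 => /(_ isT).
by rewrite nr_EB nrBC leNgt h.
Qed.

Variables (g : C -> V) (A : R -> C -> V).
Hypothesis dg : hdisc g.
Hypothesis hA : forall t, 0 <= t <= 2 * pi -> hdisc (A t) /\ A t 0 = 0.
Hypothesis eA : equicont A 0 (2 * pi).
Hypothesis A02pi : forall z, closed_disc z -> A 0 z = A (2 * pi) z.

(** Here the closing of the loop enters: nearby points whose parameters are at opposite ends are
    compared through [A 0 = A (2 * pi)]. *)
Lemma equicont_circle e : 0 < e -> exists2 d : R, 0 < d & forall t t', 0 <= t <= 2 * pi -> 0 <= t' <= 2 * pi ->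
  nr (E t - E t' : C) < d -> forall z, closed_disc z -> nr (A t z - A t' z) < e.
Proof.
move=> e0; have e2 : 0 < e / 2 by lra.
have [d d0 hd] := eA e2; have [k k0 hk] := circ_mod d0.
have p0 := pi_gt0 R.
have aux t t' : 0 <= t -> t <= t' -> t' <= 2 * pi -> nr (E t - E t' : C) < k -> forall z, closed_disc z -> nr (A t z - A t' z) < e.
  move=> t0 tt' t'2 h z Dz; have [h1|h1] := hk t t' t0 tt' t'2 h.
    apply: lt_trans (hd t t' _ _ _ z Dz) _; rewrite ?ltr_norml; [apply/andP|apply/andP|apply/andP|]; try split; lra.
  have a1 : nr (A t z - A 0 z) < e / 2.
    apply: hd => //; rewrite ?ltr_norml; apply/andP; split; lra.
  have a2 : nr (A (2 * pi) z - A t' z) < e / 2.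
    apply: hd => //; rewrite ?ltr_norml; apply/andP; split; lra.
  have -> : A t z - A t' z = (A t z - A 0 z) + (A (2 * pi) z - A t' z) by rewrite A02pi// addrA subrK.
  by apply: le_lt_trans (nrD _ _) _; lra.
exists k => // t t' /andP[? ?] /andP[? ?] h z Dz; have [tt'|/ltW tt'] := leP t t'; first exact: aux.
by rewrite nrBC; apply: aux => //; rewrite nrBC.
Qed.

Lemma family_bounded : exists2 B : R, 0 <= B & forall t z, 0 <= t <= 2 * pi -> closed_disc z -> nr (A t z) <= B.
Proof.
have [e1 e2 s s0 s1|s Ks|e e0 he] := @compact_unif R R `[0, (2 * pi)]%classic (fun e s => forall z, closed_disc z -> nr (A s z) <= e^-1)
  (segment_compact (a:=0) (b:=2 * pi)).
- move=> h z Dz; apply: le_trans (h z Dz) _; rewrite lef_pV2 ?posrE//; exact: lt_le_trans s1.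
- rewrite /= in_itv /= in Ks.
  have [B B0 hB] := hdisc_bounded (hA Ks).1.
  have [d d0 hd] := eA ltr01.
  exists (B + 1)^-1; first by rewrite invr_gt0; lra.
  apply/nbhs_ballP; exists d => // y; rewrite /ball /= distrC in_itv /= => ys Ky z Dz; rewrite invrK.
  have -> : A y z = (A y z - A s z) + A s z by rewrite subrK.
  by apply: le_trans (nrD _ _) _; have := hd y s Ky Ks ys z Dz; have := hB z Dz; lra.
exists e^-1; first by rewrite invr_ge0 ltW.
by move=> t z ht; apply: he; rewrite /= in_itv.
Qed.

Lemma node_range M l : (l < M)%N -> 0 <= (node M l : R) <= 2 * pi.
Proof.
move=> lM; have p0 := pi_gt0 R; have M0 : 0 < M%:R :> R by rewrite ltr0n; lia.
have q0 : 0 <= 2 * pi / M%:R :> R by rewrite divr_ge0//; lra.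
rewrite /node mulr_ge0//=.
apply: (@le_trans _ _ (M%:R * (2 * pi / M%:R))).
  by rewrite ler_wpM2r// ler_nat ltnW.
by rewrite mulrC divfK// gt_eqF.
Qed.

(* The pole of order N of kap N M l at 0 is compensated by the zero of
   z |-> A _ (z ^+ k). *)
Definition kdisc (N M k : nat) (z : C) : V := g z + \sum_(l < M) (kap N M l z : R[i]) *: A (node M l) (z ^+ k).

Lemma closed_discX (z : C) k : closed_disc z -> closed_disc (z ^+ k : C).
Proof. by move=> /closed_discP h; apply/closed_discP; rewrite nrX exprn_ile1// nr_ge0. Qed.

Lemma open_discX (z : C) k : (0 < k)%N -> open_disc z -> open_disc (z ^+ k : C).
Proof.
move=> k0 /open_discP h; apply/open_discP; rewrite nrX exprn_ilt1 ?nr_ge0//; lia.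
Qed.

(** The pole |z|^(-N) from [kap_bound] meets the factor |z|^k from [hdisc_schwarz]; [K] does not
    depend on [k], which is therefore still free. *)
Lemma kdisc_bound N M : exists2 K : R, 0 <= K & forall k z, (N < k)%N -> closed_disc z ->
  nr (kdisc N M k z - g z) <= K * nr z ^+ (k - N).
Proof.
have hex (l : 'I_M) : exists d : R, 0 <= d /\ forall z, closed_disc z -> nr (A (node M l) z) <= d * nr z.
  have [h1 h2] := hA (node_range (ltn_ord l)).
  by have [D ? ?] := hdisc_schwarz h1 h2; exists D.
have [D hD] := choice hex.
pose K := \sum_(l < M) (`|kfac N M| * 4 ^+ N * D l) : R.
have K0l (l : 'I_M) : 0 <= `|kfac N M| * 4 ^+ N * D l :> R.
  by rewrite !mulr_ge0 ?exprn_ge0//; case: (hD l).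
have K0 : 0 <= K by apply: sumr_ge0.
exists K => // k z Nk Dz; rewrite /kdisc addrC addKr.
have nz := nr_ge0 z.
apply: le_trans (nr_sum _ _) _; rewrite /K mulr_suml; apply: ler_sum => l _.
(* At 0 the formula of [kap] inverts 0 and carries no meaning, but [A _ (0 ^+ k) = 0] makes every
   summand vanish. *)
have [z0|z0] := eqVneq z 0.
  rewrite z0; have k0 : (0 < k)%N by lia.
  rewrite expr0n (gtn_eqF k0) /= (hA (node_range (ltn_ord l))).2 scaler0 nr0.
  by rewrite mulr_ge0// exprn_ge0// nr_ge0.
have nz0 : 0 < nr z by rewrite lt_neqAle nr_ge0 andbT eq_sym; apply/eqP => /nr_eq0 /eqP; rewrite (negbTE z0).
rewrite nrZ.
have h1 := kap_bound N M l z0 (proj1 (closed_discP _) Dz).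
have h2 := (hD l).2 _ (closed_discX k Dz); rewrite nrX in h2.
apply: (@le_trans _ _ ((`|kfac N M| * 4 ^+ N / nr z ^+ N) * (D l * nr z ^+ k))).
  by rewrite ler_pM ?nr_ge0.
have -> : nr z ^+ k = nr z ^+ N * nr z ^+ (k - N) by rewrite -exprD subnKC// ltnW.
have : nr z ^+ N != 0 by rewrite expf_neq0// gt_eqF.
move: (nr z ^+ N) => x x0; rewrite le_eqVlt; apply/orP; left; apply/eqP; field; exact: x0.
Qed.

Definition cont_at (S : set C) (f : C -> V) (x : C) := forall e : R, 0 < e -> exists2 d : R, 0 < d &
  forall y, S y -> nr (y - x) < d -> nr (f y - f x) < e.

Lemma cont_atD S f1 f2 x : cont_at S f1 x -> cont_at S f2 x -> cont_at S (fun z => f1 z + f2 z) x.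
Proof.
move=> c1 c2 e e0; have e2 : 0 < e / 2 by lra.
have [d1 d10 h1] := c1 _ e2; have [d2 d20 h2] := c2 _ e2.
exists (Order.min d1 d2); first by rewrite lt_min d10.
move=> y Sy; rewrite lt_min => /andP[/(h1 y Sy) H1 /(h2 y Sy) H2].
by rewrite opprD addrACA; apply: le_lt_trans (nrD _ _) _; lra.
Qed.

Lemma cont_at_sum S (I : Type) (r : seq I) (F : I -> C -> V) x : (forall i, cont_at S (F i) x) ->
  cont_at S (fun z => \sum_(i <- r) F i z) x.
Proof.
move=> h; elim: r => [|i r IH].
  by move=> e e0; exists 1 => // y _ _; rewrite !big_nil subrr nr0.
move=> e e0; have [d d0 hd] := cont_atD (h i) IH e0; exists d => // y Sy /(hd y Sy).
by rewrite !big_cons.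
Qed.

Lemma cont_atZ S (k : C -> C) f b x : cdiff k x b -> cont_at S f x -> cont_at S (fun z => (k z : R[i]) *: f z) x.
Proof.
move=> dk cf e e0.
have nk := nr_ge0 (k x); have nf := nr_ge0 (f x).
pose q := nr (k x) + nr (f x) + 1.
have q0 : 0 < q by rewrite /q; lra.
pose e1 := Order.min 1 (e / (2 * q)).
have e10 : 0 < e1 by rewrite lt_min ltr01 divr_gt0// mulr_gt0.
have e11 : e1 <= 1 by rewrite ge_min lexx.
have e1q : e1 * q <= e / 2.
  have : e1 <= e / (2 * q) by rewrite ge_min lexx orbT.
  rewrite -(ler_pM2r q0) => /le_trans; apply.
  by have -> : e / (2 * q) * q = e / 2 by field; rewrite gt_eqF.
clearbody e1.
have [d1 d10 h1] := cdiff_cont dk e10; have [d2 d20 h2] := cf _ e10.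
exists (Order.min d1 d2); first by rewrite lt_min d10.
move=> y Sy; rewrite lt_min => /andP[/h1 H1 /(h2 y Sy) H2].
have -> : (k y : R[i]) *: f y - (k x : R[i]) *: f x =
   ((k y - k x : C) : R[i]) *: (f y - f x) + (((k y - k x : C) : R[i]) *: f x + (k x : R[i]) *: (f y - f x)).
  have key (m m' : R[i]) (v w : V) : m *: v - m' *: w = (m - m') *: (v - w) + ((m - m') *: w + m' *: (v - w)).
    by rewrite addrA -scalerDr subrK scalerBl scalerBr addrA subrK.
  exact: key.
apply: le_lt_trans (nrD _ _) _; apply: le_lt_trans (lerD (lexx _) (nrD _ _)) _; rewrite !nrZ.
have b1 : nr (k y - k x) * nr (f y - f x) <= e1 * 1.
  by rewrite ler_pM ?nr_ge0// ?(ltW H1)//; lra.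
have b2 : nr (k y - k x) * nr (f x) <= e1 * nr (f x) by rewrite ler_wpM2r// ltW.
have b3 : nr (k x) * nr (f y - f x) <= e1 * nr (k x) by rewrite mulrC ler_wpM2r// ltW.
rewrite /q in e1q; lra.
Qed.

(** For k >= N + 2 the correction to [g] is of order |z|^2, hence differentiable at 0 with
    derivative 0 in spite of the poles of [kap]; elsewhere the rules of differentiation apply. *)
Lemma kdisc_hdisc N M k : (N.+2 <= k)%N -> hdisc (kdisc N M k).
Proof.
move=> Nk; have k0 : (0 < k)%N by lia.
have [K K0 hK] := kdisc_bound N M.
have bnd z : closed_disc z -> nr (kdisc N M k z - g z) <= K * nr z ^+ 2.
  move=> Dz; apply: le_trans (hK k z _ Dz) _; first lia.
  rewrite ler_wpM2l//; apply: ler_wiXn2l; [exact: nr_ge0|exact/closed_discP|lia].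
have k0g : kdisc N M k 0 - g 0 = 0.
  apply: nr_eq0; apply/eqP; rewrite eq_le nr_ge0 andbT.
  by have := bnd 0; rewrite nr0 expr0n mulr0; apply; apply/closed_discP; rewrite nr0.
have d0 : cdiff (fun z => kdisc N M k z - g z) 0 (0 : V).
  move=> e e0; have eK : 0 < e / (K + 1) by rewrite divr_gt0//; lra.
  exists (Order.min 1 (e / (K + 1))); first by rewrite lt_min ltr01.
  move=> w; rewrite lt_min => /andP[w1 w2]; rewrite add0r k0g subr0 scaler0 subr0.
  apply: le_trans (bnd w _) _; first by apply/closed_discP; exact: ltW.
  have nw := nr_ge0 w; rewrite expr2 mulrA ler_wpM2r//.
  move: w2; rewrite ltr_pdivlMr; lra.
have cd (z : C) : open_disc z -> exists b, cdiff (kdisc N M k) z b.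
  move=> Dz; have [bg hbg] := dg.2 z Dz.
  have [z0|z0] := eqVneq z 0.
    exists (0 + bg); have := cdiffD d0 (_ : cdiff g 0 bg); rewrite -{1}z0 => /(_ hbg).
    have -> : (fun x : C => kdisc N M k x - g x + g x) = kdisc N M k by apply/funext => x; rewrite subrK.
    by rewrite z0.
  have [bS hbS] : exists b : V, cdiff (fun z : C => \sum_(l < M) (kap N M l z : R[i]) *: A (node M l) (z ^+ k : C)) z b.
    apply: cdiff_sum => l.
    have [b1 h1] := kap_cdiff N M l z0.
    have [b2 h2] := (hA (node_range (ltn_ord l))).1.2 _ (open_discX k0 Dz).
    have [b3 h3] := cdiffX z k.
    eexists; exact: cdiffZ h1 (cdiff_comp (k := fun x : C => x ^+ k : C) h2 h3).
  exists (bg + bS); exact: cdiffD hbg hbS.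
split => //; move=> z Dz.
have cg : cont_at closed_disc g z := dg.1 z Dz.
have [z0|z0] := eqVneq z 0.
  rewrite z0 in Dz cg *.
  have [|b hb] := cd 0; first by apply/open_discP; rewrite nr0.
  by move=> e e0; have [d dd0 hd] := cdiff_cont hb e0; exists d => // y _; exact: hd.
apply: cont_atD => //; apply: cont_at_sum => l.
have [b1 h1] := kap_cdiff N M l z0.
apply: (cont_atZ h1) => e e0.
have [d dd0 hd] := (hA (node_range (ltn_ord l))).1.1 _ (closed_discX k Dz) e e0.
have [b3 h3] := cdiffX z k.
have [d' d'0 hd'] := cdiff_cont h3 dd0; exists d' => // y Dy /hd'; apply: hd; exact: closed_discX.
Qed.

Lemma finite_min (P : nat -> R -> Prop) (M : nat) : (forall l, (l < M)%N -> exists2 d, 0 < d & P l d) ->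
  (forall l d d', 0 < d' -> d' <= d -> P l d -> P l d') -> exists2 d : R, 0 < d & forall l, (l < M)%N -> P l d.
Proof.
move=> + mono; elim: M => [|M IH] h; first by exists 1.
have [d d0 hd] := IH (fun l lM => h l (ltnW lM)).
have [d' d'0 hd'] := h M (ltnSn M).
exists (Order.min d d'); first by rewrite lt_min d0.
have m0 : 0 < Order.min d d' by rewrite lt_min d0.
move=> l; rewrite ltnS leq_eqVlt => /orP[/eqP ->|lM].
  by apply: (mono _ d') => //; rewrite ge_min lexx orbT.
by apply: (mono _ d) => //; [rewrite ge_min lexx|exact: hd].
Qed.

(** Only [w] lies on the circle, while [z] may be inside: this extends estimates on the circle to a
    thin annulus. *)
Lemma near_circle N M e : 0 < e -> exists2 d : R, 0 < d & forall w z, unit_circle w -> closed_disc z -> nr (z - w) < d ->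
   nr (g z - g w) < e /\ forall l, (l < M)%N -> nr (kap N M l z - kap N M l w : C) < e.
Proof.
move=> e0; have e2 : 0 < e / 2 by lra.
have half (a b : R) : a < e / 2 -> b < e / 2 -> a + b < e by lra.
have [d d' w d0 dd' h|w Tw|d d0 hd] := @compact_unif R C unit_circle
   (fun d w => forall z, closed_disc z -> nr (z - w) < d ->
   nr (g z - g w) < e /\ forall l, (l < M)%N -> nr (kap N M l z - kap N M l w : C) < e) compact_unit_circle.
- by move=> z Dz hz; apply: h => //; exact: lt_le_trans dd'.
- have w0 : w != 0 by apply/eqP => w0; move/unit_circleP: Tw; rewrite w0 nr0 => /eqP; rewrite eq_sym oner_eq0.
  have [d1 d10 h1] := dg.1 w (circle_closed Tw) _ e2.
  have [d2 d20 h2] : exists2 d : R, 0 < d & forall l, (l < M)%N -> forall z, nr (z - w) < d -> nr (kap N M l z - kap N M l w : C) < e / 2.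
    apply: (@finite_min (fun l d => forall z, nr (z - w) < d -> nr (kap N M l z - kap N M l w : C) < e / 2)).
      by move=> l _; have [b hb] := kap_cdiff N M l w0; exact: cdiff_cont hb _ e2.
    by move=> l d d' _ dd' h z hz; apply: h; exact: lt_le_trans dd'.
  pose m := Order.min d1 d2; have m0 : 0 < m by rewrite lt_min d10.
  have [m1 m2] : m <= d1 /\ m <= d2 by rewrite /m !ge_min !lexx orbT.
  clearbody m.
  exists (m / 2); first lra.
  apply/nbhs_nrP; exists (m / 2); first lra.
  move=> w' w'w Tw' z Dz zw'.
  have zw : nr (z - w) < m.
    have -> : z - w = (z - w') + (w' - w) by rewrite addrA subrK.
    by apply: le_lt_trans (nrD _ _) _; lra.
  have w'w2 : nr (w' - w) < m by lra.
  split.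
    have -> : g z - g w' = (g z - g w) + (g w - g w') by rewrite addrA subrK.
    have x1 := h1 z Dz (lt_le_trans zw m1); have x2 := h1 w' (circle_closed Tw') (lt_le_trans w'w2 m1).
    by rewrite nrBC in x2; apply: le_lt_trans (nrD _ _) _; exact: half.
  move=> l lM; have -> : (kap N M l z - kap N M l w' : C) = (kap N M l z - kap N M l w) + (kap N M l w - kap N M l w') by rewrite addrA subrK.
  have x1 := h2 l lM z (lt_le_trans zw m2); have x2 := h2 l lM w' (lt_le_trans w'w2 m2).
  by rewrite nrBC in x2; apply: le_lt_trans (nrD _ _) _; exact: half.
- by exists d => // w z Tw; exact: hd.
Qed.

(** The averaging of [trig_approx], applied to [A t z] as a function of [t], uniformly in [z]: on
    the circle the weights [kap] are the real numbers [kr]. Two values of [A] differ by at most 2B,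
    whence the constant 8 (B + 1). *)
Lemma kdisc_circle e : 0 < e -> exists N M, (0 < M)%N /\ forall t z, 0 <= t <= 2 * pi -> closed_disc z ->
  nr (\sum_(l < M) (kap N M l (E t) : R[i]) *: A (node M l) z - A t z) < e.
Proof.
move=> e0; have e2 : 0 < e / 2 by lra.
have [B B0 hB] := family_bounded.
have [d d0 hd] := equicont_circle e2.
have eB : 0 < e / (8 * (B + 1)) by rewrite divr_gt0// mulr_gt0//; lra.
have [N hN] := kr_small d0 eB.
exists N, N.+1; split => // t z ht Dz; set M := N.+1.
have -> : \sum_(l < M) (kap N M l (E t) : R[i]) *: A (node M l) z - A t z =
   \sum_(l < M) ((kr N M (t - node M l))%:C : R[i]) *: (A (node M l) z - A t z).
  under [RHS]eq_bigr do rewrite scalerBr.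
  rewrite sumrB -scaler_suml; congr (_ - _).
    by apply: eq_bigr => l _; rewrite kap_circle.
  by rewrite -rmorph_sum /= sum_kr// scale1r.
apply: le_lt_trans (nr_sum _ _) _.
under eq_bigr do rewrite nrZ nr_real (ger0_norm (kr_ge0 _ _ _)).
apply: (@le_lt_trans _ _ (e / 2 + e / (8 * (B + 1)) * (B + B))).
  apply: (kr_avg (d := d) (x := fun l => nr (A (node M l) z - A t z))) => //.
  - lra.
  - lra.
  - exact: ltW.
  - by move=> s; exact: hN.
  - by move=> l lM h; apply: ltW; apply: hd => //; [exact: node_range|rewrite nrBC].
  - move=> l lM; apply: le_trans (nrD _ _) _; rewrite nrN; apply: lerD; apply: hB => //; exact: node_range.
have : e / (8 * (B + 1)) * (B + 1) = e / 8 by field; apply/eqP; lra.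
have := ltW eB; nra.
Qed.

End KernelDisc.

Section KernelDiscMean.
Context {R : realType} {n : nat}.
Local Notation C := (R[i]^o).
Local Notation V := ('rV[R[i]^o]_n).

(** The disc stays in [X] for two reasons. Up to radius [r0], the correction K |z|^(k - N) is too
    small to leave the tube around [g]. Beyond it, [g] and the [kap] have nearly the values of the
    radial projection E t, so h(z) is near g(E t) + A t (z^k), a point of a disc of the family. *)
Lemma kernel_disc (X W : set V) (phi : V -> \bar R) (g : C -> V) (Gam : R -> R) (A : R -> C -> V) (sl : R) :
  open X -> hdisc g -> (forall z, closed_disc z -> X (g z)) ->
  disc_family X W phi g Gam 0 (2 * pi) A sl -> (forall z, closed_disc z -> A 0 z = A (2 * pi) z) ->
  exists h, [/\ adisc X W h, h 0 = g 0 & (circle_mean (phi \o h) <= ((2 * pi)^-1 * (rint 0 (2 * pi) Gam + sl))%:E)%E].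
Proof.
have arith (N m k : nat) : (N.+2 + m <= k)%N -> [/\ (N < k)%N, (m <= k - N)%N & (k - N == 0)%N = false].
  by move=> h; split; [lia|lia|apply/negbTE; lia].
move=> oX dg gX [hA eA [e e0 [mar [k0 hth]]]] A02pi.
have p0 := pi_gt0 R.
have e4 : 0 < e / 4 by lra.
have [N [M [M0 hNM]]] := kdisc_circle hA eA A02pi e4.
have [B B0 hB] := family_bounded hA eA.
have MB : 0 < M%:R * B + 1 by rewrite ltr_wpDl// mulr_ge0.
(* [eta] will bound the change of [g] and of each [kap] near the circle; over [M] summands, with [A]
   bounded by [B], the latter costs at most [e / 4]. *)
have [eta [eta0 eta4 etaM]] : exists eta, [/\ 0 < eta, eta <= e / 4 & M%:R * (eta * B) <= e / 4].
  exists (Order.min (e / 4) (e / (4 * (M%:R * B + 1)))); split.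
  - by rewrite lt_min e4 divr_gt0// mulr_gt0.
  - by rewrite ge_min lexx.
  - apply: (@le_trans _ _ (M%:R * (e / (4 * (M%:R * B + 1)) * B))).
      by rewrite ler_wpM2l// ler_wpM2r// ge_min lexx orbT.
    have -> : M%:R * (e / (4 * (M%:R * B + 1)) * B) = e / 4 * (M%:R * B / (M%:R * B + 1)).
      by field; apply/eqP; lra.
    by rewrite ler_piMr ?(ltW e4)// ler_pdivrMr//; lra.
have [d d0 hd] := near_circle dg N M eta0.
have [K K0 hK] := kdisc_bound g hA N M.
have [eX eX0 hX] := tube_open compact_closed_disc dg.1 oX gX.
(* Beyond [r0], a point is within [d] of its radial projection to the circle; the maximum with 1/2
   keeps [r0] nonnegative. *)
pose r0 := Order.max (1 - d / 2) (1 / 2).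
have r00 : 0 <= r0 by rewrite le_max; apply/orP; right; lra.
have r01 : r0 < 1 by rewrite gt_max; apply/andP; split; lra.
have rd : 1 - d / 2 <= r0 by rewrite le_max lexx.
have [m0 hm0] : exists m0 : nat, K * r0 ^+ m0 < eX.
  have K1 : 0 < K + 1 by lra.
  have r001 : 0 <= r0 < 1 by rewrite r00 r01.
  have [m hm] := natM_expr_small r001 (divr_gt0 eX0 K1); exists m.
  have rm : 0 <= r0 ^+ m by exact: exprn_ge0.
  have h1 : r0 ^+ m <= eX / (K + 1).
    by apply: le_trans hm; rewrite ler_peMl// lerDr mulr_ge0.
  apply: (@le_lt_trans _ _ (K * (eX / (K + 1)))); first by rewrite ler_wpM2l.
  by rewrite mulrA ltr_pdivrMr// mulrC; rewrite ltr_pM2l//; lra.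
clearbody r0.
(* [k0] serves the integral bound of the family, [N.+2] holomorphy at 0, and [m0] the smallness of
   the correction up to radius [r0]. *)
pose k := maxn k0 (N.+2 + m0).
have kk0 : (k0 <= k)%N by rewrite leq_maxl.
have kN : (N.+2 + m0 <= k)%N by rewrite leq_maxr.
clearbody k.
have [th ith [rth hthk]] := hth k kk0.
pose h := kdisc g A N M k.
have circ t : 0 <= t <= 2 * pi -> nr (h (E t) - (g (E t) + A t (E (k%:R * t)))) < e / 4.
  move=> ht; have -> : h (E t) - (g (E t) + A t (E (k%:R * t))) =
     \sum_(l < M) (kap N M l (E t) : R[i]) *: A (node M l) (E t ^+ k) - A t (E t ^+ k).
    by rewrite /h /kdisc EX opprD addrACA subrr add0r.
  by apply: hNM => //; rewrite -EX; exact: circle_closed (unit_circleE _).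
have e41 : e / 4 < e by lra.
have hh : hdisc h := kdisc_hdisc dg hA M (leq_trans (leq_addr m0 N.+2) kN).
have [Nk mk kN0] := arith _ _ _ kN.
have hb z : closed_disc z -> nr (h z - g z) <= K * nr z ^+ (k - N) by exact: hK.
have hE z : h z = g z + \sum_(l < M) (kap N M l z : R[i]) *: A (node M l) (z ^+ k) by [].
clearbody h.
exists h; split.
- split.
  + exact: hh.
  + move=> z Dz; have [zr|zr] := leP (nr z) r0.
      apply: (hX z (h z) Dz); apply: le_lt_trans (hb z Dz) _.
      apply: le_lt_trans hm0; rewrite ler_wpM2l//.
      apply: (@le_trans _ _ (r0 ^+ (k - N))).
        by apply: lerXn2r; rewrite ?nnegrE ?nr_ge0.
      by apply: ler_wiXn2l => //; exact: ltW.
    have [t ht zt] := polar z.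
    have z1 := proj1 (closed_discP _) Dz.
    have zE : nr (z - E t) < d.
      have -> : z - E t = ((nr z - 1)%:C * E t : C) by rewrite {1}zt rmorphB /= mulrBl mul1r.
      rewrite nrM nr_real nr_E mulr1 ler0_norm; lra.
    have [g1 kp] := hd (E t) z (unit_circleE t) Dz zE.
    have Dzk := closed_discX k Dz.
    have [mX _] := mar t ht; apply: (mX (z ^+ k) (h z) Dzk).
    have -> : h z - (g (E t) + A t (z ^+ k)) = (g z - g (E t)) +
       ((\sum_(l < M) ((kap N M l z - kap N M l (E t) : C) : R[i]) *: A (node M l) (z ^+ k)) +
        (\sum_(l < M) (kap N M l (E t) : R[i]) *: A (node M l) (z ^+ k) - A t (z ^+ k))).
      under [X in _ = _ + (X + _)]eq_bigr do rewrite scalerBl.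
      have key (x y s1 s2 a : V) : x + s1 - (y + a) = (x - y) + ((s1 - s2) + (s2 - a)).
        by rewrite [s1 - s2 + _]addrA subrK opprD addrACA.
      by rewrite hE sumrB; exact: key.
    apply: le_lt_trans (nrD _ _) _; apply: le_lt_trans (lerD (lexx _) (nrD _ _)) _.
    have s1 : nr (\sum_(l < M) ((kap N M l z - kap N M l (E t) : C) : R[i]) *: A (node M l) (z ^+ k)) <= M%:R * (eta * B).
      apply: le_trans (nr_sum _ _) _.
      rewrite mulr_natl -[X in _ *+ X]card_ord -sumr_const; apply: ler_sum => l _.
      rewrite nrZ ler_pM ?nr_ge0//; first by apply: ltW; exact: kp.
      by apply: hB => //; exact: node_range.
    have s2 := hNM t (z ^+ k) ht Dzk.
    lra.
  + move=> z /unit_circleP /E_surj [t ht ->].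
    have [_ mW] := mar t ht; apply: (mW (E (k%:R * t))); first exact: unit_circleE.
    exact: lt_trans (circ t ht) e41.
- apply/eqP; rewrite -subr_eq0; apply/eqP; apply: nr_eq0; apply/eqP; rewrite eq_le nr_ge0 andbT.
  have D0 : closed_disc (0 : C) by apply/closed_discP; rewrite nr0.
  apply: le_trans (hb 0 D0) _.
  by rewrite nr0 expr0n kN0 mulr0.
- apply: le_trans (circle_mean_le ith _) _.
    move=> t ht; apply: hthk => //; exact: lt_trans (circ t ht) e41.
  by rewrite lee_fin ler_wpM2l// invr_ge0; lra.
Qed.

End KernelDiscMean.

(** * The gluing lemma *)

Section Gluing.
Context {R : realType} {n : nat}.
Local Notation C := (R[i]^o).
Local Notation V := ('rV[R[i]^o]_n).

Variables (X W : set V) (phi : V -> \bar R) (g : C -> V) (chi : C -> \bar R) (Pc : C -> (C -> V) -> Prop).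
Hypothesis oX : open X.
Hypothesis oW : open W.
Hypothesis uphi : usc_on W phi.
Hypothesis dg : hdisc g.
Hypothesis gX : forall z, closed_disc z -> X (g z).
Hypothesis uchi : usc_on unit_circle chi.
(* Pc z distinguishes among the discs centred at g z a class of discs that can all
   be joined (H2), and that persist under a small displacement of z (H1). *)
Hypothesis H1 : forall z (c : R), unit_circle z -> (chi z < c%:E)%E -> exists f,
  [/\ adisc X W f, f 0 = g z, (circle_mean (phi \o f) < c%:E)%E &
      exists2 d : R, 0 < d & forall z', unit_circle z' -> nr (z' - z) < d -> Pc z' (fun w => g z' + (f w - g z))].
Hypothesis H2 : forall z f f', unit_circle z -> adisc X W f -> adisc X W f' -> f 0 = g z -> f' 0 = g z ->
  Pc z f -> Pc z f' -> dpath X W (g z) f f'.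

(** [a] is the displacement of a disc from its centre, with one majorant [P] and one margin [e] that
    serve all its translates to [g z'] for [z'] near [z]. *)
Let good (Q : {poly R[i]}) (eps d : R) (z : C) (a : C -> V) (P : {poly R[i]}) (e : R) :=
  [/\ 0 < e, hdisc a, a 0 = 0 & forall z', unit_circle z' -> nr (z' - z) < d ->
    [/\ margin X W phi e (fun w => g z' + a w) (pc P), pc P 0 <= pc Q z' + eps & Pc z' (fun w => g z' + a w)]].

(** A translation of the disc from [H1] by g(z') - g(z) uses up half of its margin, and Re Q varies
    by less than [eps]. The disc found at [z] also serves the points [z0] near [z], so compactness
    gives one radius. *)
Lemma good_local Q eps : 0 < eps -> (forall z, unit_circle z -> (chi z < (pc Q z)%:E)%E) ->
  exists2 d : R, 0 < d & forall z, unit_circle z -> exists a P e, good Q eps d z a P e.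
Proof.
move=> eps0 hQ.
have [d d' z d0 dd' [a [P [e [h1 h2 h3 h4]]]]|z Tz|d d0 hd] := @compact_unif R C unit_circle
  (fun d z => exists a P e, good Q eps d z a P e) compact_unit_circle.
- exists a, P, e; split => // z' Tz' zz'; apply: h4 => //; exact: lt_le_trans dd'.
- have [f [af f0 mf [d1 d10 hd1]]] := H1 Tz (hQ z Tz).
  have [hf _ fW] := af.
  have cT : cont_on unit_circle f by apply: cont_onS hf.1 => w; exact: circle_closed.
  have [P [hP P0]] := trig_majorant (usc_comp uphi cT fW) mf.
  have [e e0 [m1 m2]] := adisc_margin oX oW uphi af hP.
  have e2 : 0 < e / 2 by lra.
  have [d2 d20 hd2] := dg.1 z (circle_closed Tz) _ e2.
  have [d3 d30 hd3] := pc_cont Q z eps0.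
  pose d := Order.min d1 (Order.min d2 d3).
  have d0 : 0 < d by rewrite !lt_min d10 d20.
  have [dd1 [dd2 dd3]] : d <= d1 /\ d <= d2 /\ d <= d3 by rewrite /d !ge_min !lexx !orbT.
  clearbody d.
  exists (d / 2); first lra.
  apply/nbhs_nrP; exists (d / 2); first lra.
  move=> z0 z0z Tz0; exists (fun w => f w - g z), P, (e / 2); split; first exact: e2.
  + exact: (hdiscD hf (hdisc_cst (- g z))).
  + by rewrite f0 subrr.
  move=> z' Tz' z'z0.
  have z'z : nr (z' - z) < d.
    have -> : z' - z = (z' - z0) + (z0 - z) by rewrite addrA subrK.
    by apply: le_lt_trans (nrD _ _) _; lra.
  have near w y : nr (y - (g z' + (f w - g z))) < e / 2 -> nr (y - f w) < e.
    move=> hy; have -> : y - f w = (y - (g z' + (f w - g z))) + (g z' - g z).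
      by rewrite opprD opprB !addrA [RHS](ACl ((1*4)*(2*5)*(3*6)))%AC /= addNr subrr !addr0.
    have := hd2 z' (circle_closed Tz') (lt_le_trans z'z dd2).
    by have := nrD (y - (g z' + (f w - g z))) (g z' - g z); lra.
  split.
  + split=> w y hw hy; [exact: m1 w y hw (near w y hy)|exact: m2 w y hw (near w y hy)].
  + have := hd3 z' (lt_le_trans z'z dd3); rewrite ltr_norml => /andP[? ?]; lra.
  + exact: hd1 z' Tz' (lt_le_trans z'z dd1).
- by exists d.
Qed.

Lemma gluing (c : R) : (circle_mean chi < c%:E)%E ->
  exists h, [/\ adisc X W h, h 0 = g 0 & (circle_mean (phi \o h) < c%:E)%E].
Proof.
(* Passing from [chi] to [pc Q] gives a continuous function with which the means of the discs are
   compared along the circle. *)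
move=> mc; have [Q [hQ Q0]] := trig_majorant uchi mc.
(* The final mean is at most Re Q(0) + eps + eps / pi, hence at most Re Q(0) + 2 eps < c. *)
pose eps := (c - pc Q 0) / 4; have eps0 : 0 < eps by rewrite /eps; lra.
have [d d0 hd] := good_local eps0 hQ.
have p0 := pi_gt0 R.
have hex (z : C) : exists t : (C -> V) * {poly R[i]} * R, unit_circle z -> good Q eps d z t.1.1 t.1.2 t.2.
  have [Tz|nT] := pselect (unit_circle z).
    by have [a [P [e h]]] := hd z Tz; exists (a, P, e).
  by exists (fun=> 0, 0, 0).
have [T hT] := choice hex.
(* As [E] is 2-Lipschitz, arcs of length [L] with [2 * L < d] lie within [d] of their starting
   points. *)
pose m := (Num.truncn (4 * pi / d)).+1.
have m0 : 0 < m%:R :> R by rewrite ltr0n.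
have hm : 4 * pi / d < m%:R by exact: truncnS_gt.
clearbody m.
pose L : R := 2 * pi / m%:R.
have L0 : 0 < L by rewrite divr_gt0//; lra.
have mL : m%:R * L = 2 * pi by rewrite /L mulrC divfK// gt_eqF.
have Ld : 2 * L < d.
  rewrite /L; have -> : 2 * (2 * pi / m%:R) = 4 * pi / m%:R :> R by field; rewrite gt_eqF.
  by move: hm; rewrite !ltr_pdivrMr// [d * _]mulrC.
clearbody L.
pose z (j : nat) : C := E (j%:R * L).
(* The [m] arcs cost [2 * del] each, [2 * eps] in all. *)
pose del := eps / m%:R; have del0 : 0 < del by rewrite divr_gt0.
have gz j : good Q eps d (z j) (T (z j)).1.1 (T (z j)).1.2 (T (z j)).2 by apply: hT; exact: unit_circleE.
have arc j t : j%:R * L <= t <= j.+1%:R * L -> nr (E t - z j) < d.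
  move=> /andP[t1 t2]; apply: le_lt_trans (E_lip _ _) _; apply: le_lt_trans Ld.
  rewrite ler_pM2l// ger0_norm ?subr_ge0//; rewrite -[j.+1%:R]natr1 in t2; lra.
have adm j z' : unit_circle z' -> nr (z' - z j) < d -> adisc X W (fun w => g z' + (T (z j)).1.1 w).
  move=> Tz' hz'; have [e0 ha a0 /(_ z' Tz' hz')[[m1 m2] _ _]] := gz j; split.
  - exact: (hdiscD (hdisc_cst (g z')) ha).
  - by move=> w Dw; apply: (m1 w) => //; rewrite subrr nr0.
  - by move=> w Tw; apply: (m2 w _ Tw _).1; rewrite subrr nr0.
have mm1 : (m.-1 < m)%N by case: (m) m0 => //; rewrite ltxx.
have mS : m.-1.+1 = m by case: (m) m0 => //; rewrite ltxx.
have [||||A [fA A0 A1]] := family_chain (X := X) (W := W) (phi := phi) (g := g) (m := m) (L := L) oX oW uphi dg (pcE1_cont (P:=Q))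
  (c := fun j => (T (z j)).1.1) (P := fun j => (T (z j)).1.2) (e := fun j => (T (z j)).2) (eps := eps) (del := del) L0 del0 (ltW eps0) _ _ _ _ mm1.
- by move=> j; have [] := gz j.
- by move=> j _; have [_ ? ? _] := gz j.
- move=> j t _ ht; have [_ _ _ h] := gz j.
  by have [? ? _] := h _ (unit_circleE t) (arc j t ht).
- move=> j _; have jj : j%:R * L <= j.+1%:R * L <= j.+1%:R * L.
    by rewrite lexx andbT ler_wpM2r ?ler_nat// ltW.
  have hj := arc j _ jj.
  have hj' : nr (E (j.+1%:R * L) - z j.+1) < d by rewrite subrr nr0.
  have [_ _ a0 /(_ _ (unit_circleE _) hj)[_ _ P1]] := gz j.
  have [_ _ a1 /(_ _ (unit_circleE _) hj')[_ _ P2]] := gz j.+1.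
  have c0 : g (E (j.+1%:R * L)) + (T (z j)).1.1 0 = g (E (j.+1%:R * L)) by rewrite a0 addr0.
  have c1 : g (E (j.+1%:R * L)) + (T (z j.+1)).1.1 0 = g (E (j.+1%:R * L)) by rewrite a1 addr0.
  exact: (H2 (unit_circleE _) (adm j _ (unit_circleE _) hj) (adm j.+1 _ (unit_circleE _) hj') c0 c1 P1 P2).
rewrite mS mL in fA A1.
(* [T] is chosen as a function of the point of the circle and not of the index; since [z m = z 0],
   the chain ends with the disc with which it began. *)
have A02 w : closed_disc w -> A 0 w = A (2 * pi) w.
  move=> Dw; rewrite A0// A1//; have -> // : z m = z 0%N.
  by rewrite /z mL E2pi mul0r E0.
have [h [ah h0 mh]] := kernel_disc oX dg gX fA A02.
exists h; split => //; apply: le_lt_trans mh _; rewrite lte_fin.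
have rG : rint 0 (2 * pi) (fun t => pc Q (E t)) = 2 * pi * pc Q 0 by exact: rint_pc.
rewrite rG.
have -> : 2 * del * m%:R = 2 * eps by rewrite /del; field; rewrite gt_eqF.
have -> : (2 * pi)^-1 * (2 * pi * pc Q 0 + (eps * (2 * pi) + 2 * eps)) = pc Q 0 + eps + eps / pi.
  by move: p0; move: (pi : R) => q q0; field; rewrite gt_eqF.
have : eps / pi <= eps by rewrite ler_pdivrMr// ler_peMr ?(ltW eps0)//; have := pi_ge2 R; lra.
rewrite /eps; lra.
Qed.

End Gluing.

(** * Joining discs with the same centre *)

Section Paths.
Context {R : realType} {n : nat}.
Local Notation C := (R[i]^o).
Local Notation V := ('rV[R[i]^o]_n).

Lemma cont_on_unif {V' : normedModType R[i]} (K : set C) (f : C -> V') (e : R) : compact K -> cont_on K f -> 0 < e ->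
  exists2 d : R, 0 < d & forall z, K z -> forall w, K w -> nr (w - z) < d -> nr (f w - f z) < e.
Proof.
move=> cK cf e0.
apply: (@compact_unif R C K (fun d z => forall w, K w -> nr (w - z) < d -> nr (f w - f z) < e) cK).
- by move=> d d' z d0 dd' h w Kw wz; apply: h => //; exact: lt_le_trans dd'.
- move=> z Kz; have e2 : 0 < e / 2 by lra.
  have [d d0 hd] := cf z Kz _ e2.
  exists (d / 2); first lra.
  apply/nbhs_nrP; exists (d / 2); first lra.
  move=> y yz Ky w Kw wy.
  have wz : nr (w - z) < d.
    have -> : w - z = (w - y) + (y - z) by rewrite addrA subrK.
    by apply: le_lt_trans (nrD _ _) _; lra.
  have -> : f w - f y = (f w - f z) - (f y - f z) by rewrite opprB addrA subrK.
  have h1 := hd w Kw wz; have h2 : nr (f y - f z) < e / 2 by apply: hd => //; lra.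
  by apply: le_lt_trans (nrD _ _) _; rewrite nrN; lra.
Qed.

Lemma dpath_sym (X W : set V) x f0 f1 : dpath X W x f0 f1 -> dpath X W x f1 f0.
Proof.
move=> [F [aF eF F0 F1]]; exists (fun t => F (1 - t)).
have flip (t : R) : 0 <= t <= 1 -> 0 <= 1 - t <= 1 by move=> /andP[? ?]; apply/andP; split; lra.
split.
- by move=> t /flip; exact: aF.
- move=> e /eF[d d0 hd]; exists d => // t t' /flip ht /flip ht' tt'; apply: hd => //.
  have -> : 1 - t - (1 - t') = t' - t by lra.
  by rewrite distrC.
- by move=> z Dz; rewrite subr0; exact: F1.
- by move=> z Dz; rewrite subrr; exact: F0.
Qed.

Lemma dpath_trans (X W : set V) x f0 f1 f2 : dpath X W x f0 f1 -> dpath X W x f1 f2 -> dpath X W x f0 f2.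
Proof.
move=> [F [aF eF F0 F1]] [G [aG eG G1 G2]].
pose H (t : R) := if t <= 1 / 2 then F (2 * t) else G (2 * t - 1).
have case1 (t : R) : 0 <= t <= 1 -> (0 <= 2 * t <= 1 /\ t <= 1 / 2 = true) \/ (0 <= 2 * t - 1 <= 1 /\ t <= 1 / 2 = false).
  by move=> /andP[h1 h2]; have [tb|tb] := leP t (1 / 2); [left|right]; split => //; apply/andP; split; lra.
exists H; split.
- by move=> t /case1[[ht h]|[ht h]]; rewrite /H h; [exact: aF|exact: aG].
- move=> e e0; have e2 : 0 < e / 2 by lra.
  have [d1 d10 h1] := eF _ e2; have [d2 d20 h2] := eG _ e2.
  pose d := Order.min d1 d2.
  have [dd1 dd2] : d <= d1 /\ d <= d2 by rewrite /d !ge_min !lexx orbT.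
  have d0 : 0 < d by rewrite lt_min d10.
  clearbody d; exists (d / 2); first lra.
  have u0 : 0 <= (0 : R) <= 1 by rewrite lexx ler01.
  have u1 : 0 <= (1 : R) <= 1 by rewrite lexx ler01.
  have mixed (t t' : R) : 0 <= 2 * t <= 1 -> 0 <= 2 * t' - 1 <= 1 -> `|t - t'| < d / 2 ->
      forall z, closed_disc z -> nr (F (2 * t) z - G (2 * t' - 1) z) < e.
    move=> ht ht' tt' z Dz; move: (ht) (ht') tt' => /andP[? ?] /andP[? ?]; rewrite ltr_norml => /andP[? ?].
    have -> : F (2 * t) z - G (2 * t' - 1) z = (F (2 * t) z - F 1 z) + (G 0 z - G (2 * t' - 1) z).
      by rewrite F1// G1// addrA subrK.
    have y1 : `|2 * t - 1| < d1 by rewrite ltr_norml; apply/andP; split; lra.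
    have y2 : `|0 - (2 * t' - 1)| < d2 by rewrite ltr_norml; apply/andP; split; lra.
    have z1 := h1 _ _ ht u1 y1 z Dz; have z2 := h2 _ _ u0 ht' y2 z Dz.
    by apply: le_lt_trans (nrD _ _) _; lra.
  move=> t t' /case1[[ht h]|[ht h]] /case1[[ht' h']|[ht' h']]; rewrite /H h h' => tt' z Dz.
  + apply: (@lt_trans _ _ (e / 2)); last lra.
    apply: h1 => //; move: tt'; rewrite !ltr_norml => /andP[? ?]; apply/andP; split; lra.
  + exact: mixed.
  + by rewrite nrBC; apply: mixed => //; rewrite distrC.
  + apply: (@lt_trans _ _ (e / 2)); last lra.
    apply: h2 => //; move: tt'; rewrite !ltr_norml => /andP[? ?]; apply/andP; split; lra.
- move=> z Dz; rewrite /H; have -> : (0 : R) <= 1 / 2 by lra.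
  by rewrite mulr0; exact: F0.
- move=> z Dz; rewrite /H; have -> : ((1 : R) <= 1 / 2) = false by apply/negbTE; rewrite -ltNge; lra.
  have -> : 2 * 1 - 1 = 1 :> R by lra.
  exact: G2.
Qed.

Lemma dpath_line (X W : set V) x f0 f1 : hdisc f0 -> hdisc f1 -> f0 0 = x -> f1 0 = x ->
  (forall (t : R) z, 0 <= t <= 1 -> closed_disc z -> X (f0 z + (t%:C : R[i]) *: (f1 z - f0 z))) ->
  (forall (t : R) z, 0 <= t <= 1 -> unit_circle z -> W (f0 z + (t%:C : R[i]) *: (f1 z - f0 z))) ->
  dpath X W x f0 f1.
Proof.
move=> h0 h1 x0 x1 hX hW.
have hZ (k : R[i]) f : hdisc f -> hdisc (fun z => k *: f z : V).
  move=> [cf df]; split.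
    move=> z Dz e e0; have K1 : 0 < nr (k : C) + 1 by have := nr_ge0 (k : C); lra.
    have [d d0 hd] := cf z Dz _ (divr_gt0 e0 K1); exists d => // y Dy yz.
    rewrite -scalerBr nrZ; have := hd y Dy yz; rewrite ltr_pdivlMr// => h.
    apply: le_lt_trans h; rewrite mulrC ler_wpM2l ?nr_ge0//; lra.
  move=> z /df[b hb]; exists ((0 : R[i]) *: f z + k *: b).
  exact: (cdiffZ (cdiff_cst (k : C) z) hb).
have hd : hdisc (fun z => f1 z - f0 z).
  have -> : (fun z => f1 z - f0 z) = (fun z => f1 z + (-1 : R[i]) *: f0 z) by apply/funext => z; rewrite scaleN1r.
  exact: (hdiscD h1 (hZ _ _ h0)).
exists (fun t z => f0 z + (t%:C : R[i]) *: (f1 z - f0 z)); split.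
- move=> t ht; split; last by rewrite x0 x1 subrr scaler0 addr0.
  split; [exact: (hdiscD h0 (hZ _ _ hd))|by move=> z Dz; exact: hX|by move=> z Tz; exact: hW].
- have [B B0 hB] := hdisc_bounded hd.
  move=> e e0; have B1 : 0 < B + 1 by lra.
  exists (e / (B + 1)); first exact: divr_gt0.
  move=> t t' _ _; rewrite ltr_pdivlMr// => tt' z Dz.
  have -> : f0 z + (t%:C : R[i]) *: (f1 z - f0 z) - (f0 z + (t'%:C : R[i]) *: (f1 z - f0 z)) = ((t - t')%:C : R[i]) *: (f1 z - f0 z).
    by rewrite opprD addrACA subrr add0r rmorphB /= scalerBl.
  rewrite nrZ nr_real; apply: le_lt_trans tt'; rewrite ler_wpM2l//.
  by have := hB z Dz; lra.
- by move=> z _; rewrite scale0r addr0.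
- by move=> z _; rewrite scale1r addrC subrK.
Qed.

Lemma hdisc_shrink (f : C -> V) (s : R) : 0 <= s <= 1 -> hdisc f -> hdisc (fun z => f (s%:C * z)).
Proof.
move=> /andP[s0 s1] [cf df].
have ns (z : C) : nr (s%:C * z : C) <= nr z by rewrite nrM nr_real ger0_norm// ler_piMl ?nr_ge0.
split.
  move=> z /closed_discP Dz e e0.
  have Dsz : closed_disc (s%:C * z : C) by apply/closed_discP; exact: le_trans (ns z) Dz.
  have [d d0 hd] := cf _ Dsz e e0; exists d => // y /closed_discP Dy yz; apply: hd.
    by apply/closed_discP; exact: le_trans (ns y) Dy.
  by rewrite -mulrBr; exact: le_lt_trans (ns _) yz.
move=> z /open_discP Dz.
have Dsz : open_disc (s%:C * z : C) by apply/open_discP; exact: le_lt_trans (ns z) Dz.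
have [b hb] := df _ Dsz.
exists (((0 : C) * z + s%:C * 1 : R[i]) *: b).
exact: (cdiff_comp hb (cdiffM (cdiff_cst (s%:C : C) z) (cdiff_id z))).
Qed.

(** The path z |-> f((1 - t) z) draws the boundary through the interior of the disc, so it remains
    in the class when the boundary is only required to lie in [X]. *)
Lemma dpath_contract (X : set V) f : adisc X X f -> dpath X X (f 0) f (fun=> f 0).
Proof.
move=> [hf fX _].
have shr (s : R) z : 0 <= s <= 1 -> closed_disc z -> closed_disc (s%:C * z : C).
  move=> /andP[s0 s1] /closed_discP Dz; apply/closed_discP; rewrite nrM nr_real ger0_norm//.
  by apply: le_trans Dz; rewrite ler_piMl ?nr_ge0.
have flip (t : R) : 0 <= t <= 1 -> 0 <= 1 - t <= 1 by move=> /andP[? ?]; apply/andP; split; lra.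
exists (fun t z => f ((1 - t)%:C * z)); split.
- move=> t /flip ht; split; last by rewrite mulr0.
  split; [exact: hdisc_shrink|by move=> z Dz; apply: fX; exact: shr|by move=> z /circle_closed Dz; apply: fX; exact: shr].
- move=> e e0; have [d d0 hd] := cont_on_unif compact_closed_disc hf.1 e0.
  exists d => // t t' /flip ht /flip ht' tt' z Dz; apply: hd; [exact: shr|exact: shr|].
  rewrite -mulrBl -rmorphB nrM nr_real.
  have -> : 1 - t - (1 - t') = - (t - t') by lra.
  rewrite normrN; apply: le_lt_trans tt'; rewrite ler_piMr//; exact/closed_discP.
- by move=> z _; rewrite subr0 mul1r.
- by move=> z _; rewrite subrr mul0r.
Qed.

(** Joint continuity on the compact set of pairs (z, t) becomes continuity in [t] uniformly in
    [z]. *)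
Lemma dpath_homotopic (X W : set V) f0 f1 : centre_homotopic X W f0 f1 -> dpath X W (f0 0) f0 f1.
Proof.
move=> [F [cF aF F0 F1]]; exists (fun t z => F (z, t)); split => //.
- move=> t ht; have [] := aF t ltac:(by rewrite in_itv) => /adiscP; by split.
- move=> e e0; have e2 : 0 < e / 2 by lra.
  have cK : compact (closed_disc `*` `[0, 1] : set (C * R)).
    by apply: compact_setX; [exact: compact_closed_disc|exact: segment_compact].
  have [d d' p d0 dd'|x Kx|d d0 hd] := @compact_unif R (C * R)%type (closed_disc `*` `[0, 1])
    (fun d p => forall t, 0 <= t <= 1 -> `|p.2 - t| < d -> nr (F (p.1, p.2) - F (p.1, t)) < e) cK.
  + by move=> h t ht pt; apply: h => //; exact: lt_le_trans dd'.
  + move/subspace_continuousP : cF => /(_ x Kx [set y | nr (y - F x) < e / 2]).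
    have /[swap]/[apply] : nbhs (F x) [set y | nr (y - F x) < e / 2] by apply/nbhs_nrP; exists (e / 2).
    move=> [[A B] /= [/nbhs_nrP[d1 d10 hA] /nbhs_ballP[d2 d20 hB]] AB].
    exists (d2 / 2); first by rewrite /= in d20; lra.
    exists (A, [set s | ball x.2 (d2 / 2) s]).
      split; first by apply/nbhs_nrP; exists d1.
      by apply/nbhs_ballP; exists (d2 / 2) => //=; rewrite /= in d20; lra.
    move=> [z s] /= [Az bs] [Dz Is] t ht st; rewrite /= in_itv /= in Is.
    have Fzs : nr (F (z, s) - F x) < e / 2.
      apply: (AB (z, s)) ; last by split => //=; rewrite in_itv.
      by split => //; apply: hB; apply: le_ball bs; rewrite /= in d20; lra.
    have Fzt : nr (F (z, t) - F x) < e / 2.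
      apply: (AB (z, t)) ; last by split => //=; rewrite in_itv.
      split => //; apply: hB; rewrite /ball /= in bs *.
      have := ler_normD (x.2 - s) (s - t); rewrite addrA subrK; lra.
    have -> : F (z, s) - F (z, t) = (F (z, s) - F x) - (F (z, t) - F x) by rewrite opprB addrA subrK.
    by apply: le_lt_trans (nrD _ _) _; rewrite nrN; lra.
  + exists d => // t t' ht ht' tt' z Dz.
    by apply: (hd (z, t)) => //; split => //=; rewrite in_itv.
Qed.

End Paths.

(** * Disc envelopes *)

Section Envelopes.
Context {R : realType} {n : nat}.
Local Notation C := (R[i]^o).
Local Notation V := ('rV[R[i]^o]_n).

Lemma nbhs_uniform_nr (b : {uniform` (closed_disc : set C) -> V}) (e : R) : 0 < e ->
  nbhs b [set h | forall z, closed_disc z -> nr (h z - b z) < e].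
Proof.
move=> e0; apply/uniform_nbhs; exists [set p | nr (p.2 - p.1) < e]; split; last by move=> h.
have eC : 0 < e%:C :> R[i] by rewrite ltcR.
rewrite -entourage_ballE; exists e%:C => // -[x y] /=; rewrite -ball_normE /= nrBC nrE ltcR; exact.
Qed.

(** Comparison with every real [c > a] also covers the value [-oo]. *)
Lemma circle_mean_cst_le (a : \bar R) : (a < +oo)%E -> (circle_mean (fun=> a : \bar R) <= a)%E.
Proof.
move=> a1; rewrite leNgt; apply/negP => /ereal_between[c [ac ca]].
have h : (circle_mean (fun=> a) <= (pc (c%:C)%:P 0)%:E)%E by apply: circle_mean_pc => z _; rewrite pc_cst ltW.
by move: ca; rewrite ltNge; move: h; rewrite pc_cst => ->.
Qed.

(** A mean below [c] is an open condition on the disc: a majorant Re P with Re P(0) < c still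
    majorises [phi] along all nearby discs. The semicontinuity of both envelopes rests on this. *)
Lemma disc_perturb (X W : set V) (phi : V -> \bar R) f (c : R) : open X -> open W -> usc_on W phi -> adisc X W f ->
  (circle_mean (phi \o f) < c%:E)%E ->
  exists2 e : R, 0 < e & forall f', hdisc f' -> (forall z, closed_disc z -> nr (f' z - f z) < e) ->
    adisc X W f' /\ (circle_mean (phi \o f') < c%:E)%E.
Proof.
move=> oX oW uphi af mf; have [hf fX fW] := af.
have cT : cont_on unit_circle f by apply: cont_onS hf.1 => w; exact: circle_closed.
have [P [hP P0]] := trig_majorant (usc_comp uphi cT fW) mf.
have [e e0 [m1 m2]] := adisc_margin oX oW uphi af hP.
exists e => // f' hf' ff'; split.
  split => //; first by move=> z Dz; exact: m1 z _ Dz (ff' z Dz).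
  by move=> z Tz; have [] := m2 z _ Tz (ff' z (circle_closed Tz)).
apply: (@le_lt_trans _ _ (pc P 0)%:E); last by rewrite lte_fin.
apply: circle_mean_pc => z Tz /=; apply: ltW.
by have [] := m2 z _ Tz (ff' z (circle_closed Tz)).
Qed.

Lemma adisc_mean_lty (X W : set V) (phi : V -> \bar R) f : usc_on W phi -> adisc X W f -> (circle_mean (phi \o f) < +oo)%E.
Proof.
move=> uphi af; have [B B0 hB] := adisc_bounded uphi af.
apply: (@le_lt_trans _ _ B%:E); last exact: ltry.
have := @circle_mean_pc R (B%:C)%:P (phi \o f); rewrite pc_cst; apply => z Tz; rewrite pc_cst ltW//; exact: hB.
Qed.

Lemma adisc_cst (X W : set V) x : X x -> W x -> adisc X W (fun=> x).
Proof. by move=> Xx Wx; split => //; exact: hdisc_cst. Qed.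

Section DiscEnvelope.
Variables (X : set V) (psi : V -> \bar R).
Hypothesis oX : open X.
Hypothesis upsi : usc_on X psi.
Let u := envelope_disc X X psi.

Lemma envelope_disc_lt x (a : \bar R) : (u x < a)%E -> exists f, [/\ adisc X X f, f 0 = x & (circle_mean (psi \o f) < a)%E].
Proof. by move=> /ereal_inf_lt[_ [f [/adiscP af f0] <-] h]; exists f. Qed.

Lemma envelope_disc_le f : adisc X X f -> (u (f 0%R) <= circle_mean (psi \o f))%E.
Proof. by move=> af; apply: ereal_inf_lbound; exists f => //; split => //; exact/adiscP. Qed.

Lemma envelope_disc_le_psi x : X x -> (u x <= psi x)%E.
Proof.
move=> Xx; apply: le_trans (envelope_disc_le (adisc_cst Xx Xx)) _.
by apply: circle_mean_cst_le; have [] := upsi Xx.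
Qed.

(** A nearly optimal disc at [x], translated by [y - x], competes at [y]. *)
Lemma envelope_disc_usc : usc_on X u.
Proof.
apply: usc_onP => [x Xx|x a Xx /envelope_disc_lt[f [af f0 mf]]].
  by apply: le_lt_trans (envelope_disc_le_psi Xx) _; have [] := upsi Xx.
have [e e0 he] := disc_perturb oX oX upsi af mf.
exists e => // y Xy yx.
have hf : hdisc (fun z => f z + (y - x)) by have [hf _ _] := af; exact: (hdiscD hf (hdisc_cst (y - x))).
have [af' mf'] := he _ hf ltac:(by move=> z _; rewrite addrC addKr).
apply: le_lt_trans mf'; have := envelope_disc_le af'.
by rewrite f0 addrC subrK.
Qed.

(* The gluing lemma with X in the place of W: all discs with a given centre in X
   can be joined, by shrinking them to their centre. *)
Lemma envelope_disc_submean g : hdisc g -> (forall z, closed_disc z -> X (g z)) ->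
  (u (g 0%R) <= circle_mean (u \o g))%E.
Proof.
move=> hg gX; rewrite leNgt; apply/negP => /ereal_between[c [mc cu]].
have cT : cont_on unit_circle g by apply: cont_onS hg.1 => w; exact: circle_closed.
have gT z : unit_circle z -> X (g z) by move=> /circle_closed; exact: gX.
have [|z f f' Tz af af' f0 f'0 _ _|h [ah h0 mh]] := gluing (X := X) (W := X) (phi := psi) (g := g) (chi := u \o g)
  (Pc := fun z f => adisc X X f /\ f 0 = g z) oX oX upsi hg gX (usc_comp envelope_disc_usc cT gT) _ _ mc.
- move=> z a Tz /envelope_disc_lt[f [af f0 mf]].
  exists f; split => //.
  have [e e0 he] := disc_perturb oX oX upsi af mf.
  have [d d0 hd] := hg.1 z (circle_closed Tz) e e0.
  exists d; first exact: d0.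
  move=> z' Tz' z'z; split; last by rewrite f0 subrr addr0.
  have hf : hdisc (fun w => g z' + (f w - g z)).
    have [hf _ _] := af; exact: (hdiscD (hdisc_cst (g z')) (hdiscD hf (hdisc_cst (- g z)))).
  have hfw w : closed_disc w -> nr (g z' + (f w - g z) - f w) < e.
    move=> _; have -> : g z' + (f w - g z) - f w = g z' - g z by rewrite addrA addrAC addrK.
    exact: hd z' (circle_closed Tz') z'z.
  by have [af' _] := he _ hf hfw; exact: af'.
- apply: (@dpath_trans _ _ X X (g z) f (fun=> g z)); first by rewrite -f0; exact: dpath_contract.
  by apply: dpath_sym; rewrite -f'0; exact: dpath_contract.
- have := lt_trans mh cu; rewrite -h0 ltNge => /negP; apply; exact: envelope_disc_le.
Qed.

Lemma hdisc_affine (a b : V) (z0 r : C) : hdisc (fun w => a + ((z0 + r * w : C) : R[i]) *: b).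
Proof.
have aff (w : C) : exists k : C, cdiff (fun w => z0 + r * w : C) w k.
  by exists (0 + (0 * w + r * 1)); exact: (cdiffD (cdiff_cst z0 w) (cdiffM (cdiff_cst r w) (cdiff_id w))).
have aff' w : exists k, cdiff (fun w => a + ((z0 + r * w : C) : R[i]) *: b) w k.
  have [k hk] := aff w.
  exists (0 + ((k : R[i]) *: b + ((z0 + r * w : C) : R[i]) *: 0)).
  exact: (cdiffD (cdiff_cst a w) (cdiffZ hk (cdiff_cst b w))).
split; last by move=> w _; exact: aff'.
by move=> w _ e e0; have [k /cdiff_cont/(_ e e0)[d d0 hd]] := aff' w; exists d => // y _; exact: hd.
Qed.

(** A closed disc on a complex line, parametrised affinely, is an analytic disc in [X], so
    [envelope_disc_submean] contains the sub-mean value property on lines. *)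
Lemma envelope_disc_psh : plurisubharmonic X u.
Proof.
split; first exact: envelope_disc_usc.
move=> a b; split.
  apply: (usc_comp (g := fun z : C => a + (z : R[i]) *: b) envelope_disc_usc); last by [].
  move=> z _ e e0; have b1 : 0 < nr b + 1 by have := nr_ge0 b; lra.
  exists (e / (nr b + 1)); first exact: divr_gt0.
  move=> y _; rewrite ltr_pdivlMr// => h.
  rewrite opprD addrACA subrr add0r -scalerBl nrZ; apply: le_lt_trans h.
  by rewrite ler_wpM2l ?nr_ge0//; lra.
move=> z r r0 zrX.
pose g (w : C) : V := a + ((z + r%:C * w : C) : R[i]) *: b.
have := @envelope_disc_submean g (hdisc_affine a b z r%:C).
rewrite /g mulr0 addr0; apply => w /closed_discP Dw; apply: zrX => /=.
rewrite addrC addKr nrE lecR nrM nr_real gtr0_norm//.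
by rewrite ler_piMr// ltW.
Qed.

End DiscEnvelope.
End Envelopes.

(** * The infimum of the means over the discs of a disc structure *)

Section DiscStructure.
Context {R : realType} {n : nat}.
Local Notation C := (R[i]^o).
Local Notation V := ('rV[R[i]^o]_n).

(** The difference from [b] is the convex combination (1 - t) (y' - y) + t (b' - b). *)
Lemma line_translate_near (b b' y y' : V) (t e : R) : 0 <= t <= 1 -> nr (b' - b) < e -> nr (y' - y) < e ->
  nr (y' + (b - y) + (t%:C : R[i]) *: (b' - (y' + (b - y))) - b) < e.
Proof.
move=> /andP[t0 t1] h1 h2.
have -> : y' + (b - y) = b + (y' - y) by rewrite addrCA.
rewrite [- (b + _)]opprD [b' + _]addrA.
move: (b' - b) (y' - y) h1 h2 => P Q h1 h2.
have -> : b + Q + (t%:C : R[i]) *: (P - Q) - b = ((1 - t)%:C : R[i]) *: Q + (t%:C : R[i]) *: P.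
  rewrite scalerBr rmorphB /= scalerBl scale1r !addrA [LHS](ACl ((1*5)*(2*4*3)))%AC /=.
  by rewrite subrr add0r.
apply: le_lt_trans (nrD _ _) _; rewrite !nrZ !nr_real (ger0_norm t0) ger0_norm ?subr_ge0//.
have [->|tn0] := eqVneq t 0; first by rewrite mul0r addr0 subr0 mul1r.
have tp : 0 < t by rewrite lt_neqAle eq_sym tn0.
have k1 : t * nr P < t * e by rewrite ltr_pM2l.
have k2 : (1 - t) * nr Q <= (1 - t) * e by rewrite ler_wpM2l ?subr_ge0// ltW.
lra.
Qed.

Variables (X W : set V) (phi : V -> \bar R).
Hypothesis oX : open X.
Hypothesis oW : open W.
Hypothesis uphi : usc_on W phi.
Variables (I : Type) (U : I -> set V) (beta : I -> V -> {uniform` (closed_disc : set C) -> V}).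
Hypothesis hbeta : disc_structure X W U beta.

Lemma structure_disc i x : U i x -> adisc X W (beta i x).
Proof. by move=> Uix; exact: (proj1 (adiscP _ _ _) (disc_structure_disc hbeta Uix)). Qed.

Lemma structure_near i x (e : R) : U i x -> 0 < e -> exists2 d : R, 0 < d & forall y, nr (y - x) < d ->
  U i y /\ forall z, closed_disc z -> nr (beta i y z - beta i x z) < e.
Proof.
move=> Uix e0.
have /open_nrP/(_ x Uix)[d1 d10 h1] := disc_structure_open hbeta (i := i).
have cb : {within U i, continuous (beta i)} by exact: disc_structure_continuous hbeta _.
move/subspace_continuousP : cb => /(_ x Uix _ (nbhs_uniform_nr _ e0))/nbhs_nrP[d2 d20 h2].
exists (Order.min d1 d2); first by rewrite lt_min d10.
move=> y; rewrite lt_min => /andP[/h1 Uy y2]; split => //; exact: h2.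
Qed.

(** The function psi. Only the index varies, so that all discs competing at [x] are
    centre-homotopic. *)
Definition structure_mean x := ereal_inf [set circle_mean (phi \o (beta i x : C -> V)) | i in [set i | U i x]].

Lemma structure_mean_usc : usc_on X structure_mean.
Proof.
apply: usc_onP => [x|x a Xx].
  rewrite -(disc_structure_cover hbeta) => -[i _ Uix].
  apply: le_lt_trans (adisc_mean_lty uphi (structure_disc Uix)).
  by apply: ereal_inf_lbound; exists i.
move=> /ereal_inf_lt[_ [i Uix <-] mi].
have [e e0 he] := disc_perturb oX oW uphi (structure_disc Uix) mi.
have [d d0 hd] := structure_near Uix e0.
exists d => // y Xy /hd[Uiy by'].
have [hf _ _] := structure_disc Uiy.
have [_ my] := he _ hf by'.
by apply: le_lt_trans my; apply: ereal_inf_lbound; exists i.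
Qed.

Lemma structure_mean_le i : U i = W -> (forall w z, W w -> closed_disc z -> beta i w z = w) ->
  forall w, W w -> (structure_mean w <= phi w)%E.
Proof.
move=> UW bw w Ww.
apply: (@le_trans _ _ (circle_mean (phi \o (beta i w : C -> V)))).
  by apply: ereal_inf_lbound; exists i => //=; rewrite UW.
apply: (@le_trans _ _ (circle_mean (fun=> phi w))).
  by apply: circle_mean_mono => z /circle_closed Dz; rewrite /= bw.
by apply: circle_mean_cst_le; have [] := uphi Ww.
Qed.

(** Both the translate of [beta i (g z)] and [beta i (g z')] are uniformly near [beta i (g z)], the
    latter by continuity of [beta i]; the segment between them stays in its tubes in [X] and [W].
    This provides the persistence required for gluing. *)
Lemma structure_translate i (g : C -> V) z : hdisc g -> closed_disc z -> U i (g z) ->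
  exists2 d : R, 0 < d & forall z', closed_disc z' -> nr (z' - z) < d -> U i (g z') /\
    dpath X W (g z') (fun w => g z' + (beta i (g z) w - g z)) (beta i (g z')).
Proof.
move=> hg Dz Uz; have [hf fX fW] := structure_disc Uz.
have cT : cont_on unit_circle (beta i (g z)) by apply: cont_onS hf.1 => w; exact: circle_closed.
have [e1 e10 h1] := tube_open compact_closed_disc hf.1 oX fX.
have [e2 e20 h2] := tube_open compact_unit_circle cT oW fW.
pose e := Order.min e1 e2.
have [ee1 ee2] : e <= e1 /\ e <= e2 by rewrite /e !ge_min !lexx orbT.
have e0 : 0 < e by rewrite lt_min e10.
clearbody e.
have [d1 d10 hd1] := structure_near Uz e0.
have m0 : 0 < Order.min d1 e by rewrite lt_min d10.
have [d d0 hd] := hg.1 z Dz _ m0.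
exists d => // z' Dz' z'z; have := hd z' Dz' z'z; rewrite lt_min => /andP[/hd1[Uz' bz'] ge].
split => //.
have [hf' _ _] := structure_disc Uz'.
have close (t : R) w : 0 <= t <= 1 -> closed_disc w ->
    nr (g z' + (beta i (g z) w - g z) + (t%:C : R[i]) *: (beta i (g z') w - (g z' + (beta i (g z) w - g z))) - beta i (g z) w) < e.
  move=> ht Dw; exact: line_translate_near ht (bz' w Dw) ge.
apply: dpath_line.
- exact: (hdiscD (hdisc_cst (g z')) (hdiscD hf (hdisc_cst (- g z)))).
- exact: hf'.
- by rewrite (disc_structure_centre hbeta Uz) subrr addr0.
- exact: (disc_structure_centre hbeta Uz').
- by move=> t w ht Dw; apply: (h1 w) => //; exact: lt_le_trans (close t w ht Dw) ee1.
- move=> t w ht Tw; apply: (h2 w) => //; exact: lt_le_trans (close t w ht (circle_closed Tw)) ee2.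
Qed.

(** The class to be glued consists of the discs that can be joined to some [beta i (g z)]. Two of
    them are joined through [beta i (g z)] and [beta j (g z)], which are centre-homotopic by the
    definition of a disc structure. *)
Lemma envelope_disc_structure g : adisc X X g ->
  (envelope_disc X W phi (g 0%R) <= circle_mean (structure_mean \o g))%E.
Proof.
move=> [hg gX _]; rewrite leNgt; apply/negP => /ereal_between[c [mc cE]].
have cT : cont_on unit_circle g by apply: cont_onS hg.1 => w; exact: circle_closed.
have gT z : unit_circle z -> X (g z) by move=> /circle_closed; exact: gX.
have [|z f f' Tz af af' f0 f'0 [i Ui pi] [j Uj pj]|h [ah h0 mh]] := gluing (X := X) (W := W) (phi := phi) (g := g) (chi := structure_mean \o g)
  (Pc := fun z f => exists2 i, U i (g z) & dpath X W (g z) f (beta i (g z))) oX oW uphi hg gX (usc_comp structure_mean_usc cT gT) _ _ mc.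
- move=> z a Tz /ereal_inf_lt[_ [i Ui <-] mi].
  exists (beta i (g z)); split; [exact: (structure_disc Ui)|exact: (disc_structure_centre hbeta Ui)|exact: mi|].
  have [d d0 hd] := structure_translate hg (circle_closed Tz) Ui.
  exists d => // z' /circle_closed Dz' /(hd z' Dz')[Uz' pz']; by exists i.
- apply: dpath_trans pi _; apply: dpath_trans (dpath_sym pj).
  have := dpath_homotopic (disc_structure_homotopic hbeta Ui Uj).
  by rewrite (disc_structure_centre hbeta Ui).
- have := lt_trans mh cE; rewrite -h0 ltNge => /negP; apply.
  by apply: ereal_inf_lbound; exists h => //; split => //; exact/adiscP.
Qed.

End DiscStructure.

Theorem theorem3 (R : realType) (n : nat) (W X : set 'rV[R[i]^o]_n)
    (phi : 'rV[R[i]^o]_n -> \bar R)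
    (n_gt0 : (0 < n)%N)
    (domW : domain W) (domX : domain X) (WX : W `<=` X)
    (extX : schlicht_disc_extension X W)
    (usc_phi : usc_on W phi) :
  forall x, X x -> envelope_psh X W phi x = envelope_disc X W phi x.
Proof.
move: domW domX => [oW _ _] [oX _ _] x Xx.
have [I [U [beta [hbeta [i0 [Ui0 bi0]]]]]] := extX.
have upsi := structure_mean_usc oX oW usc_phi hbeta.
apply/eqP; rewrite eq_le; apply/andP; split.
- apply: ge_ereal_sup => _ [u [pu uphi] <-]; apply: le_ereal_inf_tmp => _ [f [/adiscP[[cf df] fX fW] <-] <-].
  apply: le_trans (psh_submean_disc oX pu cf df fX) _.
  by apply: circle_mean_mono => z /fW; exact: uphi.
- apply: (@le_trans _ _ (envelope_disc X X (structure_mean phi U beta) x)).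
    apply: le_ereal_inf_tmp => _ [g [/adiscP ag <-] <-].
    exact: (envelope_disc_structure oX oW usc_phi hbeta ag).
  apply: ereal_sup_ubound; exists (envelope_disc X X (structure_mean phi U beta)) => //.
  split; first exact: (envelope_disc_psh oX upsi).
  move=> w Ww; exact: (le_trans (envelope_disc_le_psi upsi (WX w Ww)) (structure_mean_le usc_phi Ui0 bi0 Ww)).
Qed.
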